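(* Let $k\ge1$ and $\mathbf x=(x_1,\dots,x_k)$. The operators $D_d(\mathbf x;q,t)$, $d\in\mathbb N$, defined in the context, are pairwise commutative. In addition, they act diagonally in the basis of Macdonald polynomials $P_\mu(\mathbf x;q,q/t)$, where $\mu$ runs over partitions of length at most $k$, as $$D_d(\mathbf x;q,t)\,P_\mu(\mathbf x;q,q/t)=\frac{(t)_d}{(q)_d}\;P_{(d)}\big(q^{\mu_1},\,q^{\mu_2}(t/q),\,\dots,\,q^{\mu_k}(t/q)^{k-1};\,q,t\big)\;P_\mu(\mathbf x;q,q/t),$$ where $P_{(d)}$ is the Macdonald polynomial of the one-row partition $(d)$, evaluated at the $k$ points $q^{\mu_i}(t/q)^{i-1}$, $1\le i\le k$.
   Context: $q,t,x_1,\dots,x_k$ are indeterminates. $(x)_m=\prod_{i=0}^{m-1}(1-xq^i)$ for $m\ge0$ and $(x)_{-m}=\prod_{i=1}^{m}(1-xq^{-i})^{-1}$ for $m\geq 0$. The difference operator $D_d(\mathbf x;q,t)$ on $\mathbb C(q,t,x_1,\dots,x_k)$ is $$D_d(\mathbf x;q,t)=\sum_{\substack{d_1+\dots+d_k=d\\ d_i\ge0}}\ \prod_{i,j=1}^k\frac{(tx_j/x_i)_{d_j}}{(qx_j/x_i)_{d_j}}\frac{(qx_j/x_i)_{d_j-d_i}}{(tx_j/x_i)_{d_j-d_i}}\prod_{i=1}^kp_i^{d_i},$$ where $p_i$ is the shift $x_j\mapsto q^{\delta_{ij}}x_j$. $P_\mu(\mathbf x;q,t)$ is the standard Macdonald symmetric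 polynomial: of the form $m_\mu+\sum_{\nu<\mu}u_{\mu\nu}m_\nu$ (monomial symmetric functions, dominance order, $u_{\mu\nu}\in\mathbb Q(q,t)$), the $P_\mu$ being pairwise orthogonal for the inner product on symmetric functions with $\langle p_\lambda,p_\mu\rangle=\delta_{\lambda\mu}\prod_{r\ge1}r^{m_r}m_r!\prod_{i=1}^{\ell(\lambda)}\frac{1-q^{\lambda_i}}{1-t^{\lambda_i}}$, $m_r=\#\{i:\lambda_i=r\}$, then restricted to $k$ variables. *)

(* Defs.v *)
From HB Require Import structures.
From mathcomp Require Import all_boot all_order all_algebra.
From mathcomp Require Import complex reals.
From mathcomp Require Import mpoly.

Set Implicit Arguments.
Unset Strict Implicit.
Unset Printing Implicit Defensive.

Import GRing.Theory.
Local Open Scope ring_scope.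

Definition is_intpart (s : seq nat) := sorted geq s && (0%N \notin s).

Record intpart := IntPart { parts :> seq nat; _ : is_intpart parts }.

HB.instance Definition _ := [isSub for parts].
HB.instance Definition _ := [Choice of intpart by <:].

Lemma row_part_subproof (d : nat) : is_intpart (nseq (0 < d) d).
Proof. by case: d => [|d]. Qed.

(* The one-row partition (d); the empty partition when d = 0. *)
Definition row_part (d : nat) := IntPart (row_part_subproof d).

(* Strict dominance order nu < mu; the parts are positive, so all partial sums
   are constant from index |mu| = |nu| on. *)
Definition dominated (nu mu : intpart) : bool :=
  [&& nu != mu, sumn nu == sumn mu &
      all (fun i => sumn (take i nu) <= sumn (take i mu))%N
          (iota 0 (sumn mu).+1)].

(* A symmetric function f is represented by the family of its restrictions
   f(x_1,...,x_n), n >= 0.  All the families used below are K-linear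
   combinations of the msf la or of the psf la, so they are compatible with
   setting the last variable to 0. *)
Definition symfun (K : fieldType) := forall n : nat, {mpoly K[n]}.

(* The monomial symmetric function: the sum of the distinct monomials whose
   nonzero exponents are, up to order, the parts of la. *)
Definition msf (K : fieldType) (la : intpart) : symfun K := fun n =>
  \sum_(a : 'X_{1..n < (sumn la).+1} |
        perm_eq [seq e <- (a : 'X_{1..n}) | (0 < e)%N] la) 'X_[a].

Definition psf (K : fieldType) (la : intpart) : symfun K := fun n =>
  \prod_(r <- la) \sum_(i < n) 'X_i ^+ r.

(* <p_la, p_la>; the indices r > |la| have m_r = 0 and contribute 1. *)
Definition psf_norm (K : fieldType) (q t : K) (la : intpart) : K :=
  (\prod_(1 <= r < (sumn la).+1)
      (r ^ count_mem r la * (count_mem r la)`!))%N%:R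
  * \prod_(r <- la) ((1 - q ^+ r) / (1 - t ^+ r)).

(* <f, g> = c for the bilinear form such that
   <p_la, p_mu> = (la == mu) * psf_norm q t la. *)
Definition qt_inner (K : fieldType) (q t : K) (f g : symfun K) (c : K) : Prop :=
  exists (s : seq intpart) (a b : intpart -> K),
    [/\ uniq s,
        forall n, f n = \sum_(la <- s) a la *: psf K la n,
        forall n, g n = \sum_(la <- s) b la *: psf K la n &
        c = \sum_(la <- s) a la * b la * psf_norm q t la].

(* mu |-> P mu is the family of Macdonald symmetric functions with parameters
   q and t; (P mu k) is then the Macdonald polynomial in k variables. *)
Definition is_macdonald (K : fieldType) (q t : K) (P : intpart -> symfun K)
    : Prop :=
  (forall mu, exists (s : seq intpart) (u : intpart -> K),
      all (fun nu => dominated nu mu) s /\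
      forall n, P mu n = msf K mu n + \sum_(nu <- s) u nu *: msf K nu n)
  /\ (forall la mu, la <> mu -> qt_inner q t (P la) (P mu) 0).

(* (x)_m for m in Z: the q-shifted factorial. *)
Definition qpoch (F : fieldType) (q x : F) (m : int) : F :=
  match m with
  | Posz n => \prod_(0 <= i < n) (1 - x * q ^+ i)
  | Negz n => \prod_(1 <= i < n.+2) (1 - x * q ^- i)^-1
  end.

Section Operators.

Variables (K : fieldType) (k : nat) (q t : K).

(* K(x_1, ..., x_k) *)
Definition ratfun := {fraction {mpoly K[k]}}.

Definition rfpoly (p : {mpoly K[k]}) : ratfun := FracField.tofrac p.
Definition rfconst (c : K) : ratfun := rfpoly c%:MP.
Definition rfvar (i : 'I_k) : ratfun := rfpoly 'X_i.

Definition pshift_poly (i : 'I_k) (p : {mpoly K[k]}) : {mpoly K[k]} :=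
  p \mPo [tuple q ^+ (i == j) *: 'X_j | j < k].

(* p_i acts on a fraction through its numerator and its denominator; see
   pshift_frac for the independence of the chosen representative. *)
Definition pshift (i : 'I_k) (f : ratfun) : ratfun :=
  rfpoly (pshift_poly i (\n_(repr f))) / rfpoly (pshift_poly i (\d_(repr f))).

(* The action of \prod_i p_i ^ (a i); the p_i commute. *)
Definition pshifts (a : 'X_{1..k}) (f : ratfun) : ratfun :=
  foldr (fun i => iter (a i) (pshift i)) f (enum 'I_k).

Definition Dcoef (a : 'X_{1..k}) : ratfun :=
  \prod_(i < k) \prod_(j < k)
    let qq := rfconst q in
    let tt := rfconst t in
    let z := rfvar j / rfvar i in
    let m := (a j)%:Z - (a i)%:Z in
    qpoch qq (tt * z) (a j) / qpoch qq (qq * z) (a j)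
    * (qpoch qq (qq * z) m / qpoch qq (tt * z) m).

Definition Dop (d : nat) (f : ratfun) : ratfun :=
  \sum_(a : 'X_{1..k < d.+1} | mdeg a == d) Dcoef a * pshifts a f.

End Operators.

Section PshiftFrac.

Let frac_numden (D : idomainType) (f : {fraction D}) :
  f = FracField.tofrac \n_(repr f) / FracField.tofrac \d_(repr f).
Proof.
unlock FracField.tofrac.
rewrite -[X in _ = _ * X]FracField.pi_inv -[RHS]FracField.pi_mul.
rewrite /FracField.mulf /FracField.invf /=.
rewrite !numden_Ratio ?oner_neq0 ?denom_ratioP //.
by rewrite mulr1 mul1r Ratio_numden reprK.
Qed.

Variables (K : fieldType) (k : nat) (q : K).
Hypothesis q_neq0 : q != 0.

Let pshift_polyK (i : 'I_k) : cancel (pshift_poly q i) (pshift_poly q^-1 i).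
Proof.
move=> p; rewrite -[RHS]comp_mpoly_id /pshift_poly.
rewrite [p \mPo _]comp_mpolyE raddf_sum comp_mpolyE /=.
apply: eq_bigr => m _; rewrite comp_mpolyZ; congr (_ *: _).
rewrite rmorph_prod /=; apply: eq_bigr => j _.
rewrite !tnth_mktuple rmorphXn /= comp_mpolyZ comp_mpolyXU -tnth_nth.
by rewrite tnth_mktuple scalerA -exprMn divff // expr1n scale1r.
Qed.

Let pshift_poly_eq0 (i : 'I_k) u : (pshift_poly q i u == 0) = (u == 0).
Proof.
apply/eqP/eqP => [u0|->]; last exact: comp_mpoly0.
by rewrite -[u](pshift_polyK i) u0 /pshift_poly comp_mpoly0.
Qed.

Lemma pshift_frac (i : 'I_k) (u v : {mpoly K[k]}) : v != 0 ->
  pshift q i (rfpoly u / rfpoly v)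
  = rfpoly (pshift_poly q i u) / rfpoly (pshift_poly q i v).
Proof.
move=> v0; rewrite /pshift; set f := rfpoly u / rfpoly v.
have d0 : \d_(repr f) != 0 by exact: denom_ratioP.
have fE : rfpoly u * rfpoly \d_(repr f) = rfpoly \n_(repr f) * rfpoly v.
  apply/eqP; rewrite -eqr_div ?tofrac_eq0 //; apply/eqP.
  exact: frac_numden.
apply/eqP; rewrite eqr_div ?tofrac_eq0 ?pshift_poly_eq0 //.
rewrite /rfpoly -!tofracM tofrac_eq -!rmorphM; apply/eqP; congr comp_mpoly.
by move: fE; rewrite /rfpoly -!tofracM => /eqP; rewrite tofrac_eq => /eqP <-.
Qed.

End PshiftFrac.

Section BaseField.

Variable R : realType.

Definition Cqt := {fraction {mpoly R[i][2]}}.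

Definition Cqt_q : Cqt := FracField.tofrac 'X_(@ord0 1).
Definition Cqt_t : Cqt := FracField.tofrac 'X_(@ord_max 1).

End BaseField.

(* Main.v *)
Require Import Defs.
From HB Require Import structures.
From mathcomp Require Import all_boot all_order all_fingroup all_algebra.
From mathcomp Require Import mpoly ring zify.

(* Put T = q / t and let M_r be the r-th Macdonald operator of parameters (q, T)
   with the sign (-1)^r.  The identity
     1/(1 - x y) - 1/(1 - T x y) = x y (1/(1 - x y) - T/(1 - T x y))
   relates the determinants det(1/(1 - x_i y_j) - z/(1 - T x_i y_j)) at z = 1 and
   z = T.  Expanding both by Cauchy's formula and taking for the 1/y_j the shifted
   variables q^{c_j} x_j yields, for m > 0, the Wronski-type relation
     sum_r (t/q)^{kr} (T^r - q^m) M_r D_{m-r} = 0,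
   so that each D_d is a polynomial in the M_r.  The M_r commute by a source
   identity, proved by counting the roots of the difference of its two sides;
   hence the D_d commute.

   The same determinant is invariant under the exchange of x and y, so that
   sum_r z^r M_r acts in the same way on the x and on the y variables of the
   reproducing kernel sum_mu b_mu P_mu(x) P_mu(y).  Comparing leading monomials
   shows that the P_mu are eigenfunctions, with eigenvalue
     prod_i (1 - z T^{k-i} q^{mu_i}).
   Finally, (t)_d/(q)_d P_(d)(y; q, t) is the degree d part of the reproducing
   kernel of parameters (q, t) in the alphabets {1} and y, whose q-difference
   equation is the scalar form of the Wronski relation. *)

Set Implicit Arguments.
Unset Strict Implicit.
Unset Printing Implicit Defensive.
Import Order.TTheory GRing.Theory.
Local Open Scope ring_scope.

(** * Cauchy determinants and the kernel function identity *)

(** The choice of 1/y_j is dictated by the coefficients of D_d: after telescoping, the coefficient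
    of the shift c involves c only through the variables q^{c_j} x_j and the numbers c_i of factors.
    Shifting by I while removing I from c leaves these variables fixed and multiplies the
    coefficient by exactly the product attached to I in the kernel identity. The obstacle is that
    c_i = 0 makes 1 - x_i y_i vanish, where Cauchy's formula breaks down; the identity is therefore
    extended as a polynomial identity in a scaling of y. The same zeros discard the sets I that are
    not contained in c. For the eigenfunctions, the M_r are multiplied by the Vandermonde product so
    as to stay among polynomials, and the kernel is handled degree by degree. Orthogonality enters
    through the expansion of the kernel, triangularity through leading monomials. The parameters
    live in a field of characteristic 0 where q, t and q/t are not roots of unity and t is not a
    power of q; C(q,t) appears at the end. *)

Definition vdm (R : comNzRingType) k (x : 'I_k -> R) : R :=
  \prod_(i < k) \prod_(j < k | (i < j)%N) (x j - x i).

Definition scale_on (R : comNzRingType) k (I : {set 'I_k}) (c : R)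
    (x : 'I_k -> R) (i : 'I_k) : R := if i \in I then c * x i else x i.

Lemma vdm_neq0 (F : fieldType) k (x : 'I_k -> F) : injective x -> vdm x != 0.
Proof.
move=> xI; apply/prodf_neq0 => i _; apply/prodf_neq0 => j ij.
by rewrite subr_eq0 (inj_eq xI) -val_eqE gtn_eqF.
Qed.

(** Multilinearity in the rows; [I] is the set of rows taken from [A]. *)
Lemma det_addE (R : comNzRingType) k (A B : 'M[R]_k) :
  \det (A + B) =
  \sum_(I : {set 'I_k}) \det (\matrix_(i, j) if i \in I then A i j else B i j).
Proof.
rewrite /determinant exchange_big /=; apply: eq_bigr => s _.
rewrite -mulr_sumr; congr (_ * _).
rewrite (eq_bigr (fun i => A i (s i) + B i (s i))); last first.
  by move=> i _; rewrite mxE.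
rewrite bigA_distr; apply: eq_bigr => I _.
by apply: eq_bigr => i _; rewrite mxE.
Qed.

(* The entries 1/(1 - x_i y_j) times prod_l (1 - x_i y_l) are the values at the
   x_i of the polynomials prod_{l != j} (1 - y_l X), so that the determinant is
   a Vandermonde determinant in x up to a factor depending only on y. *)
Lemma det_Cauchy (F : fieldType) k (y : 'I_k -> F) :
  injective y -> (forall i, y i != 0) ->
  exists2 C : F, C != 0 &
  forall x : 'I_k -> F, (forall i j, 1 - x i * y j != 0) ->
    \det (\matrix_(i, j) (1 - x i * y j)^-1) =
    C * vdm x / \prod_i \prod_j (1 - x i * y j).
Proof.
move=> yI y0.
pose L j : {poly F} := \prod_(l < k | l != j) (1 - y l *: 'X).
have sL j : (size (L j) <= k)%N.
  apply: leq_trans (size_prod_leq _ _) _.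
  have -> : #|(fun l : 'I_k => l != j)| = k.-1.
    rewrite -[k in RHS]card_ord -(cardC (pred1 j)) card1 /=.
    by apply: eq_card.
  have k0 : (0 < k)%N by apply: leq_ltn_trans (ltn_ord j).
  rewrite leq_subLR; apply: leq_trans (_ : (\sum_(l < k | l != j) 2).+1 <= _)%N.
    rewrite ltnS; apply: leq_sum => l _; apply: leq_trans (size_polyD _ _) _.
    rewrite size_poly1 geq_max /= size_polyN.
    by apply: leq_trans (size_scale_leq _ _) _; rewrite size_polyX.
  rewrite sum_nat_const.
  have -> : #|(fun l : 'I_k => l != j)| = k.-1.
    rewrite -[k in RHS]card_ord -(cardC (pred1 j)) card1 /=.
    by apply: eq_card.
  by rewrite muln2 -addnn -addnS prednK.
have hL j u : (L j).[u] = \prod_(l < k | l != j) (1 - u * y l).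
  rewrite horner_prod; apply: eq_bigr => l _.
  by rewrite !hornerE mulrC.
pose Co : 'M[F]_k := \matrix_(m, j) (L j)`_m.
have detL (x : 'I_k -> F) : \det (\matrix_(i, j) (L j).[x i]) = vdm x * \det Co.
  have -> : \matrix_(i, j) (L j).[x i] = (Vandermonde k (\row_i x i))^T *m Co.
    apply/matrixP => i j; rewrite !mxE (horner_coef_wide _ (sL j)).
    by apply: eq_bigr => m _; rewrite !mxE mulrC.
  rewrite det_mulmx det_tr det_Vandermonde; congr (_ * _).
  by apply: eq_bigr => i _; apply: eq_bigr => j _; rewrite !mxE.
(* At x_i = 1/y_i the matrix of the [(L j).[x i]] is diagonal with nonzero entries, so the constant
   does not vanish. *)
exists (\det Co).
  have : \det (\matrix_(i, j) (L j).[(y i)^-1]) != 0.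
    rewrite (_ : matrix_of_fun _ _ = diag_mx (\row_i (L i).[(y i)^-1])).
      rewrite det_diag; apply/prodf_neq0 => i _; rewrite mxE hL.
      apply/prodf_neq0 => l li; apply: contra li => /eqP h.
      by apply/eqP/yI/esym/(mulfI (invr_neq0 (y0 i))); rewrite mulVf //;
        apply/eqP; rewrite -subr_eq0 h.
    apply/matrixP => i j; rewrite !mxE; case: eqVneq => [->|ij]; rewrite ?mulr1n //.
    by rewrite mulr0n hL (bigD1 i) //= mulVf // subrr mul0r.
  by rewrite detL mulf_eq0 negb_or => /andP[].
move=> x xy0.
have -> : \matrix_(i, j) (1 - x i * y j)^-1 =
    diag_mx (\row_i (\prod_j (1 - x i * y j))^-1) *m \matrix_(i, j) (L j).[x i].
  apply/matrixP => i j; rewrite mul_diag_mx !mxE hL (bigD1 j) //= invfM.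
  by rewrite -mulrA mulVf ?mulr1 //; apply/prodf_neq0.
rewrite det_mulmx det_diag detL mulrC [X in X * _]mulrC; congr (_ * _).
by rewrite -prodfV; apply: eq_bigr => i _; rewrite mxE.
Qed.

(* The action of the Macdonald operators of parameter T on the reproducing
   kernel with two sets of variables x and y, divided by that kernel. *)
Definition kernel_sum (F : fieldType) k (T z : F) (x y : 'I_k -> F) : F :=
  \sum_(I : {set 'I_k}) (- z) ^+ #|I| * (vdm (scale_on I T x) / vdm x) *
    \prod_(i in I) \prod_j ((1 - x i * y j) / (1 - T * x i * y j)).

Section KernelSum.

Variables (F : fieldType) (k : nat) (T : F) (x y : 'I_k -> F).
Hypotheses (xI : injective x) (yI : injective y).
Hypothesis y0 : forall i, y i != 0.
Hypothesis xy0 : forall i j, 1 - x i * y j != 0.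
Hypothesis Txy0 : forall i j, 1 - T * x i * y j != 0.

(** Each row is a Cauchy row at x_i minus z times the Cauchy row at T x_i. The multilinear expansion
    thus consists of Cauchy determinants in the variables [scale_on I T x] with the same y, and the
    constant depending on y cancels in the quotient. *)
Lemma kernel_sum_det z :
  kernel_sum T z x y = \det (\matrix_(i, j) ((1 - x i * y j)^-1 - z / (1 - T * x i * y j)))
     / \det (\matrix_(i, j) (1 - x i * y j)^-1).
Proof.
have [C C0 HC] := det_Cauchy yI y0.
have V0 := vdm_neq0 xI.
have P0 : \prod_i \prod_j (1 - x i * y j) != 0.
  by apply/prodf_neq0 => i _; apply/prodf_neq0.
have -> : \matrix_(i, j) ((1 - x i * y j)^-1 - z / (1 - T * x i * y j)) =
  \matrix_(i, j) (- z / (1 - T * x i * y j)) + \matrix_(i, j) (1 - x i * y j)^-1.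
  by apply/matrixP => i j; rewrite !mxE addrC mulNr.
rewrite det_addE mulr_suml; apply: eq_bigr => I _.
rewrite [X in _ = \det X / _](_ : _ = diag_mx (\row_i (if i \in I then - z else 1)) *m
   \matrix_(i, j) (1 - scale_on I T x i * y j)^-1); last first.
  apply/matrixP => i j; rewrite mul_diag_mx !mxE /scale_on.
  by case: (i \in I); rewrite ?mul1r.
have s0 i j : 1 - scale_on I T x i * y j != 0 by rewrite /scale_on; case: ifP.
rewrite det_mulmx det_diag !HC //.
have -> : \prod_(i < k) (\row_i0 (if i0 \in I then - z else 1)) 0 i = (- z) ^+ #|I|.
  rewrite -prodr_const [RHS]big_mkcond /=.
  by apply: eq_bigr => i _; rewrite mxE.
have Ps0 : \prod_i \prod_j (1 - scale_on I T x i * y j) != 0.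
  by apply/prodf_neq0 => i _; apply/prodf_neq0.
suff -> : \prod_(i in I) \prod_j ((1 - x i * y j) / (1 - T * x i * y j)) =
    (\prod_i \prod_j (1 - x i * y j)) / \prod_i \prod_j (1 - scale_on I T x i * y j).
  by field; rewrite Ps0 P0 V0 C0.
have -> : \prod_i \prod_j (1 - scale_on I T x i * y j) =
  (\prod_(i in I) \prod_j (1 - T * x i * y j)) * \prod_(i | i \notin I) \prod_j (1 - x i * y j).
  rewrite (bigID (mem I)) /=; congr (_ * _); apply: eq_bigr => i iI;
    apply: eq_bigr => j _; rewrite /scale_on.
  - by rewrite iI.
  - by rewrite (negPf iI).
rewrite [in RHS](bigID (mem I)) /= invfM mulrACA divff ?mulr1; last first.
  by apply/prodf_neq0 => i _; apply/prodf_neq0.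
rewrite -prodfV -big_split /=; apply: eq_bigr => i _.
by rewrite -prodfV -big_split.
Qed.

(** The factor x_i y_j between the entries at z = 1 and z = T splits into a row factor and a column
    factor, which leave the determinant. *)
Lemma kernel_sum_wronski :
  kernel_sum T 1 x y = (\prod_i (x i * y i)) * kernel_sum T T x y.
Proof.
rewrite !kernel_sum_det mulrA; congr (_ / _).
have -> : \matrix_(i, j) ((1 - x i * y j)^-1 - 1 / (1 - T * x i * y j)) =
  diag_mx (\row_i x i) *m (\matrix_(i, j) ((1 - x i * y j)^-1 - T / (1 - T * x i * y j)))
   *m diag_mx (\row_i y i).
  apply/matrixP => i j; rewrite mul_mx_diag mul_diag_mx !mxE.
  by field; rewrite xy0 Txy0.
rewrite !det_mulmx !det_diag mulrAC big_split /=.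
by congr (_ * _ * _); apply: eq_bigr => i _; rewrite mxE.
Qed.

End KernelSum.

Lemma kernel_sumC (F : fieldType) k (T z : F) (x y : 'I_k -> F) :
  injective x -> injective y ->
  (forall i, x i != 0) -> (forall i, y i != 0) ->
  (forall i j, 1 - x i * y j != 0) -> (forall i j, 1 - T * x i * y j != 0) ->
  kernel_sum T z x y = kernel_sum T z y x.
Proof.
move=> xI yI x0 y0 xy Txy.
have yx i j : 1 - y i * x j != 0 by rewrite mulrC.
have Tyx i j : 1 - T * y i * x j != 0 by rewrite -mulrA [y i * _]mulrC mulrA.
rewrite !kernel_sum_det //; congr (_ / _); rewrite -det_tr; congr (\det _);
  apply/matrixP => i j; rewrite !mxE -?mulrA ![y i * _]mulrC //.
Qed.

Lemma poly_natr_eq0 (F : fieldType) (p : {poly F}) : [pchar F] =i pred0 ->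
  (forall n : nat, p.[n%:R] = 0) -> p = 0.
Proof.
move=> charF p0; apply/eqP/negPn/negP => pn0.
pose rs := [seq n%:R : F | n <- iota 0 (size p)].
have allr : all (root p) rs by apply/allP => u /mapP[n _ ->]; apply/rootP.
suff urs : uniq rs.
  by have := max_poly_roots pn0 allr urs; rewrite size_map size_iota ltnn.
rewrite map_inj_uniq ?iota_uniq // => m n /eqP.
wlog mn : m n / (m <= n)%N.
  by move=> H; case/orP: (leq_total m n) => /H // h; rewrite eq_sym => /h.
have /pcharf0P c0 := charF.
rewrite eq_sym -subr_eq0 -natrB // c0 subn_eq0 => nm.
by apply/eqP; rewrite eqn_leq mn.
Qed.

Lemma horner_1BZX (R : comNzRingType) (c u : R) : (1 - c *: 'X).[u] = 1 - c * u.
Proof. by rewrite hornerD hornerN hornerZ hornerX hornerC. Qed.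

(** This is [kernel_sum] with y scaled by the indeterminate and with all denominators cleared.
    Identities proved through determinants, hence for nonzero 1 - x_i y_j, extend to all y in this
    form. *)
Definition kernel_poly (F : fieldType) k (T z : F) (x y : 'I_k -> F) : {poly F} :=
  \sum_(I : {set 'I_k}) ((- z) ^+ #|I| * (vdm (scale_on I T x) / vdm x)) *:
    ((\prod_(i in I) \prod_j (1 - (x i * y j) *: 'X))
    * \prod_(i | i \notin I) \prod_j (1 - (T * x i * y j) *: 'X)).

Lemma vdm_scale_ratio (F : fieldType) k (I : {set 'I_k}) (T u : F) (y : 'I_k -> F) :
  u != 0 ->
  vdm (scale_on I T (fun j => u * y j)) / vdm (fun j => u * y j)
  = vdm (scale_on I T y) / vdm y.
Proof.
move=> u0; have vu (y' : 'I_k -> F) : vdm (fun j => u * y' j) =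
    (\prod_(i < k) \prod_(j < k | (i < j)%N) u) * vdm y'.
  rewrite /vdm -big_split /=; apply: eq_bigr => i _.
  by rewrite -big_split /=; apply: eq_bigr => j _; rewrite mulrBr.
have -> : vdm (scale_on I T (fun j => u * y j)) = vdm (fun j => u * scale_on I T y j).
  apply: eq_bigr => i _; apply: eq_bigr => j _.
  by rewrite /scale_on; do 2!case: ifP => _; rewrite 1?mulrCA // [T * (u * y i)]mulrCA.
rewrite !vu -mulf_div divff ?mul1r //.
by apply/prodf_neq0 => i _; apply/prodf_neq0.
Qed.

Lemma kernel_poly_sum (F : fieldType) k (T z u : F) (x y : 'I_k -> F) :
  (forall i j, 1 - T * x i * (u * y j) != 0) ->
  (kernel_poly T z x y).[u] =
  kernel_sum T z x (fun j => u * y j) * \prod_i \prod_j (1 - T * x i * (u * y j)).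
Proof.
move=> H; rewrite horner_sum mulr_suml; apply: eq_bigr => I _.
rewrite hornerZ -[RHS]mulrA; congr (_ * _).
rewrite hornerM [X in _ = _ * X](bigID (mem I)) /= mulrA; congr (_ * _); last first.
  rewrite horner_prod; apply: eq_bigr => i _; rewrite horner_prod; apply: eq_bigr => j _.
by rewrite horner_1BZX; ring.
rewrite horner_prod -big_split /=; apply: eq_bigr => i _.
rewrite horner_prod -big_split /=; apply: eq_bigr => j _.
by rewrite divfK // horner_1BZX; ring.
Qed.

Section KernelPoly.

Variables (F : fieldType) (k : nat) (T : F) (x y : 'I_k -> F).
Hypothesis charF : [pchar F] =i pred0.
Hypotheses (xI : injective x) (yI : injective y).
Hypotheses (x0 : forall i, x i != 0) (y0 : forall i, y i != 0).

Let ext (P Q : {poly F}) :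
  (forall u, u != 0 -> (forall i j, 1 - x i * (u * y j) != 0) ->
    (forall i j, 1 - T * x i * (u * y j) != 0) -> P.[u] = Q.[u]) -> P = Q.
Proof.
move=> H; apply/eqP; rewrite -subr_eq0.
(* [E] vanishes at every value u excluded from the hypothesis, so that (P - Q) E vanishes at all
   natural numbers. *)
pose E := 'X * \prod_i \prod_j ((1 - (x i * y j) *: 'X) * (1 - (T * x i * y j) *: 'X)).
suff : (P - Q) * E = 0.
  move/eqP; rewrite mulf_eq0 => /orP[//|]; rewrite mulf_eq0 polyX_eq0 /=.
  move/prodf_eq0 => [i _ /prodf_eq0 [j _]]; rewrite mulf_eq0 => /orP[]/eqP/(congr1 (horner^~ 0));
    by rewrite horner_1BZX horner0 mulr0 subr0 => /eqP; rewrite oner_eq0.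
apply: (poly_natr_eq0 charF) => n; set u := n%:R.
rewrite !hornerM horner_prod hornerD hornerN hornerX.
rewrite (eq_bigr (fun i => \prod_j
   ((1 - x i * (u * y j)) * (1 - T * x i * (u * y j))))); last first.
  move=> i _; rewrite horner_prod; apply: eq_bigr => j _.
  by rewrite hornerM !horner_1BZX; congr (_ * _); ring.
have [->|u0] := eqVneq u 0; first by rewrite mul0r mulr0.
case: (eqVneq (\prod_i \prod_j ((1 - x i * (u * y j)) * (1 - T * x i * (u * y j)))) 0) => [->|p0].
  by rewrite !mulr0.
have pn0 i j : ((1 - x i * (u * y j)) != 0) && (1 - T * x i * (u * y j) != 0).
  by have /prodf_neq0/(_ i isT)/prodf_neq0/(_ j isT) := p0; rewrite mulf_eq0 negb_or.
by rewrite H ?subrr ?mul0r // => i j; case/andP: (pn0 i j).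
Qed.

Let uyI u : u != 0 -> injective (fun j => u * y j).
Proof. by move=> u0 i j /(mulfI u0)/yI. Qed.

Lemma kernel_polyC z : kernel_poly T z x y = kernel_poly T z y x.
Proof.
apply: ext => u u0 h1 h2.
have h3 i j : T * x i * (u * y j) = T * y j * (u * x i) by ring.
rewrite !kernel_poly_sum //; last by move=> i j; rewrite -h3.
congr (_ * _); last first.
  by rewrite exchange_big /=; apply: eq_bigr => i _; apply: eq_bigr => j _; rewrite h3.
rewrite kernel_sumC //; last by move=> i; rewrite mulf_neq0.
  apply: eq_bigr => I _; rewrite vdm_scale_ratio //; congr (_ * _).
  apply: eq_bigr => i _; apply: eq_bigr => j _; congr (_ / _); ring.
exact: uyI.
Qed.

Lemma kernel_poly_wronski :
  kernel_poly T 1 x y = (\prod_i (x i * y i)) *: 'X^k * kernel_poly T T x y.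
Proof.
apply: ext => u u0 h1 h2.
rewrite hornerM kernel_poly_sum // kernel_poly_sum // mulrA; congr (_ * _).
rewrite kernel_sum_wronski // ?hornerZ ?hornerXn; last by move=> i; rewrite mulf_neq0.
  congr (_ * _); rewrite -[u ^+ k](_ : \prod_(i < k) u = _); last by rewrite prodr_const card_ord.
  by rewrite -big_split /=; apply: eq_bigr => i _; ring.
exact: uyI.
Qed.

End KernelPoly.

(** Evaluating the polynomial identity at 1 also covers vanishing factors 1 - x_i y_j. They occur in
    the application: y_j = 1/x_j whenever c_j = 0. *)
Lemma kernel_sum_wronski_ext (F : fieldType) k (T : F) (x y : 'I_k -> F) :
  [pchar F] =i pred0 -> injective x -> injective y ->
  (forall i, y i != 0) ->
  (forall i j, 1 - T * x i * y j != 0) ->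
  kernel_sum T 1 x y = (\prod_i (x i * y i)) * kernel_sum T T x y.
Proof.
move=> charF xI yI y0 Txy.
have y1 : (fun j => 1 * y j) =1 y by move=> j; rewrite mul1r.
have H1 i j : 1 - T * x i * (1 * y j) != 0 by rewrite mul1r.
have ksE z : kernel_sum T z x (fun j => 1 * y j) = kernel_sum T z x y.
  apply: eq_bigr => I _; congr (_ * _); apply: eq_bigr => i _.
  by apply: eq_bigr => j _; rewrite mul1r.
have := congr1 (horner^~ 1) (kernel_poly_wronski T charF xI yI y0).
rewrite hornerM !kernel_poly_sum // hornerZ hornerXn expr1n mulr1 mulrA !ksE.
by apply: mulIf; apply/prodf_neq0 => i _; apply/prodf_neq0.
Qed.

(** * The source identity behind the commutation of the Macdonald operators *)

Lemma sum_subsetU1 (V : nmodType) (A : finType) (b : A) (B : {set A})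
    (f : {set A} -> V) : b \notin B ->
  \sum_(I : {set A} | I \subset b |: B) f I =
  \sum_(I : {set A} | I \subset B) (f I + f (b |: I)).
Proof.
move=> bB; rewrite (bigID (fun I : {set A} => b \in I)) /= addrC big_split /=.
congr (_ + _).
  apply: eq_bigl => I; apply/andP/idP => [[/subsetP IB bI]|IB].
    apply/subsetP => i iI; move: (IB i iI); rewrite in_setU1 => /orP[/eqP e|//].
    by rewrite -e iI in bI.
  split; first exact: subset_trans IB (subsetUr _ _).
  by apply: contra bB => /(subsetP IB).
rewrite (reindex_onto (fun I => b |: I) (fun I => I :\ b)) /=; last first.
  by move=> I /andP[_ bI]; rewrite setD1K.
apply: eq_bigl => I; rewrite setU11 andbT.
apply/andP/idP => [[IB /eqP <-]|IB].
  rewrite subDset //.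
have bI : b \notin I by apply: contra bB => /(subsetP IB).
by rewrite setU1K // eqxx setUS.
Qed.

Section SourceIdentity.

Variables (R : comNzRingType) (A : finType).
Implicit Types (a : A -> A -> R) (u w d : A -> R) (I B : {set A}).

(** For a i j = (T x_i - x_j)/(x_i - x_j) and B the full set, this is the coefficient of the shift
    by I in a Macdonald operator, up to sign and a power of T. *)
Definition cut a B I : R := \prod_(i in I) \prod_(j in B :\: I) a i j.

Definition cut_sum a B (p : nat) : R := \sum_(I : {set A} | I \subset B) (cut a B I) *+ (#|I| == p).

(* The numerator of cut_sum a (b |: B) p when a b j = u j / d j and a j b = w j / d j
   for j in B and the values of a on B are given. *)
Definition cut_num (g : {set A} -> R) u w d B (p : nat) : R :=
  \sum_(I : {set A} | I \subset B)
    (g I * (\prod_(j in B :\: I) u j) * (\prod_(j in I) d j) *+ (#|I|.+1 == p)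
     + g I * (\prod_(j in I) w j) * (\prod_(j in B :\: I) d j) *+ (#|I| == p)).

Lemma cutU1r a b B I : b \notin B -> I \subset B ->
  cut a (b |: B) I = cut a B I * \prod_(i in I) a i b.
Proof.
move=> bB IB; rewrite /cut -big_split /=; apply: eq_bigr => i iI.
have -> : (b |: B) :\: I = b |: (B :\: I).
  rewrite setDUl; congr (_ :|: _); apply/setDidPl; rewrite disjoints1.
  by apply: contra bB => /(subsetP IB).
by rewrite big_setU1 /= 1?mulrC // inE (negPf bB) andbF.
Qed.

Lemma cutU1l a b B I : b \notin B -> I \subset B ->
  cut a (b |: B) (b |: I) = cut a B I * \prod_(j in B :\: I) a b j.
Proof.
move=> bB IB.
have bI : b \notin I by apply: contra bB => /(subsetP IB).
have E : (b |: B) :\: (b |: I) = B :\: I.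
  apply/setP => j; rewrite !inE negb_or; case: eqVneq => [->|] //=.
  by rewrite (negPf bB) andbF.
by rewrite /cut E big_setU1 //= mulrC.
Qed.

(** Isolates the dependence on the point [b], whose variable becomes the indeterminate of the root
    count. *)
Lemma cut_sumU1 a b B p : b \notin B ->
  cut_sum a (b |: B) p =
  \sum_(I : {set A} | I \subset B)
    (cut a B I * (\prod_(j in B :\: I) a b j) *+ (#|I|.+1 == p)
     + cut a B I * (\prod_(j in I) a j b) *+ (#|I| == p)).
Proof.
move=> bB; rewrite /cut_sum sum_subsetU1 //; apply: eq_bigr => I IB.
have bI : b \notin I by apply: contra bB => /(subsetP IB).
by rewrite cutU1r // cutU1l // cardsU1 bI addrC.
Qed.

(** With d b = 0 only the terms where [b] contributes u b or w b survive. They come from the sets I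
    and b |: I respectively, and both require |I| + 1 = p. *)
Lemma cut_num0 a u w d b B p : b \notin B -> d b = 0 ->
  cut_num (cut a (b |: B)) u w d (b |: B) p =
  \sum_(I : {set A} | I \subset B)
    cut a B I * (u b * (\prod_(i in I) (a i b * d i)) * (\prod_(j in B :\: I) u j)
     + w b * (\prod_(j in B :\: I) (a b j * d j)) * (\prod_(j in I) w j)) *+ (#|I|.+1 == p).
Proof.
move=> bB db; rewrite /cut_num sum_subsetU1 //; apply: eq_bigr => I IB.
have bI : b \notin I by apply: contra bB => /(subsetP IB).
have E : (b |: B) :\: (b |: I) = B :\: I.
  apply/setP => j; rewrite !inE negb_or; case: eqVneq => [->|] //=.
  by rewrite (negPf bB) andbF.
have E' : (b |: B) :\: I = b |: (B :\: I).
  rewrite setDUl; congr (_ :|: _); apply/setDidPl; rewrite disjoints1.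
  by apply: contra bB => /(subsetP IB).
have bBI : b \notin B :\: I by rewrite inE (negPf bB) andbF.
rewrite E E' !big_setU1 //= db !(mul0r, mulr0, mul0rn, addr0, add0r).
rewrite cardsU1 bI add1n cutU1r // cutU1l // -mulrnDl; congr (_ *+ _).
rewrite !big_split /=; move: (cut a B I) (\prod_(i in I) a i b).
move: (\prod_(i in I) d i) (\prod_(i in I) w i) (\prod_(i in B :\: I) u i).
move: (\prod_(i in B :\: I) d i) (\prod_(i in B :\: I) a b i) => *; ring.
Qed.

End SourceIdentity.

Lemma cut_num_unit (F : fieldType) (A : finType) (g : {set A} -> F) u w d (B : {set A}) p :
  (forall j, j \in B -> d j != 0) ->
  cut_num g u w d B p = (\prod_(j in B) d j) *
  \sum_(I : {set A} | I \subset B)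
    (g I * (\prod_(j in B :\: I) (u j / d j)) *+ (#|I|.+1 == p)
     + g I * (\prod_(j in I) (w j / d j)) *+ (#|I| == p)).
Proof.
move=> d0; rewrite mulr_sumr; apply: eq_bigr => I IB.
have d1 : \prod_(j in I) d j != 0.
  by apply/prodf_neq0 => j jI; apply/d0/(subsetP IB).
have d2 : \prod_(j in B :\: I) d j != 0.
  by apply/prodf_neq0 => j; rewrite inE => /andP[_]; apply/d0.
rewrite (big_setID I (A := B)) /= (setIidPr IB) mulrDr !big_split /= !prodfV.
move: (\prod_(j in I) d j) (\prod_(j in B :\: I) d j) d1 d2 => D1 D2 d1 d2.
by congr (_ + _); case: (_ == p); rewrite ?mulr0n ?mulr0 // !mulr1n;
  move: (g I) (\prod_(j in _) _) => *; field; rewrite ?d1 ?d2.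
Qed.

Lemma size_prod_leq_card (F : fieldType) (A : finType) (B : {set A}) (P : A -> {poly F}) m :
  (forall i, (size (P i) <= m.+1)%N) ->
  (size (\prod_(i in B) P i)%R <= (m * #|B|).+1)%N.
Proof.
move=> sP; apply: leq_trans (size_prod_leq _ _) _.
rewrite leq_subLR addnS ltnS.
apply: (@leq_trans (\sum_(i in B) m.+1)); first by apply: leq_sum => i _.
by rewrite sum_nat_const mulnS mulnC.
Qed.

Lemma horner_cut_num (F : fieldType) (A : finType) (g : {set A} -> F)
    (u w d : A -> {poly F}) (B : {set A}) p z :
  (cut_num (fun I => (g I)%:P) u w d B p).[z] =
  cut_num g (fun j => (u j).[z]) (fun j => (w j).[z]) (fun j => (d j).[z]) B p.
Proof.
rewrite horner_sum; apply: eq_bigr => I _.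
by rewrite hornerD !hornerMn !hornerM hornerC !horner_prod.
Qed.

Lemma size_cut_num (F : fieldType) (A : finType) (g : {set A} -> F)
    (u w d : A -> {poly F}) (B : {set A}) p m :
  (forall j, (size (u j) <= m.+1)%N) -> (forall j, (size (w j) <= m.+1)%N) ->
  (forall j, (size (d j) <= m.+1)%N) ->
  (size (cut_num (fun I => (g I)%:P) u w d B p) <= (m * #|B|).+1)%N.
Proof.
move=> su sw sd; apply: leq_trans (size_sum _ _ _) _; apply/bigmax_leqP => I IB.
have H (P Q : {poly F}) (b : bool) :
    (size P <= (m * #|B :\: I|).+1)%N -> (size Q <= (m * #|I|).+1)%N ->
    (size ((g I)%:P * P * Q *+ b) <= (m * #|B|).+1)%N.
  move=> sP sQ; case: b; rewrite ?mulr0n ?size_poly0 // mulr1n.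
  apply: leq_trans (size_mul_leq _ _) _.
  have : (size ((g I)%:P * P)%R <= (m * #|B :\: I|).+1)%N.
    by rewrite mul_polyC; apply: leq_trans (size_scale_leq _ _) sP.
  have <- : (#|B :\: I| + #|I|)%N = #|B|.
    by rewrite -(cardsID I B) addnC (setIidPr IB).
  rewrite mulnDr => sP'; rewrite -subn1 leq_subLR add1n -addSn -addnS.
  exact: leq_add.
apply: leq_trans (size_polyD _ _) _; rewrite geq_max; apply/andP; split.
  by apply: H; apply: size_prod_leq_card.
by rewrite -mulrA [X in _ * X]mulrC mulrA; apply: H; apply: size_prod_leq_card.
Qed.

Section Commute.

Variables (F : fieldType) (A : finType) (q T : F) (x : A -> F).
Hypotheses (q0 : q != 0) (xI : injective x) (x0 : forall i, x i != 0).
Hypothesis qx : forall i j, q * x i != x j.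
Hypothesis qqx : forall i j, q * (q * x i) != x j.

(** Product of m(u, v) and m(v, q u) for m(u, v) = (T u - v)/(u - v): the joint contribution of two
    indices, u shifted by the first of two composed operators only and v by the second only. *)
Definition pair_coef (u v : F) : F :=
  (T * u - v) * (T * v - q * u) / ((u - v) * (v - q * u)).

Let a i j := pair_coef (x i) (x j).
Let a' i j := pair_coef (x j) (x i).

(** [d] is a common denominator of [pair_coef z (x j)] and [pair_coef (x j) z], with numerators [n1]
    and [n2]. All three are cubic in z, and the zeros of [d] are x_j, x_j / q and q x_j. *)
Let d (z : F) j := (z - x j) * (x j - q * z) * (z - q * x j).
Let n1 (z : F) j := (T * z - x j) * (T * x j - q * z) * (z - q * x j).
Let n2 (z : F) j := - ((T * x j - z) * (T * z - q * x j) * (x j - q * z)).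

Let toP (c1 c2 c3 c4 c5 c6 : F) : {poly F} :=
  (c1 *: 'X + c2%:P) * (c3 *: 'X + c4%:P) * (c5 *: 'X + c6%:P).
Let dP j := toP 1 (- x j) (- q) (x j) 1 (- (q * x j)).
Let n1P j := toP T (- x j) (- q) (T * x j) 1 (- (q * x j)).
Let n2P j := toP 1 (- (T * x j)) T (- (q * x j)) (- q) (x j).

Let dPE z j : (dP j).[z] = d z j.
Proof. by rewrite !hornerE /d; ring. Qed.
Let n1PE z j : (n1P j).[z] = n1 z j.
Proof. by rewrite !hornerE /n1; ring. Qed.
Let n2PE z j : (n2P j).[z] = n2 z j.
Proof. by rewrite !hornerE /n2; ring. Qed.

Let size_toP c1 c2 c3 c4 c5 c6 : (size (toP c1 c2 c3 c4 c5 c6) <= 4)%N.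
Proof.
have lin (c e : F) : (size (c *: 'X + e%:P)%R <= 2)%N.
  apply: leq_trans (size_polyD _ _) _; rewrite geq_max.
  rewrite (leq_trans (size_scale_leq _ _)) ?size_polyX //=.
  by rewrite size_polyC; case: eqP.
rewrite /toP; apply: leq_trans (size_mul_leq _ _) _.
have := size_mul_leq (c1 *: 'X + c2%:P) (c3 *: 'X + c4%:P).
have := lin c1 c2; have := lin c3 c4; have := lin c5 c6.
set s1 := size _; set s2 := size _; set s3 := size _; set s4 := size _.
move=> h1 h2 h3 h4; rewrite -subn1 leq_subLR add1n.
apply: leq_trans (leq_add h4 h1) _; rewrite addn2 !ltnS -subn1 leq_subLR add1n.
exact: leq_add h3 h2.
Qed.

Let num (z : F) B p := cut_num (cut a B) (n1 z) (n2 z) (d z) B p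
                     - cut_num (cut a' B) (n2 z) (n1 z) (d z) B p.

Let n1d z j : d z j != 0 -> n1 z j / d z j = pair_coef z (x j).
Proof.
rewrite /d !mulf_eq0 !negb_or => /andP[/andP[h1 h2] h3].
by rewrite /n1 /d /pair_coef; field; rewrite h1 h2 h3.
Qed.

Let n2d z j : d z j != 0 -> n2 z j / d z j = pair_coef (x j) z.
Proof.
rewrite /d !mulf_eq0 !negb_or => /andP[/andP[h1 h2] h3].
rewrite /n2 /d /pair_coef; field; rewrite h1 h2 h3 /=.
by rewrite andbT -opprB oppr_eq0.
Qed.

Let xB i j : i != j -> x i - x j != 0.
Proof. by move=> ij; rewrite subr_eq0 (inj_eq xI). Qed.
Let qxB i j : q * x i - x j != 0. Proof. by rewrite subr_eq0. Qed.
Let xqB i j : x i - q * x j != 0. Proof. by rewrite subr_eq0 eq_sym. Qed.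
Let xqqB i j : x i - q * (q * x j) != 0. Proof. by rewrite subr_eq0 eq_sym. Qed.

Let d_qx b j : b != j -> d (q * x b) j != 0.
Proof. by move=> bj; rewrite /d !mulf_neq0 // -mulrBr mulf_neq0 // xB. Qed.

Let d_x b j : b != j -> d (x b) j != 0.
Proof. by move=> bj; rewrite /d !mulf_neq0 // xB. Qed.

Let d_xq b j : b != j -> d (q^-1 * x b) j != 0.
Proof.
move=> bj; have bj' : j != b by rewrite eq_sym.
rewrite /d !mulf_neq0 //.
- by rewrite -(mulKf q0 (x j)) -mulrBr mulf_neq0 ?invr_eq0.
- by rewrite mulVKf // xB.
- by rewrite -(mulKf q0 (q * x j)) -mulrBr mulf_neq0 ?invr_eq0.
Qed.

Let d_0 j : d 0 j != 0.
Proof. by rewrite /d mulr0 !sub0r subr0 !mulf_neq0 ?oppr_eq0 ?mulf_neq0. Qed.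

(** This symmetry explains the roots z = q x_b and z = x_b / q: there a coefficient involving z
    equals one involving x_b in the opposite order. *)
Let pc_qx u v : u != 0 -> pair_coef u (q * v) = pair_coef v u.
Proof.
move=> u0; rewrite /pair_coef.
have -> : (T * u - q * v) * (T * (q * v) - q * u) = q * ((T * v - u) * (T * u - q * v)) by ring.
have -> : (u - q * v) * (q * v - q * u) = q * ((v - u) * (u - q * v)) by ring.
by rewrite -mulf_div divff // mul1r.
Qed.

Let pc_x0 u : u != 0 -> pair_coef u 0 = T.
Proof.
move=> u0; rewrite /pair_coef mulr0 !sub0r !subr0 -mulf_div mulfK // divff ?mulr1 //.
by rewrite oppr_eq0 mulf_neq0.
Qed.

Let pc_0x u : u != 0 -> pair_coef 0 u = T.
Proof.
move=> u0; rewrite /pair_coef !mulr0 !sub0r !subr0 -mulf_div mulfK // divff ?mul1r //.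
by rewrite oppr_eq0.
Qed.

(* At a zero of the denominators, the identity reduces to its instance for a set
   with one element less. *)
Let num_root z (b : A) (B : {set A}) p : b \notin B -> d z b = 0 ->
  (forall j, j \in B -> d z j != 0) ->
  (cut_sum a B p.-1 = cut_sum a' B p.-1) ->
  [\/ [/\ n1 z b = 0 & forall j, j \in B -> pair_coef (x j) z = a b j],
      [/\ n2 z b = 0 & forall j, j \in B -> pair_coef z (x j) = a j b] |
      z = x b] ->
  num z (b |: B) p = 0.
Proof.
move=> bB db dB IH H; rewrite /num !cut_num0 //; apply/eqP; rewrite subr_eq0; apply/eqP.
case: p IH => [|p] /= IH.
  by rewrite !big1.
(* When the bracket does not depend on I, it factors out and leaves a cut sum over B for the size p
   - 1, to which the hypothesis applies. *)
have aux (c : F) (a1 : A -> A -> F) (G : {set A} -> F) :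
   (forall I : {set A}, I \subset B -> G I = c) ->
   \sum_(I : {set A} | I \subset B) cut a1 B I * G I *+ (#|I|.+1 == p.+1)
   = cut_sum a1 B p * c.
  move=> Gc; rewrite mulr_suml; apply: eq_bigr => I IB.
  by rewrite Gc // eqSS mulrnAl.
have split (I : {set A}) (f g h : A -> F) : I \subset B ->
   (forall j, j \in B -> f j = h j) -> (forall j, j \in B -> g j = h j) ->
   (\prod_(i in I) f i) * (\prod_(j in B :\: I) g j) = \prod_(j in B) h j.
  move=> IB fh gh; rewrite [RHS](big_setID I) /= (setIidPr IB); congr (_ * _);
    apply: eq_bigr => i; rewrite ?inE => iI.
  - exact/fh/(subsetP IB).
  - by apply/gh; case/andP: iI.
case: H => [[n1b Hw]|[n2b Hu]|zb].
- rewrite (aux (n2 z b * \prod_(j in B) (a b j * d z j))); last first.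
    move=> I IB; rewrite n1b !mul0r add0r -mulrA; congr (_ * _); rewrite mulrC.
    apply: split => // j jB; rewrite -Hw //.
    by rewrite -n2d ?dB // divfK ?dB.
  rewrite (aux (n2 z b * \prod_(j in B) (a b j * d z j))) ?IH //.
  move=> I IB; rewrite n1b !mul0r addr0 -mulrA; congr (_ * _).
  by apply: split => // j jB; rewrite -Hw // -n2d ?dB // divfK ?dB.
- rewrite (aux (n1 z b * \prod_(j in B) (a j b * d z j))); last first.
    move=> I IB; rewrite n2b !mul0r addr0 -mulrA; congr (_ * _).
    by apply: split => // j jB; rewrite -Hu // -n1d ?dB // divfK ?dB.
  rewrite (aux (n1 z b * \prod_(j in B) (a j b * d z j))) ?IH //.
  move=> I IB; rewrite n2b !mul0r add0r -mulrA; congr (_ * _); rewrite mulrC.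
  by apply: split => // j jB; rewrite -Hu // -n1d ?dB // divfK ?dB.
(* At z = x_b the two numerators are opposite, so the two summands attached to each I cancel and
   both sides vanish separately. *)
- have n12 : n2 z b = - n1 z b by rewrite /n1 /n2 zb; ring.
  rewrite (aux 0); last first.
    move=> I IB; rewrite n12 !mulNr; apply/eqP; rewrite subr_eq0; apply/eqP.
    rewrite -[LHS]mulrA -[RHS]mulrA; congr (_ * _); rewrite [RHS]mulrC; congr (_ * _).
      by apply: eq_bigr => j /(subsetP IB) jB; rewrite /a -zb -n2d ?dB // divfK ?dB.
    by apply: eq_bigr => j; rewrite inE => /andP[_ jB]; rewrite /a -zb -n1d ?dB // divfK ?dB.
  rewrite (aux 0) ?mulr0 //.
  move=> I IB; rewrite n12 !mulNr addrC; apply/eqP; rewrite subr_eq0; apply/eqP.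
  rewrite -[LHS]mulrA -[RHS]mulrA; congr (_ * _); rewrite mulrC; congr (_ * _).
    by apply: eq_bigr => j /(subsetP IB) jB; rewrite /a' -zb -n1d ?dB // divfK ?dB.
  by apply: eq_bigr => j; rewrite inE => /andP[_ jB]; rewrite /a' -zb -n2d ?dB // divfK ?dB.
Qed.

(** Induction on |B|. With the variable of one point b0 replaced by an indeterminate z, the
    difference of the two sides, cleared of denominators, has degree at most 3 |B'| for B' = B minus
    b0. It vanishes at the 3 |B'| + 1 distinct points 0, x_b, q x_b and x_b / q with b in B'. *)
Lemma cut_sum_sym B p : cut_sum a B p = cut_sum a' B p.
Proof.
have [n] := ubnP #|B|; elim: n B p => // n IHn B p; rewrite ltnS => Bn.
have [->|[b0 b0B]] := set_0Vmem B.
  rewrite /cut_sum; apply: eq_bigr => I; rewrite subset0 => /eqP ->.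
  by rewrite /cut !big_set0.
rewrite -(setD1K b0B); set B' := B :\ b0.
have b0B' : b0 \notin B' by rewrite !inE eqxx.
have B'n : (#|B'| < n)%N.
  by move: Bn; rewrite (cardsD1 b0) b0B add1n.
pose P := cut_num (fun I => (cut a B' I)%:P) n1P n2P dP B' p
        - cut_num (fun I => (cut a' B' I)%:P) n2P n1P dP B' p.
have PE z : P.[z] = num z B' p.
  rewrite /P hornerD hornerN !horner_cut_num /num /cut_num.
  by congr (_ - _); apply: eq_bigr => I _; congr (_ * _ * _ *+ _ + _ * _ * _ *+ _);
    apply: eq_bigr => j _; rewrite ?dPE ?n1PE ?n2PE.
have sP : (size P <= (3 * #|B'|).+1)%N.
  apply: leq_trans (size_polyD _ _) _; rewrite size_polyN geq_max.
  by rewrite !size_cut_num // => j; apply: size_toP.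
have num_unit z : (forall j, j \in B' -> d z j != 0) ->
    num z B' p = (\prod_(j in B') d z j) * (
      (\sum_(I : {set A} | I \subset B')
         (cut a B' I * (\prod_(j in B' :\: I) pair_coef z (x j)) *+ (#|I|.+1 == p)
        + cut a B' I * (\prod_(j in I) pair_coef (x j) z) *+ (#|I| == p)))
    - (\sum_(I : {set A} | I \subset B')
         (cut a' B' I * (\prod_(j in B' :\: I) pair_coef (x j) z) *+ (#|I|.+1 == p)
        + cut a' B' I * (\prod_(j in I) pair_coef z (x j)) *+ (#|I| == p)))).
  move=> dB; rewrite /num !cut_num_unit // -mulrBr.
  have dBI I j : j \in B' :\: I -> d z j != 0.
    by rewrite in_setD => /andP[_]; apply: dB.
  have dI (I : {set A}) j : I \subset B' -> j \in I -> d z j != 0.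
    by move=> IB /(subsetP IB); apply: dB.
  congr (_ * (_ - _)); apply: eq_bigr => I IB;
    congr (_ * _ *+ _ + _ * _ *+ _); apply: eq_bigr => j;
    by [move=> /dBI h; rewrite ?n1d ?n2d | move=> /(dI _ _ IB) h; rewrite ?n1d ?n2d].
pose rs := 0 :: [seq x b | b <- enum B'] ++ [seq q * x b | b <- enum B']
    ++ [seq q^-1 * x b | b <- enum B'].
have P0 : P = 0.
  apply/eqP/negPn/negP => Pn0.
  have rootB (f : A -> F) :
      (forall b, let B1 := B' :\ b in b \notin B1 -> cut_sum a B1 p.-1 = cut_sum a' B1 p.-1 ->
       num (f b) (b |: B1) p = 0) ->
      all (root P) [seq f b | b <- enum B'].
    move=> H; apply/allP => v /mapP[b bB ->]; move: bB; rewrite mem_enum => bB.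
    apply/rootP; rewrite PE -(setD1K bB); apply: H; first by rewrite !inE eqxx.
    by apply: IHn; apply: leq_ltn_trans B'n; apply/subset_leq_card/subD1set.
  have allr : all (root P) rs.
    rewrite /= !all_cat; apply/and4P; split.
    (* At z = 0 every coefficient involving z equals T, and both sides become the same combination
       of cut sums of B' for the sizes p - 1 and p. *)
    - apply/rootP; rewrite PE num_unit //.
      apply/eqP; rewrite mulf_eq0 subr_eq0; apply/orP; right; apply/eqP.
      have aux (a1 : A -> A -> F) (u w : A -> F) : (forall j, u j = T) -> (forall j, w j = T) ->
        \sum_(I : {set A} | I \subset B')
         (cut a1 B' I * (\prod_(j in B' :\: I) u j) *+ (#|I|.+1 == p)
         + cut a1 B' I * (\prod_(j in I) w j) *+ (#|I| == p)) =
        T ^+ (#|B'| - p.-1) * cut_sum a1 B' p.-1 *+ (0 < p) + T ^+ p * cut_sum a1 B' p.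
        move=> uT wT; rewrite !mulr_sumr -sumrMnl -big_split /=; apply: eq_bigr => I IB.
        rewrite (eq_bigr (fun=> T)) // prodr_const (eq_bigr (fun=> T)) // prodr_const.
        rewrite cardsD (setIidPr IB).
        congr (_ + _).
          case: (p) => [|p'] //=; rewrite eqSS mulr1n.
          by case: eqP => [->|_]; rewrite ?mulr0n ?mulr0 // mulr1n mulrC.
        by case: eqP => [->|_]; rewrite ?mulr0n ?mulr0 // mulr1n mulrC.
      rewrite !aux ?IHn // => j; rewrite ?pc_x0 ?pc_0x //.
    - apply: rootB => b B1 bb IHb; apply: num_root => //; last exact: Or33.
        by rewrite /d subrr !mul0r.
      by move=> j; rewrite !inE eq_sym => /andP[bj _]; apply: d_x.
    - apply: rootB => b B1 bb IHb; apply: num_root => //.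
      + by rewrite /d subrr mulr0.
      + by move=> j; rewrite !inE eq_sym => /andP[bj _]; apply: d_qx.
      + by apply: Or31; split => [|j _]; rewrite ?pc_qx // /n1 subrr mulr0.
    - apply: rootB => b B1 bb IHb; apply: num_root => //.
      + by rewrite /d mulVKf // subrr mulr0 mul0r.
      + by move=> j; rewrite !inE eq_sym => /andP[bj _]; apply: d_xq.
      + apply: Or32; split => [|j _]; first by rewrite /n2 mulVKf // subrr mulr0 oppr0.
        by rewrite -pc_qx // mulVKf.
  have urs : uniq rs.
    have xqI : injective (fun b => q * x b) by move=> b c /(mulfI q0)/xI.
    have xqI' : injective (fun b => q^-1 * x b) by move=> b c /(mulfI (invr_neq0 q0))/xI.
    rewrite /= !cat_uniq !map_inj_uniq // !enum_uniq /= !andbT !mem_cat !negb_or.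
    apply/andP; split.
      apply/and3P; split; apply/mapP => -[b _] /esym/eqP; first by rewrite (negPf (x0 b)).
        by rewrite mulf_eq0 (negPf q0) (negPf (x0 b)).
      by rewrite mulf_eq0 invr_eq0 (negPf q0) (negPf (x0 b)).
    rewrite has_cat negb_or -andbA; apply/and3P; split.
    - by apply/hasPn => _ /mapP[b _ ->]; apply/mapP => -[c _] /eqP; rewrite (negPf (qx _ _)).
    - apply/hasPn => _ /mapP[b _ ->]; apply/mapP => -[c _] /(congr1 ( *%R q))/eqP.
      by rewrite mulVKf // eq_sym (negPf (qx _ _)).
    - apply/hasPn => _ /mapP[b _ ->]; apply/mapP => -[c _] /(congr1 ( *%R q))/eqP.
      by rewrite mulVKf // eq_sym (negPf (qqx _ _)).
  have := max_poly_roots Pn0 allr urs.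
  rewrite /rs /= !size_cat !size_map -!cardE ltnNge => /negP; apply.
  by apply: leq_trans sP _; rewrite ltnS !mulSn mul0n addn0.
(* The identity for B is recovered at z = x_{b0}, where the cleared denominators are nonzero. *)
have dB0 j : j \in B' -> d (x b0) j != 0.
  by move=> jB; apply: d_x; apply: contraNneq b0B' => ->.
have := num_unit _ dB0; rewrite -PE P0 horner0 => /esym/eqP.
have D0 : \prod_(j in B') d (x b0) j != 0 by apply/prodf_neq0.
rewrite mulf_eq0 subr_eq0 (negPf D0) /=.
by move/eqP => h; rewrite !cut_sumU1.
Qed.

End Commute.

(** * Shift operators on rational functions *)

HB.instance Definition _ (K : fieldType) (k : nat) :=
  GRing.RMorphism.copy (@rfpoly K k) (@FracField.tofrac {mpoly K[k]}).
HB.instance Definition _ (K : fieldType) (k : nat) :=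
  GRing.RMorphism.copy (@rfconst K k) (@rfpoly K k \o @mpolyC k K).

Section Ratfun.

Variables (K : fieldType) (k : nat).

Lemma ratfunP (f : ratfun K k) :
  exists u v, v != 0 /\ f = rfpoly u / rfpoly v.
Proof.
exists \n_(generic_quotient.repr f), \d_(generic_quotient.repr f); split; first exact: denom_ratioP.
rewrite /rfpoly; unlock FracField.tofrac.
rewrite -[X in _ = _ * X]FracField.pi_inv -[RHS]FracField.pi_mul.
rewrite /FracField.mulf /FracField.invf /=.
rewrite !numden_Ratio ?oner_neq0 ?denom_ratioP //.
by rewrite mulr1 mul1r Ratio_numden reprK.
Qed.

Lemma rfpoly_inj : injective (@rfpoly K k).
Proof. by move=> p r /eqP; rewrite tofrac_eq => /eqP. Qed.

Lemma rfpoly_eq0 (p : {mpoly K[k]}) : (rfpoly p == 0) = (p == 0).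
Proof. exact: tofrac_eq0. Qed.

Lemma mmap_ext (R : nzRingType) (S : comNzRingType) n (f : {rmorphism {mpoly R[n]} -> S})
    (p : {mpoly R[n]}) : mmap (f \o @mpolyC n R) (fun i => f 'X_i) p = f p.
Proof.
rewrite [in RHS](mpolyE p) rmorph_sum; apply: eq_bigr => m _.
rewrite -mul_mpolyC rmorphM; congr (_ * _).
by rewrite mpolyXE_id rmorph_prod; apply: eq_bigr => i _; rewrite rmorphXn.
Qed.

Lemma rfpolyE (p : {mpoly K[k]}) : rfpoly p = mmap (@rfconst K k) (@rfvar K k) p.
Proof. by rewrite -[LHS](mmap_ext (@rfpoly K k)). Qed.

Lemma ratfun_ext (L : fieldType) (f g : {rmorphism ratfun K k -> L}) :
  (forall c, f (rfconst k c) = g (rfconst k c)) ->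
  (forall i, f (rfvar K i) = g (rfvar K i)) -> f =1 g.
Proof.
move=> fc fv h; have [u [v [v0 ->]]] := ratfunP h.
have fp p : f (rfpoly p) = g (rfpoly p).
  rewrite -[LHS](mmap_ext (f \o @rfpoly K k)) -[RHS](mmap_ext (g \o @rfpoly K k)).
  apply: eq_bigr => m _ /=; rewrite fc; congr (_ * _).
  by apply: eq_bigr => i _; congr (_ ^+ _); apply: fv.
by rewrite !rmorphM !fmorphV /= !fp.
Qed.

Lemma rfvar_neq0 i : rfvar K i != 0 :> ratfun K k.
Proof.
rewrite rfpoly_eq0; apply/eqP => /(congr1 (mcoeff U_(i)))/eqP.
by rewrite mcoeffXU mcoeff0 eqxx oner_eq0.
Qed.

Lemma rfvar_scale_eq c i j : rfconst k c * rfvar K i = rfvar K j -> i = j /\ c = 1.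
Proof.
rewrite /rfconst /rfvar -rmorphM mul_mpolyC => /rfpoly_inj h.
have := congr1 (mcoeff U_(j)) h; rewrite mcoeffZ !mcoeffXU eqxx.
by case: eqP => [->|_]; rewrite ?mulr1 // mulr0 => /esym/eqP; rewrite oner_eq0.
Qed.

Lemma rfvar_inj : injective (@rfvar K k).
Proof. by move=> i j h; case: (@rfvar_scale_eq 1 i j) => //; rewrite rmorph1 mul1r. Qed.

End Ratfun.

Section Shift.

Variables (K : fieldType) (k : nat) (q : K).
Hypothesis q0 : q != 0.

Let pshift_poly0 (i : 'I_k) (u : {mpoly K[k]}) : u != 0 -> pshift_poly q i u != 0.
Proof.
(* If u were sent to 0, the shift of u / u = 1 would be 0 / 0, that is 0, although 1 is fixed. *)
move=> u0; have := @pshift_frac K k q q0 i u u u0.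
rewrite divff ?rfpoly_eq0 // => h; apply/eqP => p0; move: h; rewrite p0 rmorph0 mul0r.
have := @pshift_frac K k q q0 i 1 1 (oner_neq0 _).
rewrite rmorph1 invr1 mulr1 => -> /eqP.
by rewrite /pshift_poly comp_mpoly1 rmorph1 divr1 oner_eq0.
Qed.

Let pshift_rfpoly i (u : {mpoly K[k]}) : pshift q i (rfpoly u) = rfpoly (pshift_poly q i u).
Proof.
rewrite -[rfpoly u]divr1 -(rmorph1 (@rfpoly K k)) pshift_frac ?oner_neq0 //.
by rewrite /pshift_poly comp_mpoly1 rmorph1 divr1.
Qed.

Let pshiftM (i : 'I_k) : {morph pshift q i : f g / f * g}.
Proof.
move=> f g; have [u [v [v0 ->]]] := ratfunP f; have [u' [v' [v0' ->]]] := ratfunP g.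
rewrite mulf_div -!rmorphM !pshift_frac ?mulf_neq0 // mulf_div -!rmorphM.
by rewrite /pshift_poly !rmorphM.
Qed.

Let pshiftB (i : 'I_k) : {morph pshift q i : f g / f - g}.
Proof.
move=> f g; have [u [v [v0 ->]]] := ratfunP f; have [u' [v' [v0' ->]]] := ratfunP g.
have n0 w : w != 0 -> rfpoly w != 0 by rewrite rfpoly_eq0.
have s0 w : w != 0 -> pshift_poly q i w != 0 by apply: pshift_poly0.
rewrite -mulNr addf_div ?n0 // -!rmorphN -!rmorphM -rmorphD !pshift_frac ?mulf_neq0 //.
rewrite -mulNr addf_div ?n0 ?s0 // -!rmorphN -!rmorphM -rmorphD.
by rewrite /pshift_poly !(rmorphM, rmorphD, rmorphN).
Qed.

Let pshift1 (i : 'I_k) : pshift q i 1 = 1.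
Proof.
rewrite -[1 in LHS](rmorph1 (@rfpoly K k)) pshift_rfpoly.
by rewrite /pshift_poly comp_mpoly1 rmorph1.
Qed.

Let pshift_const i c : pshift q i (rfconst k c) = rfconst k c.
Proof. by rewrite /rfconst pshift_rfpoly /pshift_poly comp_mpolyC. Qed.

Let pshift_var i j : pshift q i (rfvar K j) = rfconst k (q ^+ (i == j)) * rfvar K j.
Proof.
rewrite /rfvar pshift_rfpoly /pshift_poly comp_mpolyXU -tnth_nth tnth_mktuple.
by rewrite -mul_mpolyC rmorphM.
Qed.

(* Carrying the proof of q != 0 lets ring morphism instances be declared on shift. *)
Definition shift of q != 0 := fun a : 'X_{1..k} => @pshifts K k q a.

Let pshifts_ind (P : (ratfun K k -> ratfun K k) -> Prop) (a : 'X_{1..k}) :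
  P id -> (forall i g, P g -> P (pshift q i \o g)) -> P (pshifts q a).
Proof.
move=> Pid Pstep; rewrite /pshifts; elim: (enum 'I_k) => [|i s IHs] //=.
by elim: (a i) => [|n IHn] //=; apply: Pstep.
Qed.

Let shift_zmod a : zmod_morphism (shift q0 a).
Proof.
by apply: (@pshifts_ind (fun g => zmod_morphism g)) => // i g Pg f h /=; rewrite Pg pshiftB.
Qed.

Let shift_monoid a : monoid_morphism (shift q0 a).
Proof.
split; first by apply: (@pshifts_ind (fun g => g 1 = 1)) => // i g /= ->.
by apply: (@pshifts_ind (fun g => {morph g : x y / x * y})) => // i g Pg f h /=; rewrite Pg pshiftM.
Qed.

HB.instance Definition _ a :=
  GRing.isZmodMorphism.Build (ratfun K k) (ratfun K k) (shift q0 a) (shift_zmod a).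
HB.instance Definition _ a :=
  GRing.isMonoidMorphism.Build (ratfun K k) (ratfun K k) (shift q0 a) (shift_monoid a).

Lemma shift_const a c : shift q0 a (rfconst k c) = rfconst k c.
Proof.
by apply: (@pshifts_ind (fun g => g (rfconst k c) = rfconst k c)) => // i g /= ->.
Qed.

Lemma shift_var a j : shift q0 a (rfvar K j) = rfconst k (q ^+ a j) * rfvar K j.
Proof.
rewrite /shift /pshifts.
have iterE n i c : iter n (pshift q i) (rfconst k c * rfvar K j) =
    rfconst k (c * q ^+ (n * (i == j))) * rfvar K j.
  elim: n => [|n IHn] /=; first by rewrite mul0n expr0 mulr1.
  rewrite IHn pshiftM pshift_const pshift_var mulrA -rmorphM mulSn addnC exprD.
  by rewrite mulrA.
suff H s c : uniq s ->
    foldr (fun i => iter (a i) (pshift q i)) (rfconst k c * rfvar K j) s =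
    rfconst k (c * q ^+ (if j \in s then a j else 0%N)) * rfvar K j.
  by have := H (enum 'I_k) 1 (enum_uniq _); rewrite rmorph1 !mul1r mem_enum.
elim: s => [|i s IHs] /= => [_|/andP[nis us]]; first by rewrite expr0 mulr1.
rewrite IHs // iterE inE; case: (eqVneq i j) => [e|ij].
  by rewrite -e (negPf nis) /= expr0 mulr1 muln1.
by rewrite /= muln0 expr0 mulr1.
Qed.

Lemma shiftD a b f : shift q0 a (shift q0 b f) = shift q0 (a + b)%MM f.
Proof.
apply: (ratfun_ext (f := shift q0 a \o shift q0 b) (g := shift q0 (a + b)%MM)) => /= [c|i].
  by rewrite !shift_const.
rewrite !shift_var rmorphM /= shift_const shift_var mulrA -rmorphM.
by rewrite /= mnmDE exprD mulrC [q ^+ a i * _]mulrC [RHS]mulrC.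
Qed.

Lemma shift_rfpoly a p :
  shift q0 a (rfpoly p) = mmap (@rfconst K k) (fun i => rfconst k (q ^+ a i) * rfvar K i) p.
Proof.
rewrite -[LHS](mmap_ext (shift q0 a \o @rfpoly K k)); apply: eq_bigr => m _ /=.
rewrite shift_const; congr (_ * _); apply: eq_bigr => i _; congr (_ ^+ _).
exact: shift_var.
Qed.

End Shift.

(** * The operators D_d and the Macdonald operators *)

Section Qpoch.

Variables (F : fieldType) (q x : F).
Hypothesis q0 : q != 0.

Lemma qpoch_rev (n : nat) :
  qpoch q x n = \prod_(1 <= l < n.+1) (1 - x * q ^+ n * q ^- l).
Proof.
rewrite /qpoch big_nat_rev /= big_add1 /=; apply: eq_big_nat => i /andP[_ ni].
by rewrite add0n -mulrA -expfB_cond ?(negPf q0) //= ?subSS // ltnW.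
Qed.

Hypothesis xq : forall n : int, 1 - x * q ^ n != 0.

Lemma qpochS (n : int) : qpoch q x (n + 1) = qpoch q x n * (1 - x * q ^ n).
Proof.
case: n => [n|[|n]].
- by rewrite -PoszD addn1 /qpoch big_nat_recr.
- by rewrite /= big_geq // big_nat1 mulVf // (xq (Negz 0)).
- have -> : Negz n.+1 + 1 = Negz n by rewrite !NegzE -addn1 PoszD opprD addrK.
  by rewrite /qpoch [in RHS]big_nat_recr //= mulfVK // (xq (Negz n.+1)).
Qed.

Lemma qpoch_neq0 (n : int) : qpoch q x n != 0.
Proof.
case: n => n /=.
  by rewrite big_mkord; apply/prodf_neq0 => i _; apply: (xq i).
rewrite big_add1 big_mkord; apply/prodf_neq0 => i _; rewrite invr_eq0.
exact: (xq (Negz i)).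
Qed.

(** For m < c the convention for negative indices is what keeps the product uniform. *)
Lemma qpoch_ratio (m c : nat) :
  qpoch q x m / qpoch q x (m%:Z - c%:Z) = \prod_(1 <= l < c.+1) (1 - x * q ^+ m * q ^- l).
Proof.
elim: c => [|c IHc]; first by rewrite subr0 divff ?qpoch_neq0 // big_geq.
rewrite big_nat_recr //= -IHc.
have -> : m%:Z - c%:Z = (m%:Z - c.+1%:Z) + 1 by rewrite -addn1 PoszD; ring.
have E : 1 - x * q ^ (m%:Z - c.+1%:Z) = 1 - x * q ^+ m * q ^- c.+1.
  by rewrite expfzDr // -mulrA.
by rewrite qpochS invfM mulrA -E mulfVK.
Qed.

End Qpoch.

Definition mnm_seq k d : seq 'X_{1..k} :=
  [seq val a | a : 'X_{1..k < d.+1} <- enum {: 'X_{1..k < d.+1}} & mdeg a == d].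

Lemma mem_mnm_seq k d (m : 'X_{1..k}) : (m \in mnm_seq k d) = (mdeg m == d).
Proof.
apply/mapP/idP => [[a]|md]; first by rewrite mem_filter => /andP[h _] ->.
have lt : (mdeg m < d.+1)%N by rewrite (eqP md).
by exists (BMultinom lt); rewrite // mem_filter mem_enum andbT.
Qed.

Lemma mnm_seq_uniq k d : uniq (mnm_seq k d).
Proof.
rewrite map_inj_uniq; first by rewrite filter_uniq ?enum_uniq.
by move=> a b h; apply: val_inj.
Qed.

Lemma big_mnm_seq (V : nmodType) k d (f : 'X_{1..k} -> V) :
  \sum_(a : 'X_{1..k < d.+1} | mdeg a == d) f a = \sum_(a <- mnm_seq k d) f a.
Proof. by rewrite big_map big_filter big_enum_cond. Qed.

Lemma mulf_div_swap (F : fieldType) (p u v : F) :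
  u != 0 -> v != 0 -> v / u * p * (u / v) = p.
Proof.
by move=> u0 v0; rewrite mulrAC mulf_div [v * u]mulrC divff ?mulf_neq0 // mul1r.
Qed.

Lemma subr1_inv (F : fieldType) (s X W : F) : s != 0 -> X != 0 -> W != 0 ->
  1 - s^-1 * X * W^-1 = - (s * (W / X))^-1 * (1 - s * (W / X)).
Proof. by move=> s0 X0 W0; field; rewrite s0 X0 W0. Qed.

Lemma ratio1_inv (F : fieldType) (s X W : F) : s != 0 -> X != 0 -> W != 0 ->
  1 - s * (W / X) != 0 ->
  (1 - W / X) / (1 - s * (W / X)) = s^-1 * ((1 - X * W^-1) / (1 - s^-1 * X * W^-1)).
Proof.
move=> s0 X0 W0 h.
have h1 : X - s * W != 0.
  by apply: contra h => /eqP h; rewrite -(mulfK X0 (1 - _)) mulrBl mul1r -mulrA divfK // h mul0r.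
have h2 : s * W - X != 0 by rewrite -opprB oppr_eq0.
by field; rewrite s0 X0 W0 h1 h2.
Qed.

Lemma wronski_coef_term (K F : fieldType) (C : {rmorphism K -> F}) (s T qm : K) (V D Q : F) e n :
  s != 0 ->
  C (s ^+ n * (T ^+ e - qm)) * ((-1) ^+ e * V) * (D * (C (s ^- n) * Q)) =
  D * ((- C T) ^+ e * V * Q - C qm * ((- 1) ^+ e * V * Q)).
Proof.
move=> s0; rewrite (exprNn (C T)) rmorphM rmorphB (rmorphXn C e T) fmorphV.
have : C (s ^+ n) != 0 by rewrite fmorph_eq0 expf_neq0.
move: (C (s ^+ n)) (C T) (C qm) ((-1) ^+ e) => c1 c2 c3 c4 c10.
by field.
Qed.

Section Operators.

Variables (K : fieldType) (k : nat) (q t : K).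
Hypothesis charK : [pchar K] =i pred0.
Hypotheses (q0 : q != 0) (t0 : t != 0).
Hypothesis qn : forall n : nat, q ^+ n.+1 != 1.
Hypothesis tq : forall n : int, t * q ^ n != 1.

Notation L := (ratfun K k).
Notation C := (@rfconst K k).
Notation x := (@rfvar K k).
Notation sg := (shift q0).

Let s := t / q.
Let T := q / t.

Let C0 c : c != 0 -> C c != 0.
Proof. by move=> c0; rewrite fmorph_eq0. Qed.

Lemma rfvar_scale_neq (c : K) i j : i != j -> C c * x i / x j != 1.
Proof.
move=> ij; apply/eqP => h; move: ij; suff [-> _] : i = j /\ c = 1 by rewrite eqxx.
apply: (@rfvar_scale_eq K k).
by rewrite -[RHS]mul1r -h divfK ?rfvar_neq0.
Qed.

Let phi (X W : L) (n : nat) : L := \prod_(1 <= l < n.+1)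
  ((1 - C t * C q ^- l * (W / X)) / (1 - C q * C q ^- l * (W / X))).

Let w (c : 'X_{1..k}) j : L := C (q ^+ c j) * x j.

Let w0 c j : w c j != 0.
Proof. by rewrite mulf_neq0 ?rfvar_neq0 ?C0 ?expf_neq0. Qed.

Let wx_neq1 (d : K) (c : 'X_{1..k}) (i j : 'I_k) :
  (i = j -> d * q ^+ c j != 1) -> C d * (w c j / x i) != 1.
Proof.
rewrite /w !mulrA -rmorphM; have [->|ij _] := eqVneq i j.
  by move=> /(_ erefl) h; rewrite mulfK ?rfvar_neq0 // -(rmorph1 C) (inj_eq (fmorph_inj _)).
by rewrite rfvar_scale_neq // eq_sym.
Qed.

(** Dividing (t x_j/x_i)_{c_j} by (t x_j/x_i)_{c_j - c_i}, and likewise with q in place of t, leaves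
    c_i factors in the ratio of w_j = q^{c_j} x_j to x_i. *)
Lemma DcoefE (c : 'X_{1..k}) : Dcoef q t c = \prod_i \prod_j phi (x i) (w c j) (c i).
Proof.
apply: eq_bigr => i _; apply: eq_bigr => j _; cbv zeta.
(* On the diagonal 1 - q q^n vanishes at n = -1, outside the scope of [qpoch_ratio]; there the
   difference of indices is 0 and the second quotient is trivial. *)
have [->|ij] := eqVneq j i.
  have q1 u : qpoch (C q) u 0 = 1 by rewrite /= big_geq.
  rewrite subrr divff ?rfvar_neq0 // !mulr1 !q1 divr1 mulr1.
  rewrite !qpoch_rev ?C0 // -prodf_div; apply: eq_bigr => l _.
  by rewrite /w mulfK ?rfvar_neq0 // rmorphXn /= -!mulrA ![_ ^+ c i * _]mulrC.
have nz (d : K) (n : int) : 1 - C d * (x j / x i) * C q ^ n != 0.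
  rewrite subr_eq0 eq_sym mulrAC -(fmorphXz C) -rmorphM mulrA.
  exact: rfvar_scale_neq.
have qn1 (d : K) n : qpoch (C q) (C d * (x j / x i)) n != 0.
  exact: qpoch_neq0.
have alg (a b d e : L) : a / b * (d / e) = a / e / (b / d).
  by rewrite invf_div !mulf_div [b * e]mulrC.
rewrite alg !qpoch_ratio ?C0 // -prodf_div; apply: eq_bigr => l _.
have E (u a b p r : L) : u * (a / b) * p * r = u * r * (p * a / b) by ring.
by rewrite !E /w rmorphXn.
Qed.

Lemma phiS X W n : X != 0 -> phi X W n.+1 =
  (1 - C s * (W / X)) / (1 - W / X) * phi (C q * X) W n.
Proof.
move=> X0; rewrite /phi big_nat_recl //; congr (_ * _).
  rewrite expr1 divff ?C0 // mul1r; congr ((1 - _ * _) / _).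
  by rewrite /s rmorphM fmorphV.
apply: eq_big_nat => l _ /=; congr ((1 - _) / (1 - _));
  by rewrite exprSr !invfM -!mulrA; do 2!congr (_ * _); rewrite mulrCA.
Qed.

Lemma shift_phi a X W n : sg a (phi X W n) = phi (sg a X) (sg a W) n.
Proof.
rewrite rmorph_prod /=; apply: eq_bigr => l _.
rewrite !(rmorphM, rmorphB, rmorph1, fmorphV, rmorphXn) /= !shift_const.
by [].
Qed.

Let wI c : injective (w c).
Proof.
move=> i j h; apply/eqP/negPn/negP => ij.
have /eqP[] := @rfvar_scale_neq (q ^+ c i / q ^+ c j) i j ij.
rewrite rmorphM /= fmorphV -mulrA mulrACA -invfM.
by have := h; rewrite /w => ->; rewrite divff // w0.
Qed.

Let s0 : s != 0. Proof. by rewrite mulf_neq0 ?invr_eq0. Qed.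

Let sT : s^-1 = T. Proof. exact: invf_div. Qed.

Let sq_neq1 n : s * q ^+ n != 1.
Proof. by have := tq (n%:Z - 1); rewrite expfzDr // [q ^ n * _]mulrC mulrA. Qed.

Let swx_neq1 c i j : 1 - C s * (w c j / x i) != 0.
Proof. by rewrite subr_eq0 eq_sym wx_neq1. Qed.

Lemma mesym1E (I : {set 'I_k}) i : mesym1 I i = (i \in I) :> nat.
Proof. by rewrite mnmE. Qed.

(** The shift by I and the removal of I from c compensate in each w_j. By [phiS], every [phi] with i
    in I just loses its first factor. *)
Lemma shift_Dcoef (I : {set 'I_k}) c : (mesym1 I <= c)%MM ->
  sg (mesym1 I) (Dcoef q t (c - mesym1 I)%MM) =
  Dcoef q t c * \prod_(i in I) \prod_j ((1 - w c j / x i) / (1 - C s * (w c j / x i))).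
Proof.
move=> Ic; rewrite !DcoefE rmorph_prod [X in _ = _ * X]big_mkcond -big_split /=.
apply: eq_bigr => i _; rewrite rmorph_prod.
have wE j : sg (mesym1 I) (w (c - mesym1 I)%MM j) = w c j.
  rewrite /w rmorphM /= shift_const shift_var mulrA -rmorphM -exprD.
  by rewrite mnmBE subnK //; apply: (mnm_lepP Ic).
under eq_bigr => j _ do rewrite /= shift_phi wE shift_var mnmBE mesym1E.
case: ifP => iI; last first.
  by rewrite mulr1; apply: eq_bigr => j _; rewrite expr0 rmorph1 mul1r subn0.
rewrite -big_split /=; apply: eq_bigr => j _; rewrite expr1.
have ci : (0 < c i)%N by have := mnm_lepP Ic i; rewrite mesym1E iI.
rewrite -{2}(prednK ci) phiS ?rfvar_neq0 // subn1.
have h1 : 1 - w c j / x i != 0.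
  rewrite subr_eq0 eq_sym -[_ / _]mul1r -(rmorph1 C); apply: wx_neq1 => <-.
  by rewrite mul1r -(prednK ci).
by rewrite (mulf_div_swap _ h1 (swx_neq1 c i j)).
Qed.

Definition mac_coef (I : {set 'I_k}) : L :=
  (-1) ^+ #|I| * (vdm (scale_on I (C T) x) / vdm x).

(* (-1)^r times the r-th Macdonald operator of parameters (q, q / t). *)
Definition mac_op (r : nat) (f : L) : L :=
  \sum_(I : {set 'I_k} | #|I| == r) mac_coef I * sg (mesym1 I) f.

(** With y_j = 1/w_j the product of the x_i y_i is q^-m, so the kernel identity says that the sums
    at z = T and z = 1 differ by the factor q^m; hence T^r - q^m. The power of s = t/q compensates
    the passage from w_j/x_i to x_i y_j in the k |I| factors. *)
Lemma wronski_coef (c : 'X_{1..k}) (m : nat) : mdeg c = m ->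
  \sum_(I : {set 'I_k} | (mesym1 I <= c)%MM)
    C (s ^+ (k * #|I|) * (T ^+ #|I| - q ^+ m)) * mac_coef I *
      sg (mesym1 I) (Dcoef q t (c - mesym1 I)%MM) = 0.
Proof.
move=> cm; pose y j := (w c j)^-1.
have y0 j : y j != 0 by rewrite invr_eq0.
have yI : injective y by move=> i j /invr_inj/wI.
have charL : [pchar L] =i pred0.
  by move=> p; rewrite (fmorph_pchar C) charK.
have CTE i j : 1 - C T * x i * y j = - (C s * (w c j / x i))^-1 * (1 - C s * (w c j / x i)).
  by rewrite -sT fmorphV /y subr1_inv ?w0 ?C0 ?rfvar_neq0.
have Txy i j : 1 - C T * x i * y j != 0.
  rewrite CTE; apply: mulf_neq0 => //; rewrite oppr_eq0 invr_eq0.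
  by apply: mulf_neq0; rewrite ?C0 //; apply: mulf_neq0; rewrite ?invr_eq0 ?rfvar_neq0.
pose Q (I : {set 'I_k}) := \prod_(i in I) \prod_j ((1 - x i * y j) / (1 - C T * x i * y j)).
have PQ (I : {set 'I_k}) :
    \prod_(i in I) \prod_j ((1 - w c j / x i) / (1 - C s * (w c j / x i))) =
    C (s ^- (k * #|I|)) * Q I.
  rewrite (eq_bigr (fun i => C s^-1 ^+ k * \prod_j ((1 - x i * y j) / (1 - C T * x i * y j)))).
    by rewrite big_split /= prodr_const -exprM -rmorphXn /= -exprVn.
  move=> i _; rewrite (eq_bigr (fun j => C s^-1 * ((1 - x i * y j) / (1 - C T * x i * y j)))).
    by rewrite big_split /= prodr_const card_ord.
  by move=> j _; rewrite ratio1_inv ?w0 ?C0 ?rfvar_neq0 // -sT fmorphV.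
transitivity (Dcoef q t c * (kernel_sum (C T) (C T) x y - C (q ^+ m) * kernel_sum (C T) 1 x y)).
  rewrite [C (q ^+ m) * _]mulr_sumr -sumrB mulr_sumr big_mkcond.
  apply: eq_bigr => I _; case: ifP => Ic.
    rewrite shift_Dcoef // PQ /mac_coef.
    exact: wronski_coef_term.
  (* A set I not contained in c has an element i with c_i = 0, and then 1 - x_i y_i = 0. *)
  suff Q0 : Q I = 0 by rewrite -/(Q I) Q0 !mulr0 subrr mulr0.
  have [i iI ci] : exists2 i, i \in I & c i = 0%N.
    move: (negbT Ic); rewrite negb_forall; case/existsP=> i; rewrite mesym1E.
    case: (boolP (i \in I)) => // iI; rewrite -ltnNge ltnS leqn0 => /eqP ci.
    by exists i.
  rewrite /Q (bigD1 i) //= (bigD1 i) //= /y /w ci expr0 rmorph1 mul1r divff ?rfvar_neq0 //.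
  by rewrite subrr !mul0r.
rewrite kernel_sum_wronski_ext //; last exact: rfvar_inj.
rewrite (_ : \prod_i (x i * y i) = C (q ^- m)).
  by rewrite mulrA -rmorphM divff ?expf_neq0 // rmorph1 mul1r subrr mulr0.
rewrite -cm mdegE -prodrXr -prodfV rmorph_prod; apply: eq_bigr => i _.
by rewrite /y /w invfM mulrCA divff ?rfvar_neq0 // mulr1 /= fmorphV.
Qed.

End Operators.

Section Wronski.

Variables (K : fieldType) (k : nat) (q t : K).
Hypothesis charK : [pchar K] =i pred0.
Hypotheses (q0 : q != 0) (t0 : t != 0).
Hypothesis qn : forall n : nat, q ^+ n.+1 != 1.
Hypothesis tq : forall n : int, t * q ^ n != 1.

Notation L := (ratfun K k).
Notation C := (@rfconst K k).
Notation sg := (shift q0).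
Notation mac := (mac_op (k := k) t q0).
Notation D := (@Dop K k q t).

Lemma DopE d f : D d f = \sum_(a <- mnm_seq k d) Dcoef q t a * sg a f.
Proof. by rewrite -big_mnm_seq. Qed.

Lemma Dop_sum d (J : Type) (r : seq J) (P : pred J) F :
  D d (\sum_(j <- r | P j) F j) = \sum_(j <- r | P j) D d (F j).
Proof.
rewrite DopE; under [RHS]eq_bigr => j _ do rewrite DopE.
by rewrite exchange_big /=; apply: eq_bigr => a _; rewrite rmorph_sum mulr_sumr.
Qed.

Lemma DopZ d c f : D d (C c * f) = C c * D d f.
Proof.
rewrite !DopE mulr_sumr; apply: eq_bigr => a _.
by rewrite rmorphM /= shift_const mulrCA.
Qed.

Lemma mac_op_sum d (J : Type) (r : seq J) (P : pred J) F :
  mac d (\sum_(j <- r | P j) F j) = \sum_(j <- r | P j) mac d (F j).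
Proof.
rewrite exchange_big /=; apply: eq_bigr => a _.
by rewrite rmorph_sum mulr_sumr.
Qed.

Lemma mac_opZ d c f : mac d (C c * f) = C c * mac d f.
Proof.
rewrite mulr_sumr; apply: eq_bigr => a _.
by rewrite rmorphM /= shift_const mulrCA.
Qed.

Lemma mnm_seq_add (a : 'X_{1..k}) m : (mdeg a <= m)%N ->
  perm_eq [seq (a + b)%MM | b <- mnm_seq k (m - mdeg a)]
          [seq c <- mnm_seq k m | (a <= c)%MM].
Proof.
move=> am; apply: uniq_perm.
- by rewrite map_inj_uniq ?mnm_seq_uniq // => b c /addmI.
- by rewrite filter_uniq // mnm_seq_uniq.
move=> c; rewrite mem_filter mem_mnm_seq; apply/mapP/andP => [[b]|[ac /eqP cm]].
  by rewrite mem_mnm_seq => /eqP bm ->; rewrite lem_addr mdegD bm subnKC.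
exists (c - a)%MM; last by rewrite addmC submK.
by rewrite mem_mnm_seq -(eqn_add2r (mdeg a)) -mdegD submK // subnK // cm.
Qed.

(** Collecting the terms of equal total shift c, the sum of the shift by I and of a shift from
    D_{m-r}, reduces the operator identity to [wronski_coef]. *)
Lemma wronski (m : nat) (f : L) :
  \sum_(r < m.+1) C ((t / q) ^+ (k * r) * ((q / t) ^+ r - q ^+ m)) * mac r (D (m - r) f) = 0.
Proof.
pose be r := C ((t / q) ^+ (k * r) * ((q / t) ^+ r - q ^+ m)).
pose G (I : {set 'I_k}) c :=
  be #|I| * mac_coef q t I * sg (mesym1 I) (Dcoef q t (c - mesym1 I)%MM) * sg c f.
transitivity (\sum_(r < m.+1) \sum_(I : {set 'I_k} | #|I| == r)
    \sum_(c <- mnm_seq k m | (mesym1 I <= c)%MM) G I c).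
  apply: eq_bigr => r _; rewrite mulr_sumr; apply: eq_bigr => I /eqP Ir.
  have Im : (mdeg (mesym1 I) <= m)%N by rewrite mdeg_mesym1 Ir -ltnS.
  rewrite -[RHS]big_filter -(perm_big _ (mnm_seq_add Im)) big_map mdeg_mesym1 Ir.
  rewrite DopE rmorph_sum !mulr_sumr; apply: eq_bigr => a _.
  rewrite /G rmorphM /= shiftD Ir !mulrA; congr (_ * _ * _).
  by rewrite [X in (X - _)%MM]addmC addmK.
transitivity (\sum_(c <- mnm_seq k m) \sum_(I : {set 'I_k} | (mesym1 I <= c)%MM) G I c); last first.
  rewrite big_seq big1 // => c; rewrite mem_mnm_seq => /eqP cm.
  by rewrite -mulr_suml (wronski_coef charK q0 t0 qn tq cm) mul0r.
under eq_bigr => r _ do rewrite (exchange_big_dep xpredT) //=.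
rewrite (exchange_big_dep xpredT) //= big_seq [RHS]big_seq; apply: eq_bigr => c.
rewrite mem_mnm_seq => /eqP cm.
rewrite (exchange_big_dep xpredT) //= [RHS]big_mkcond /=; apply: eq_bigr => I _.
case: ifP => Ic; last by rewrite big1 // => r; rewrite andbF.
have Im : (#|I| < m.+1)%N.
  rewrite ltnS -mdeg_mesym1 -cm !mdegE; apply: leq_sum => i _; exact: (mnm_lepP Ic).
by rewrite (big_pred1 (Ordinal Im)) // => r; rewrite andbT eq_sym.
Qed.

End Wronski.

(** * Commutation of the Macdonald operators *)

Lemma big_ord_pairs (R : Type) (idx : R) (op : Monoid.com_law idx) k (f : 'I_k -> 'I_k -> R) :
  \big[op/idx]_(i < k) \big[op/idx]_(j < k | (i < j)%N) op (f i j) (f j i) =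
  \big[op/idx]_(i < k) \big[op/idx]_(j < k | j != i) f i j.
Proof.
transitivity (op (\big[op/idx]_(i < k) \big[op/idx]_(j < k | (i < j)%N) f i j)
   (\big[op/idx]_(i < k) \big[op/idx]_(j < k | (j < i)%N) f i j)).
  rewrite [X in op _ X](exchange_big_dep xpredT) //= -big_split /=.
  by apply: eq_bigr => i _; rewrite big_split.
rewrite -big_split /=; apply: eq_bigr => i _.
rewrite [RHS](bigID (fun j : 'I_k => (i < j)%N)) /=.
by congr (op _ _); apply: eq_bigl => j; rewrite -val_eqE /=; case: ltngtP.
Qed.

(** A pair inside I contributes T, a pair separated by I contributes (T x_i - x_j)/(x_i - x_j) with
    i in I, and the other pairs contribute 1. *)
Lemma vdm_scale_cut (F : fieldType) k (T : F) (x : 'I_k -> F) (I : {set 'I_k}) :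
  injective x ->
  vdm (scale_on I T x) / vdm x =
  T ^+ (#|I| * #|I|.-1)./2 * cut (fun i j => (T * x i - x j) / (x i - x j)) [set: 'I_k] I.
Proof.
move=> xI.
pose f i j := if (i \in I) && (j \notin I) then (T * x i - x j) / (x i - x j) else 1.
pose g (i j : 'I_k) : nat := (i \in I) && (j \in I).
have -> : cut (fun i j => (T * x i - x j) / (x i - x j)) [set: 'I_k] I =
    \prod_(i < k) \prod_(j < k | (i < j)%N) (f i j * f j i).
  rewrite big_ord_pairs /cut big_mkcond /=; apply: eq_bigr => i _.
  rewrite big_mkcond [RHS]big_mkcond /=; case: ifP => iI; last first.
    by rewrite big1 // => j _; rewrite /f iI; case: ifP.
  apply: eq_bigr => j _; rewrite /f iI !inE andbT /=.
  by case: eqVneq => [->|_]; rewrite ?iI.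
have -> : ((#|I| * #|I|.-1)./2 = \sum_(i < k) \sum_(j < k | (i < j)%N) g i j)%N.
  rewrite -[RHS]doubleK -addnn -big_split /=; congr _./2.
  rewrite (eq_bigr (fun i : 'I_k => \sum_(j < k | (i < j)%N) (g i j + g j i)))%N; last first.
    move=> i _; rewrite -big_split /=; apply: eq_bigr => j _.
    by rewrite {2}/g andbC.
  rewrite big_ord_pairs.
  rewrite -sum_nat_const big_mkcond; apply: eq_bigr => i _ /=.
  case: ifP => iI; last by rewrite big1 // => j _; rewrite /g iI.
  rewrite (cardsD1 i) iI add1n /= -sum1_card big_mkcond [RHS]big_mkcond /=.
  by apply: eq_bigr => j _; rewrite !inE /g iI; case: (j != i); case: (j \in I).
rewrite -prodrXr -big_split -prodf_div /=; apply: eq_bigr => i _.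
rewrite -prodrXr -big_split -prodf_div /=; apply: eq_bigr => j ij.
have xij : x i - x j != 0.
  by rewrite subr_eq0 (inj_eq xI) -val_eqE /= neq_ltn ij.
have xji : x j - x i != 0 by rewrite -opprB oppr_eq0.
rewrite /scale_on /f /g; case: (i \in I); case: (j \in I); rewrite ?expr1 ?expr0 /=; field;
  by rewrite ?xij ?xji.
Qed.

(** The pairs (I, J) are grouped by their intersection and symmetric difference, which determine the
    composite shift; the inner variable is the difference of I and J. *)
Lemma sum_set_pairs (V : nmodType) (A : finType) (F : {set A} -> {set A} -> V) :
  \sum_I \sum_J F I J =
  \sum_(P : {set A} * {set A} | [disjoint P.1 & P.2])
    \sum_(I : {set A} | I \subset P.2) F (P.1 :|: I) (P.1 :|: (P.2 :\: I)).
Proof.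
rewrite pair_big /=.
pose h (p : {set A} * {set A}) := (p.1 :&: p.2, (p.1 :\: p.2) :|: (p.2 :\: p.1)).
rewrite (partition_big h (fun P => [disjoint P.1 & P.2])) /=; last first.
  move=> [I J] _ /=; rewrite -setI_eq0; apply/eqP/setP => i; rewrite !inE.
  by case: (i \in I); case: (i \in J).
apply: eq_bigr => -[B1 B2] /= dB.
rewrite (reindex_onto (fun I : {set A} => (B1 :|: I, B1 :|: (B2 :\: I)))
                      (fun p => p.1 :\: p.2)) /=; last first.
  move=> [I J] /eqP[<- <-] /=; congr (_, _); apply/setP => i; rewrite !inE;
    by case: (i \in I); case: (i \in J).
have d i : ~~ ((i \in B1) && (i \in B2)).
  by move: dB; rewrite -setI_eq0 => /eqP/setP/(_ i); rewrite !inE => ->.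
apply: eq_bigl => I; apply/idP/idP => [/andP[/eqP[_ e2] /eqP e3]|IB].
  apply/subsetP => i iI; rewrite -e2 !inE; move/setP: e3 => /(_ i); move: (d i).
  by rewrite !inE iI; case: (i \in B1); case: (i \in B2).
have s i : i \in I -> i \in B2 by apply: (subsetP IB).
apply/andP; split; first (apply/eqP; congr (_, _)); last apply/eqP; apply/setP => i;
  move: (d i) (s i); rewrite !inE; case: (i \in B1); case: (i \in B2); case: (i \in I) => //= _ H;
  by move: (H isT).
Qed.

Lemma addn_split_eq (a b c d r p : nat) : (r + p = a + a + d)%N -> (a <= r)%N ->
  (b + c = d)%N -> ((a + b == r) && (a + c == p))%N = (b == r - a)%N.
Proof. lia. Qed.

Section CutPair.

Variables (F : fieldType) (k : nat) (q T : F) (x : 'I_k -> F).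
Hypotheses (q0 : q != 0).

Let m u v := (T * u - v) / (u - v).

Definition cut_pair (I J : {set 'I_k}) : F :=
  cut (fun i j => m (x i) (x j)) setT I *
  cut (fun i j => m (scale_on I q x i) (scale_on I q x j)) setT J.

(** The factors of [cut_pair I J] that depend only on the intersection [P.1] and the symmetric
    difference [P.2]. *)
Definition cut_pair_out (P : {set 'I_k} * {set 'I_k}) : F :=
  \prod_i \prod_j
   (if i \in P.1 then
      if j \in P.2 then m (x i) (x j)
      else if j \in P.1 then 1 else m (x i) (x j) * m (q * x i) (x j)
    else if (i \in P.2) && ~~ ((j \in P.1) || (j \in P.2)) then m (x i) (x j) else 1).

Let mq u v : m (q * u) (q * v) = m u v.
Proof. by rewrite /m mulrCA -!mulrBr -mulf_div divff // mul1r. Qed.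

Let cutE (a : 'I_k -> 'I_k -> F) B I :
  cut a B I = \prod_i \prod_j (if (i \in I) && ((j \in B) && (j \notin I)) then a i j else 1).
Proof.
rewrite /cut big_mkcond; apply: eq_bigr => i _; case: ifP => iI /=.
  by rewrite big_mkcond; apply: eq_bigr => j _; rewrite inE andbC.
by rewrite big1.
Qed.

(** Since m(q u, q v) = m(u, v), only the pairs inside B2 separated by I see how B2 is split, and
    each of them yields one [pair_coef]. *)
Lemma cut_pairE (B1 B2 I : {set 'I_k}) : [disjoint B1 & B2] -> I \subset B2 ->
  cut_pair (B1 :|: I) (B1 :|: (B2 :\: I)) =
  cut_pair_out (B1, B2) * cut (fun i j => pair_coef q T (x i) (x j)) B2 I.
Proof.
move=> dB IB; rewrite /cut_pair !cutE.
have -> : \prod_i \prod_j (if (i \in I) && ((j \in B2) && (j \notin I)) then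
     pair_coef q T (x i) (x j) else 1) =
  (\prod_i \prod_j (if (i \in I) && ((j \in B2) && (j \notin I)) then m (x i) (x j) else 1)) *
  (\prod_i \prod_j (if (j \in I) && ((i \in B2) && (i \notin I)) then m (x i) (q * x j) else 1)).
  rewrite [X in _ = _ * X]exchange_big -big_split /=; apply: eq_bigr => i _.
  rewrite -big_split /=; apply: eq_bigr => j _; case: ifP => _; last by rewrite mulr1.
  by rewrite /m mulf_div.
rewrite /cut_pair_out -!big_split; apply: eq_bigr => i _ /=.
rewrite -!big_split; apply: eq_bigr => j _ /=.
have d l : ~~ ((l \in B1) && (l \in B2)).
  by move: dB; rewrite -setI_eq0 => /eqP/setP/(_ l); rewrite !inE => ->.
have s l : l \in I -> l \in B2 by apply: (subsetP IB).
rewrite !inE /scale_on !inE; move: (d i) (d j) (s i) (s j).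
case: (i \in B1); case: (i \in B2); case: (i \in I) => //= _;
case: (j \in B1); case: (j \in B2); case: (j \in I) => //= _ h1 h2;
rewrite ?mq ?mul1r ?mulr1 //; by [move: (h1 isT) | move: (h2 isT)].
Qed.

Hypotheses (xI : injective x) (x0 : forall i, x i != 0).
Hypothesis qx : forall i j, q * x i != x j.
Hypothesis qqx : forall i j, q * (q * x i) != x j.

Lemma cut_sumC (a : 'I_k -> 'I_k -> F) B (p : nat) :
  cut_sum (fun i j => a j i) B p =
  \sum_(I : {set 'I_k} | I \subset B) cut a B I *+ (#|B :\: I| == p).
Proof.
rewrite /cut_sum (reindex_onto (fun I => B :\: I) (fun I => B :\: I)) /=; last first.
  by move=> I IB; rewrite setDDr setDv set0U (setIidPr IB).
apply: eq_big => [I|I /andP[_ /eqP E]].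
  rewrite subsetDl /=; apply/eqP/idP => [<-|IB]; first exact: subsetDl.
  by rewrite setDDr setDv set0U (setIidPr IB).
by congr (_ *+ _); rewrite /cut E exchange_big.
Qed.

(** Exchanging r and p amounts to replacing I by its complement in B2, which transposes [pair_coef];
    this is the symmetry given by [cut_sum_sym]. *)
Lemma cut_pair_sum_sym (B1 B2 : {set 'I_k}) (r p : nat) : [disjoint B1 & B2] ->
  \sum_(I : {set 'I_k} | I \subset B2) cut_pair (B1 :|: I) (B1 :|: (B2 :\: I))
    *+ ((#|B1 :|: I| == r) && (#|B1 :|: (B2 :\: I)| == p)) =
  \sum_(I : {set 'I_k} | I \subset B2) cut_pair (B1 :|: I) (B1 :|: (B2 :\: I))
    *+ ((#|B1 :|: I| == p) && (#|B1 :|: (B2 :\: I)| == r)).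
Proof.
move=> dB.
have cU (I : {set 'I_k}) : I \subset B2 -> #|B1 :|: I| = (#|B1| + #|I|)%N.
  move=> IB; rewrite cardsU (_ : B1 :&: I = set0) ?cards0 ?subn0 //.
  by apply/eqP; rewrite setI_eq0; apply: disjointWr dB.
have cD (I : {set 'I_k}) : I \subset B2 -> (#|I| + #|B2 :\: I| = #|B2|)%N.
  by move=> IB; rewrite -(cardsID I B2) (setIidPr IB).
have [rp|rp] := boolP ((r + p == #|B1| + #|B1| + #|B2|) && (#|B1| <= r))%N; last first.
  rewrite !big1 // => I IB; rewrite !cU ?subsetDl // (_ : _ && _ = false) //;
  by have := cD I IB; move: rp; lia.
case/andP: rp => /eqP rp r1.
transitivity (cut_pair_out (B1, B2) *
  cut_sum (fun i j => pair_coef q T (x i) (x j)) B2 (r - #|B1|)%N).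
  rewrite mulr_sumr; apply: eq_bigr => I IB.
  rewrite cut_pairE // !cU ?subsetDl // mulrnAr; congr (_ *+ nat_of_bool _).
  exact: addn_split_eq rp r1 (cD I IB).
rewrite cut_sum_sym // cut_sumC mulr_sumr; apply: eq_bigr => I IB.
rewrite cut_pairE // !cU ?subsetDl // mulrnAr; congr (_ *+ nat_of_bool _).
by rewrite andbC (addn_split_eq rp r1) // addnC cD.
Qed.

End CutPair.

Section MacCommute.

Variables (K : fieldType) (k : nat) (q t : K).
Hypotheses (q0 : q != 0).
Hypothesis qn : forall n : nat, q ^+ n.+1 != 1.

Notation L := (ratfun K k).
Notation C := (@rfconst K k).
Notation x := (@rfvar K k).
Notation sg := (shift q0).
Notation mac := (mac_op (k := k) t q0).

Let c_ r : L := (-1) ^+ r * C (q / t) ^+ (r * r.-1)./2.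

Let m (u v : L) := (C (q / t) * u - v) / (u - v).

Let mac_coefE I : mac_coef q t I = c_ #|I| * cut (fun i j => m (x i) (x j)) setT I.
Proof.
by rewrite /mac_coef vdm_scale_cut ?mulrA //; apply: rfvar_inj.
Qed.

Let shift_cut I J : sg (mesym1 I) (cut (fun i j => m (x i) (x j)) setT J) =
  cut (fun i j => m (scale_on I (C q) x i) (scale_on I (C q) x j)) setT J.
Proof.
have sx i : sg (mesym1 I) (x i) = scale_on I (C q) x i.
  rewrite shift_var mesym1E /scale_on; case: ifP => _; rewrite ?expr1 //.
  by rewrite expr0 rmorph1 mul1r.
rewrite rmorph_prod; apply: eq_bigr => i _; rewrite rmorph_prod; apply: eq_bigr => j _.
by rewrite /m fmorph_div !rmorphB rmorphM /= shift_const !sx.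
Qed.

Let qx1 (n : nat) i j : C (q ^+ n.+1) * x i != x j.
Proof.
apply/eqP => /rfvar_scale_eq[_ /eqP]; by rewrite (negPf (qn n)).
Qed.

(** The two composites have the same scalar prefactor, and their coefficients are compared for each
    fixed intersection and symmetric difference of the two index sets. *)
Lemma mac_opC r p f : mac r (mac p f) = mac p (mac r f).
Proof.
pose S r p := \sum_I \sum_J (cut_pair (C q) (C (q / t)) x I J * sg (mesym1 I + mesym1 J)%MM f)
    *+ ((#|I| == r) && (#|J| == p)).
have macE r' p' : mac r' (mac p' f) = c_ r' * c_ p' * S r' p'.
  rewrite /mac_op /S mulr_sumr big_mkcond; apply: eq_bigr => I _ /=.
  case: eqP => [Ir|_]; last by rewrite big1 ?mulr0.
  rewrite rmorph_sum !mulr_sumr big_mkcond; apply: eq_bigr => J _ /=.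
  case: eqP => [Jp|_]; last by rewrite mulr0.
  rewrite rmorphM /= shiftD !mac_coefE Ir Jp [sg _ (c_ _ * _)]rmorphM /= shift_cut.
  have -> : sg (mesym1 I) (c_ p') = c_ p'.
    by rewrite /c_ rmorphM !rmorphXn rmorphN rmorph1 /= shift_const.
  have alg (a b u v w : L) : a * u * (b * v * w) = a * b * (u * v * w).
    by rewrite !mulrA; congr (_ * _ * _); rewrite mulrAC.
  by rewrite mulr1n; apply: alg.
rewrite !macE [c_ p * _]mulrC; congr (_ * _).
rewrite /S !sum_set_pairs; apply: eq_bigr => -[B1 B2] /= dB.
have sgE (I : {set 'I_k}) : I \subset B2 ->
    (mesym1 (B1 :|: I) + mesym1 (B1 :|: (B2 :\: I)))%MM = (mesym1 B1 + mesym1 (B1 :|: B2))%MM.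
  move=> /subsetP IB; apply/mnmP => i; rewrite !mnmDE !mesym1E !inE.
  have := IB i; have : ~~ ((i \in B1) && (i \in B2)).
    by move: dB; rewrite -setI_eq0 => /eqP/setP/(_ i); rewrite !inE => ->.
  by case: (i \in B1); case: (i \in B2); case: (i \in I) => //= _ H; have := H isT.
transitivity ((\sum_(I : {set 'I_k} | I \subset B2)
   cut_pair (C q) (C (q / t)) x (B1 :|: I) (B1 :|: (B2 :\: I))
    *+ ((#|B1 :|: I| == r) && (#|B1 :|: (B2 :\: I)| == p)))
    * sg (mesym1 B1 + mesym1 (B1 :|: B2))%MM f).
  by rewrite mulr_suml; apply: eq_bigr => I IB; rewrite sgE // mulrnAl.
rewrite cut_pair_sum_sym //.
- by rewrite mulr_suml; apply: eq_bigr => I IB; rewrite sgE // mulrnAl.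
- by rewrite fmorph_eq0.
- exact: rfvar_inj.
- exact: rfvar_neq0.
- by move=> i j; have := qx1 0 i j; rewrite expr1.
- by move=> i j; have := qx1 1 i j; rewrite expr2 rmorphM mulrA.
Qed.

End MacCommute.

(** * Commutation and eigenvectors of the operators D_d *)

Section DopCommute.

Variables (K : fieldType) (k : nat) (q t : K).
Hypothesis charK : [pchar K] =i pred0.
Hypotheses (q0 : q != 0) (t0 : t != 0).
Hypothesis qn : forall n : nat, q ^+ n.+1 != 1.
Hypothesis tq : forall n : int, t * q ^ n != 1.

Notation L := (ratfun K k).
Notation C := (@rfconst K k).
Notation x := (@rfvar K k).
Notation sg := (shift q0).
Notation mac := (mac_op (k := k) t q0).
Notation D := (@Dop K k q t).

Let be m r : K := (t / q) ^+ (k * r) * ((q / t) ^+ r - q ^+ m).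

Let sg0 (f : L) : sg 0%MM f = f.
Proof.
apply: (ratfun_ext (f := sg 0%MM) (g := idfun)) => [c|i] /=; first exact: shift_const.
by rewrite shift_var mnm0E expr0 rmorph1 mul1r.
Qed.

Let mac0 (f : L) : mac 0 f = f.
Proof.
rewrite /mac_op (big_pred1 set0) => [|I]; last by rewrite cards_eq0.
rewrite /mac_coef cards0 expr0 mul1r mesym1_set0 sg0.
have -> : vdm (scale_on set0 (C (q / t)) x) = vdm x.
  by apply: eq_bigr => i _; apply: eq_bigr => j _; rewrite /scale_on !inE.
by rewrite divff ?mul1r // vdm_neq0 //; apply: rfvar_inj.
Qed.

Let D0 (f : L) : D 0 f = f.
Proof.
rewrite (DopE _ q0) (perm_big [:: 0%MM]) /=; last first.
  apply: uniq_perm; rewrite ?mnm_seq_uniq // => a.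
  by rewrite mem_mnm_seq inE mdeg_eq0.
rewrite big_seq1 sg0 DcoefE // big1 ?mul1r // => i _.
by rewrite big1 // => j _; rewrite mnm0E big_geq.
Qed.

(** The term r = 0 of the Wronski relation is (1 - q^m) D_m, and 1 - q^m is invertible for m > 0. *)
Let Drec m (f : L) : (0 < m)%N ->
  D m f = C (- (1 - q ^+ m)^-1) * \sum_(r < m) C (be m r.+1) * mac r.+1 (D (m - r.+1) f).
Proof.
move=> m0; have := wronski charK q0 t0 qn tq m f; rewrite big_ord_recl /=.
rewrite muln0 !expr0 mul1r subn0 mac0 => /eqP; rewrite addr_eq0 => /eqP h.
have q1 : 1 - q ^+ m != 0 by rewrite subr_eq0 eq_sym -(prednK m0).
by rewrite rmorphN mulNr -mulrN -h mulrA -rmorphM mulVf // rmorph1 mul1r.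
Qed.

Lemma mac_Dop_comm r m (f : L) : mac r (D m f) = D m (mac r f).
Proof.
have [n] := ubnP m; elim: n m f => // n IHn m f; rewrite ltnS => mn.
have [->|m0] := posnP m; first by rewrite !D0.
rewrite !(Drec _ m0) mac_opZ mac_op_sum; congr (_ * _); apply: eq_bigr => j _.
rewrite mac_opZ mac_opC // IHn //.
by rewrite (leq_trans _ mn) // ltn_subrL.
Qed.

Lemma Dop_comm d e (f : L) : D d (D e f) = D e (D d f).
Proof.
have [n] := ubnP d; elim: n d f => // n IHn d f; rewrite ltnS => dn.
have [->|d0] := posnP d; first by rewrite !D0.
rewrite !(Drec _ d0) (DopZ _ q0) (Dop_sum _ q0); congr (_ * _); apply: eq_bigr => j _.
by rewrite (DopZ _ q0) -mac_Dop_comm IHn // (leq_trans _ dn) // ltn_subrL.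
Qed.

(** On a common eigenvector of the M_r the recursion becomes scalar, and its solution with initial
    value 1 is unique. *)
Lemma Dop_eigen (f : L) (n g : nat -> K) :
  (forall r, mac r f = C (n r) * f) -> g 0%N = 1 -> n 0%N = 1 ->
  (forall m, (0 < m)%N -> \sum_(r < m.+1) be m r * n r * g (m - r)%N = 0) ->
  forall m, D m f = C (g m) * f.
Proof.
move=> fn g0 n0 gn m; have [N] := ubnP m; elim: N m => // N IHN m; rewrite ltnS => mN.
have [->|m0] := posnP m; first by rewrite D0 g0 rmorph1 mul1r.
rewrite Drec //.
under eq_bigr => r _ do rewrite IHN ?mac_opZ ?fn
   ?(leq_trans _ mN) ?ltn_subrL // [C (g _) * _]mulrCA !mulrA -!rmorphM.
rewrite -mulr_suml -rmorph_sum /= mulrA -rmorphM; congr (C _ * _).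
have := gn m m0; rewrite big_ord_recl /= subn0 n0 mulr1 /be muln0 !expr0 mul1r.
have q1 : 1 - q ^+ m != 0 by rewrite subr_eq0 eq_sym -(prednK m0).
move/eqP; rewrite addrC addr_eq0 => /eqP ->.
by rewrite mulrNN mulKf.
Qed.

End DopCommute.

(** * Logarithmic derivatives of power series *)

Section LogDerivative.

Variable F : fieldType.
Implicit Types (a b p r : {poly F}) (f g : nat -> F).

(* Power series are represented by polynomials up to terms of degree n. *)
Definition eq_upto n p r := forall i, (i < n)%N -> p`_i = r`_i.

Lemma eq_uptoM n p p' r r' :
  eq_upto n p p' -> eq_upto n r r' -> eq_upto n (p * r) (p' * r').
Proof.
move=> hp hr i ni; rewrite !coefM; apply: eq_bigr => j _.
by rewrite hp ?hr // (leq_ltn_trans _ ni) ?leq_subr // -ltnS.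
Qed.

Lemma eq_upto_trans n p q r : eq_upto n p q -> eq_upto n q r -> eq_upto n p r.
Proof. by move=> h1 h2 i ni; rewrite h1 ?h2. Qed.

Lemma eq_upto_sum n (J : Type) (s : seq J) (P : pred J) (u v : J -> {poly F}) :
  (forall j, P j -> eq_upto n (u j) (v j)) ->
  eq_upto n (\sum_(j <- s | P j) u j) (\sum_(j <- s | P j) v j).
Proof. by move=> h i ni; rewrite !coef_sum; apply: eq_bigr => j /h ->. Qed.

Lemma eq_upto_cancel n p r (e : {poly F}) : e`_0 != 0 -> eq_upto n (p * e) (r * e) -> eq_upto n p r.
Proof.
move=> e0 h i; elim/ltn_ind: i => i IHi ni; have := h i ni.
rewrite !coefM !big_ord_recr /= subnn => /eqP.
rewrite -subr_eq0 opprD addrACA -sumrB big1 ?add0r => [|j _]; last first.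
  by rewrite IHi ?subrr // (ltn_trans _ ni).
by rewrite -mulrBl mulf_eq0 (negPf e0) orbF subr_eq0 => /eqP.
Qed.

Definition series n f : {poly F} := \poly_(m < n) (f m *+ (m != 0)%N).

(* The power series with sum_(r >= 1) f r X^r = X a' / a. *)
Definition logder n a f := eq_upto n ('X * a^`()) (a * series n f).

Lemma coefXderiv a i : ('X * a^`())`_i = a`_i *+ i.
Proof. by rewrite coefXM coef_deriv; case: i. Qed.

Lemma coef_mul_series n a f i : (i < n)%N ->
  (a * series n f)`_i = \sum_(j < i) a`_j * f (i - j)%N.
Proof.
move=> ni; rewrite coefM big_ord_recr /= subnn coef_poly mulr0n if_same mulr0 addr0.
apply: eq_bigr => j _; rewrite coef_poly (leq_ltn_trans _ ni) ?leq_subr //.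
by rewrite -lt0n subn_gt0 ltn_ord.
Qed.

Lemma logderP n a f :
  (forall i, (i < n)%N -> a`_i *+ i = \sum_(j < i) a`_j * f (i - j)%N) <-> logder n a f.
Proof.
by split=> h i ni; have := h i ni; rewrite ?coefXderiv coef_mul_series.
Qed.

Lemma logder_ext n a f g : logder n a f -> f =1 g -> logder n a g.
Proof.
move=> /logderP h fg; apply/logderP => i ni; rewrite h //.
by apply: eq_bigr => j _; rewrite fg.
Qed.

Lemma logderM n a b f g : logder n a f -> logder n b g ->
  logder n (a * b) (fun m => f m + g m).
Proof.
move=> ha hb; rewrite /logder derivM.
have -> : series n (fun m => f m + g m) = series n f + series n g.
  apply/polyP => i; rewrite coefD !coef_poly; case: ifP; rewrite ?addr0 //.
  by rewrite mulrnDl.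
have -> : 'X * (a^`() * b + a * b^`()) = ('X * a^`()) * b + a * ('X * b^`()) by ring.
have -> : a * b * (series n f + series n g) = (a * series n f) * b + a * (b * series n g) by ring.
by move=> i ni; rewrite !coefD; congr (_ + _); apply: eq_uptoM ni.
Qed.

Lemma logder1 n : logder n 1 (fun=> 0).
Proof.
move=> i ni; rewrite derivC mulr0 coef0 coef_mul_series //.
by rewrite big1 // => j _; rewrite mulr0.
Qed.

Lemma logder_lin n c : logder n (1 - c *: 'X) (fun m => - c ^+ m).
Proof.
apply/logderP => i ni; rewrite coefB coef1 coefZ coefX.
case: i ni => [|[|i]] ni; first by rewrite mulr0n big_ord0.
  by rewrite big_ord1 coefB coef1 coefZ coefX /= mulr0 subr0 mul1r expr1 mulr1 sub0r mulr1n.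
rewrite /= mulr0 subr0 mul0rn big_ord_recl big_ord_recl big1 => [|j _].
  rewrite !coefB !coef1 !coefZ !coefX /= mulr0 subr0 mul1r mulr1 sub0r addr0.
  by rewrite mulNr mulrN opprK subn0 subSS subn0 [c ^+ i.+2]exprS addNr.
by rewrite coefB coef1 coefZ coefX /= mulr0 subr0 mul0r.
Qed.

Lemma logder_prod n (J : finType) (P : pred J) (c : J -> F) :
  logder n (\prod_(j | P j) (1 - c j *: 'X)) (fun m => - \sum_(j | P j) c j ^+ m).
Proof.
elim: (index_enum J) => [|j s IHs].
  rewrite big_nil; apply: (logder_ext (@logder1 n)) => r;
  by rewrite big_nil oppr0.
rewrite big_cons; case: ifP => Pj.
  apply: (logder_ext (logderM (@logder_lin n (c j)) IHs)) => r.
  by rewrite big_cons Pj opprD.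
by apply: (logder_ext IHs) => r; rewrite big_cons Pj.
Qed.

Hypothesis charF : [pchar F] =i pred0.

(** In characteristic 0 the equation for i a_i determines a_i from the lower coefficients. *)
Lemma logder_uniq n a b f : logder n a f -> logder n b f -> a`_0 = b`_0 -> eq_upto n a b.
Proof.
move=> /logderP ha /logderP hb ab0 i; elim/ltn_ind: i => i IHi ni.
have [->//|i0] := posnP i.
have : a`_i *+ i = b`_i *+ i.
  rewrite ha // hb //; apply: eq_bigr => j _.
  by rewrite IHi // (ltn_trans _ ni).
rewrite -[LHS]mulr_natr -[RHS]mulr_natr; apply: mulIf.
by have /pcharf0P -> := charF; rewrite -lt0n.
Qed.

(** Adding the sums of (T c_j)^m - c_j^m to the logarithmic derivative multiplies a series by the (1
    - c_j X)/(1 - T c_j X); the denominators are moved to the other side. *)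
Lemma logder_shift n a b f (J : finType) (P : pred J) (T : F) (c : J -> F) :
  logder n a f ->
  logder n b (fun m => f m + \sum_(j | P j) ((T * c j) ^+ m - c j ^+ m)) ->
  a`_0 = b`_0 ->
  eq_upto n (b * \prod_(j | P j) (1 - (T * c j) *: 'X)) (a * \prod_(j | P j) (1 - c j *: 'X)).
Proof.
move=> ha hb ab0.
have hb' := logderM hb (@logder_prod n J P (fun j => T * c j)).
apply: (logder_uniq hb'); last first.
  rewrite -!horner_coef0 !hornerM !horner_prod !horner_coef0 ab0; congr (_ * _).
  by apply: eq_bigr => j _; rewrite !horner_1BZX !mulr0.
apply: (logder_ext (logderM ha (@logder_prod n J P c))) => r /=.
by rewrite sumrB -[RHS]addrA; congr (_ + _); rewrite addrAC subrr add0r.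
Qed.

End LogDerivative.

(** * Sums over partitions and the reproducing kernel *)

Lemma intpartP (la : intpart) : sorted geq la /\ 0%N \notin (la : seq nat).
Proof. by case: la => s /= /andP[]. Qed.

Lemma intpart_inj (la mu : intpart) : la = mu :> seq nat -> la = mu.
Proof. exact: val_inj. Qed.

Lemma intpart_perm (la mu : intpart) : perm_eq la mu -> la = mu.
Proof.
move=> h; apply: intpart_inj.
have [h1 _] := intpartP la; have [h2 _] := intpartP mu.
apply: (sorted_eq _ _ h1 h2 h) => [a b c /= ba cb|a b /= /andP[ba ab]].
  exact: leq_trans cb ba.
by apply/eqP; rewrite eqn_leq ab ba.
Qed.

Lemma leq_mem_sumn (s : seq nat) r : r \in s -> (r <= sumn s)%N.
Proof.
elim: s => //= e s IHs; rewrite inE => /orP[/eqP ->|/IHs h]; first exact: leq_addr.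
exact: leq_trans h (leq_addl _ _).
Qed.

Lemma size_intpart (la : intpart) : (size la <= sumn la)%N.
Proof.
have [_] := intpartP la; elim: (la : seq nat) => //= e s IHs.
rewrite inE negb_or eq_sym -lt0n => /andP[e0 /IHs h].
by rewrite -add1n leq_add.
Qed.

(** A partition of N has at most N parts, each at most N, so it is the list of positive entries of
    some N-tuple; [undup] removes the repetitions due to the positions of the zeros. *)
Definition partn (N : nat) : seq intpart :=
  undup [seq la : intpart <- pmap insub
    [seq [seq e <- map val (tval m) | (0 < e)%N] |
       m : N.-tuple 'I_N.+1 <- enum {: N.-tuple 'I_N.+1}]
    | sumn la == N].

Lemma partn_uniq N : uniq (partn N).
Proof. exact: undup_uniq. Qed.

Lemma mem_partn N (la : intpart) : (la \in partn N) = (sumn la == N).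
Proof.
rewrite mem_undup mem_filter andb_idr // => /eqP laN.
rewrite mem_pmap; apply/mapP; exists (la : seq nat); last by rewrite valK.
pose s := la ++ nseq (N - size la) 0%N.
have sN : size s == N by rewrite size_cat size_nseq subnKC // -laN size_intpart.
have leN e : e \in s -> (e < N.+1)%N.
  rewrite mem_cat mem_nseq => /orP[/leq_mem_sumn|/andP[_ /eqP -> //]].
  by rewrite laN ltnS.
have sN' : size (map (@inord N) s) == N by rewrite size_map.
apply/mapP; exists (Tuple sN'); first by rewrite mem_enum.
rewrite /= -map_comp (_ : [seq _ | _ <- s] = s).
  rewrite filter_cat (_ : [seq e <- nseq _ _ | _] = [::]) ?cats0; last first.
    by elim: (N - size la)%N.
  apply/esym/all_filterP/allP => e ela; rewrite lt0n; apply/eqP => e0.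
  by have [_] := intpartP la; rewrite -e0 ela.
rewrite -[RHS]map_id; apply/eq_in_map => e es /=.
by rewrite inordK // leN.
Qed.

(** The classical z_la, the order of the centralizer of a permutation of cycle type [la]. *)
Definition part_fact (la : intpart) : nat :=
  \prod_(1 <= r < (sumn la).+1) (r ^ count_mem r la * (count_mem r la)`!).

Lemma part_factE M (la : intpart) : (sumn la <= M)%N ->
  part_fact la = (\prod_(1 <= r < M.+1) (r ^ count_mem r la * (count_mem r la)`!))%N.
Proof.
move=> laM; rewrite /part_fact [in RHS](@big_cat_nat _ _ _ (sumn la).+1) //=.
rewrite [X in (_ * X)%N](_ : _ = 1%N) ?muln1 //.
rewrite big_nat big1 // => r /andP[lr _].
rewrite (_ : count_mem r la = 0%N) //; apply/count_memPn/negP => /leq_mem_sumn.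
by rewrite leqNgt lr.
Qed.

Lemma sumn_count M (s : seq nat) : (forall r, r \in s -> r <= M)%N ->
  sumn s = (\sum_(1 <= r < M.+1) r * count_mem r s)%N.
Proof.
elim: s => [|e s IHs] h /=; first by rewrite big1 // => r _; rewrite muln0.
under eq_bigr => r _ do rewrite mulnDr.
rewrite big_split /= -IHs; last by move=> r rs; rewrite h // inE rs orbT.
congr (_ + _)%N; have eM : (e < M.+1)%N by rewrite ltnS h // inE eqxx.
case: e {h} eM => [|e] eM.
  by rewrite big_nat big1 // => r /andP[r1 _];
    rewrite (_ : (0 == r)%N = false) ?muln0 //; case: r r1.
rewrite (bigD1_seq e.+1) ?iota_uniq ?mem_index_iota //=.
rewrite eqxx muln1 big1 ?addn0 // => r re.
by rewrite eq_sym (negPf re) muln0.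
Qed.

Lemma rem_part_subproof r (la : intpart) : is_intpart (rem r la).
Proof.
have [h1 h2] := intpartP la; rewrite /is_intpart.
rewrite (subseq_sorted _ (rem_subseq r la) h1) /=; last first.
  by move=> a b c /= ba cb; apply: leq_trans cb ba.
by apply: contra h2; apply: mem_rem.
Qed.

Definition rem_part r la := IntPart (rem_part_subproof r la).

Lemma part_fact_rem r (la : intpart) : (0 < r)%N -> r \in (la : seq nat) ->
  part_fact la = (r * count_mem r la * part_fact (rem_part r la))%N.
Proof.
move=> r0 rla; have := perm_to_rem rla => P.
have sE : sumn la = (r + sumn (rem r la))%N by rewrite (perm_sumn P).
rewrite (@part_factE (sumn la) (rem_part r la)) /=; last by rewrite sE leq_addl.
have rM : r \in index_iota 1 (sumn la).+1 by rewrite mem_index_iota r0 ltnS leq_mem_sumn.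
have cE s' : count_mem s' la = ((r == s') + count_mem s' (rem r la))%N.
  by have /seq.permP -> := P.
rewrite /part_fact (bigD1_seq r) ?iota_uniq //= [in RHS](bigD1_seq r) ?iota_uniq //= mulnA.
congr (_ * _)%N.
  by rewrite !cE eqxx add1n factS expnS mulnACA.
by apply: eq_bigr => s' s'r; rewrite cE eq_sym (negPf s'r).
Qed.

Lemma perm_rem_part N r : (0 < r <= N)%N ->
  perm_eq [seq rem_part r la | la : intpart <- partn N & r \in (la : seq nat)] (partn (N - r)).
Proof.
move=> /andP[r0 rN]; apply: uniq_perm; rewrite ?partn_uniq //.
  rewrite map_inj_in_uniq ?filter_uniq ?partn_uniq // => la mu.
  rewrite !mem_filter => /andP[rla _] /andP[rmu _] /(congr1 parts) /= e.
  apply: intpart_perm; rewrite (perm_trans (perm_to_rem rla)) // e perm_sym.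
  exact: perm_to_rem.
move=> nu; rewrite mem_partn; apply/mapP/eqP => [[la]|nuN].
  rewrite mem_filter mem_partn => /andP[rla /eqP <-] -> /=.
  by rewrite (perm_sumn (perm_to_rem rla)) /= addKn.
have [h1 h2] := intpartP nu.
have sP : is_intpart (sort geq (r :: nu)).
  rewrite /is_intpart sort_sorted /=; last by move=> a b; apply: leq_total.
  by rewrite mem_sort inE negb_or h2 andbT eq_sym -lt0n.
have P : perm_eq (sort geq (r :: nu)) (r :: nu) by rewrite perm_sort.
exists (IntPart sP).
  by rewrite mem_filter mem_partn /= (perm_mem P) inE eqxx (perm_sumn P) /= nuN subnKC.
apply: intpart_perm; rewrite /= -(perm_cons r) -(permPr (perm_to_rem _)).
  by rewrite perm_sym perm_sort.
by rewrite mem_sort inE eqxx.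
Qed.

(* The coefficients of exp (sum_r f r X^r / r) in terms of power sums. *)
Definition exp_coef (F : fieldType) (f : nat -> F) N : F :=
  \sum_(la <- partn N) (part_fact la)%:R^-1 * \prod_(r <- la) f r.

(** Coefficient form of X E' = E sum_r f r X^r. Writing N as the sum of the r m_r distributes each
    partition over its distinct parts, and deleting one part r turns r m_r / z_la into 1 / z of the
    smaller partition. *)
Lemma exp_coef_rec (F : fieldType) (f : nat -> F) N : [pchar F] =i pred0 ->
  exp_coef f N *+ N = \sum_(j < N) exp_coef f j * f (N - j)%N.
Proof.
move=> /pcharf0P charF.
have -> : \sum_(j < N) exp_coef f j * f (N - j)%N =
    \sum_(1 <= r < N.+1) f r * exp_coef f (N - r)%N.
  rewrite -(big_mkord xpredT (fun j => exp_coef f j * f (N - j)%N)) big_nat_rev /= big_add1 /=.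
  by apply: eq_big_nat => i /andP[_ iN]; rewrite add0n subKn // mulrC.
transitivity (\sum_(la <- partn N) \sum_(1 <= r < N.+1)
    (part_fact la)%:R^-1 * (\prod_(e <- la) f e) *+ (r * count_mem r la)).
  rewrite -sumrMnl big_seq [RHS]big_seq; apply: eq_bigr => la; rewrite mem_partn => /eqP laN.
  by rewrite sumrMnr -sumn_count ?laN // => r; rewrite -laN; apply: leq_mem_sumn.
rewrite exchange_big /=; apply: eq_big_nat => r /andP[r0 rN].
rewrite (bigID (fun la : intpart => r \in (la : seq nat))) /= [X in _ + X]big1 ?addr0; last first.
  by move=> la /count_memPn ->; rewrite muln0 mulr0n.
rewrite /exp_coef -(perm_big _ (perm_rem_part (N := N) (r := r) _)) /=; last by rewrite r0.
rewrite big_map big_filter mulr_sumr; apply: eq_bigr => la rla.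
rewrite (part_fact_rem r0 rla) natrM invfM (perm_big _ (perm_to_rem rla)) big_cons /=.
rewrite -[LHS]mulr_natr.
have c0 : (r * count_mem r la)%:R != 0 :> F.
  by rewrite charF muln_eq0 negb_or -lt0n r0 -lt0n -has_count has_pred1.
move: (r * count_mem r la)%:R c0 => c c0.
move: ((part_fact _)%:R^-1) (f r) (\prod_(j <- _) f j) => a b d.
by rewrite mulrAC mulrAC mulrACA; field.
Qed.

Lemma exp_coef0 (F : fieldType) (f : nat -> F) : exp_coef f 0 = 1.
Proof.
rewrite /exp_coef (perm_big [:: row_part 0]) /=; last first.
  apply: uniq_perm; rewrite ?partn_uniq // => la.
  rewrite mem_partn inE; apply/eqP/eqP => [la0|-> //].
  apply: intpart_inj; have := size_intpart la; rewrite la0 leqn0 /=.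
  by case: (la : seq nat).
by rewrite big_seq1 big_nil /part_fact /= big_geq // invr1 mulr1.
Qed.

Lemma exp_coefZ (F : fieldType) (f : nat -> F) c N :
  exp_coef (fun r => c ^+ r * f r) N = c ^+ N * exp_coef f N.
Proof.
rewrite /exp_coef mulr_sumr big_seq [RHS]big_seq; apply: eq_bigr => la.
rewrite mem_partn => /eqP <-; rewrite big_split /= mulrCA; congr (_ * (_ * _)).
elim: (la : seq nat) => [|e s IHs]; first by rewrite big_nil.
by rewrite big_cons IHs -exprD.
Qed.

Lemma eq_exp_coef (F : fieldType) (f g : nat -> F) N : f =1 g -> exp_coef f N = exp_coef g N.
Proof. by move=> fg; apply: eq_bigr => la _; congr (_ * _); apply: eq_bigr. Qed.

Definition psum (F : fieldType) k (x : 'I_k -> F) r := \sum_i x i ^+ r.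

(* The degree N part of the reproducing kernel of parameters (q, T). *)
Definition kernel (F : fieldType) (q T : F) k l (x : 'I_k -> F) (y : 'I_l -> F) :=
  exp_coef (fun r => (1 - T ^+ r) / (1 - q ^+ r) * psum x r * psum y r).

Lemma kernelC (F : fieldType) (q T : F) k l (x : 'I_k -> F) (y : 'I_l -> F) N :
  kernel q T x y N = kernel q T y x N.
Proof. by apply: eq_exp_coef => r; rewrite mulrAC. Qed.

Section Kernel.

Variables (F : fieldType) (q T : F).
Hypothesis charF : [pchar F] =i pred0.
Hypothesis qn : forall n : nat, q ^+ n.+1 != 1.

Let kpoly k l (x : 'I_k -> F) (y : 'I_l -> F) n : {poly F} :=
  \poly_(N < n) kernel q T x y N.

Let kpoly_logder k l (x : 'I_k -> F) (y : 'I_l -> F) n :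
  logder n (kpoly x y n) (fun r => (1 - T ^+ r) / (1 - q ^+ r) * psum x r * psum y r).
Proof.
apply/logderP => i ni; rewrite coef_poly ni exp_coef_rec //.
by apply: eq_bigr => j _; rewrite coef_poly (ltn_trans _ ni).
Qed.

Let kpoly0 k l (x : 'I_k -> F) (y : 'I_l -> F) n : (kpoly x y n)`_0 = (0 < n)%:R.
Proof. by rewrite coef_poly; case: n => // n; rewrite /kernel exp_coef0. Qed.

(** Scaling x_i by q changes the power sum p_r(x) by (q^r - 1) x_i^r, which cancels the denominator
    1 - q^r of the kernel. The logarithmic derivative changes by (T^r - 1) x_i^r p_r(y), that of a
    finite product. *)
Lemma kernel_shift k l (x : 'I_k -> F) (y : 'I_l -> F) (I : {set 'I_k}) n :
  eq_upto n
   (\poly_(N < n) kernel q T (scale_on I q x) y N *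
     \prod_(i in I) \prod_j (1 - (T * x i * y j) *: 'X))
   (\poly_(N < n) kernel q T x y N * \prod_(i in I) \prod_j (1 - (x i * y j) *: 'X)).
Proof.
pose c (p : 'I_k * 'I_l) := x p.1 * y p.2.
have -> : \prod_(i in I) \prod_j (1 - (x i * y j) *: 'X) =
    \prod_(p | p.1 \in I) (1 - c p *: 'X).
  by rewrite pair_big_dep; apply: eq_bigl => p; rewrite andbT.
have -> : \prod_(i in I) \prod_j (1 - (T * x i * y j) *: 'X) =
    \prod_(p | p.1 \in I) (1 - (T * c p) *: 'X).
  rewrite pair_big_dep; apply: eq_big => p; first by rewrite andbT.
  by rewrite /c mulrA.
apply: (logder_shift charF (@kpoly_logder _ _ x y n)); last by rewrite !kpoly0.
apply: (logder_ext (@kpoly_logder _ _ (scale_on I q x) y n)) => r.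
have -> : psum (scale_on I q x) r = psum x r + (q ^+ r - 1) * \sum_(i in I) x i ^+ r.
  rewrite /psum mulr_sumr [X in _ = _ + X]big_mkcond -big_split /=; apply: eq_bigr => i _.
  by rewrite /scale_on; case: ifP => _; rewrite ?addr0 // exprMn; ring.
have -> : \sum_(p | p.1 \in I) ((T * c p) ^+ r - c p ^+ r) =
    (T ^+ r - 1) * (\sum_(i in I) x i ^+ r) * psum y r.
  rewrite (eq_bigr (fun p => (T ^+ r - 1) * (x p.1 ^+ r * y p.2 ^+ r))); last first.
    by move=> p _; rewrite /c !exprMn; ring.
  rewrite -mulr_sumr -mulrA; congr (_ * _); rewrite mulr_suml.
  under [RHS]eq_bigr => i _ do rewrite mulr_sumr.
  by rewrite pair_big_dep; apply: eq_bigl => p; rewrite andbT.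
case: r => [|r]; first by rewrite !expr0 !subrr !mul0r addr0.
have q1 : 1 - q ^+ r.+1 != 0 by rewrite subr_eq0 eq_sym.
move: (\sum_(i in I) _) (psum x _) (psum y _) (T ^+ _) (q ^+ _) q1 => a b e u v v1.
by field.
Qed.

Definition mac_kernel z k l (x : 'I_k -> F) (y : 'I_l -> F) N :=
  \sum_(I : {set 'I_k}) (- z) ^+ #|I| * (vdm (scale_on I T x) / vdm x) *
    kernel q T (scale_on I q x) y N.

(** Multiplication by the product of all 1 - T x_i y_j X turns the generating series into
    [kernel_poly] times the kernel, both symmetric in x and y. That product has constant term 1 and
    can be cancelled. *)
Lemma mac_kernelC z k (x y : 'I_k -> F) N :
  injective x -> injective y -> (forall i, x i != 0) -> (forall i, y i != 0) ->
  mac_kernel z x y N = mac_kernel z y x N.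
Proof.
move=> xI yI x0 y0.
pose S (x y : 'I_k -> F) := \sum_(I : {set 'I_k})
   ((- z) ^+ #|I| * (vdm (scale_on I T x) / vdm x)) *: kpoly (scale_on I q x) y N.+1.
have SE x' y' : (S x' y')`_N = mac_kernel z x' y' N.
  by rewrite coef_sum; apply: eq_bigr => I _; rewrite coefZ coef_poly ltnSn.
pose E (x y : 'I_k -> F) : {poly F} := \prod_i \prod_j (1 - (T * x i * y j) *: 'X).
have SK x' y' : eq_upto N.+1 (S x' y' * E x' y') (kernel_poly T z x' y' * kpoly x' y' N.+1).
  rewrite !mulr_suml; apply: eq_upto_sum => I _.
  rewrite -!scalerAl => i ni; rewrite !coefZ; congr (_ * _).
  rewrite /E (bigID (mem I)) /= mulrA [in RHS]mulrAC.
  by apply: (eq_uptoM _ _ ni) => //; rewrite [X in eq_upto _ _ X]mulrC; apply: kernel_shift.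
have EC : E x y = E y x.
  rewrite /E exchange_big; apply: eq_bigr => i _; apply: eq_bigr => j _.
  by congr (1 - _ *: _); ring.
rewrite -!SE; apply: (@eq_upto_cancel _ N.+1 _ _ (E x y)) => //.
  rewrite -horner_coef0 horner_prod; apply/prodf_neq0 => i _.
  by rewrite horner_prod; apply/prodf_neq0 => j _; rewrite horner_1BZX mulr0 subr0 oner_neq0.
apply: eq_upto_trans (SK x y) _; rewrite {1}EC (kernel_polyC T charF xI yI x0 y0).
have -> : kpoly x y N.+1 = kpoly y x N.+1.
  by apply/polyP => i; rewrite !coef_poly kernelC.
by move=> i ni; rewrite SK.
Qed.

End Kernel.

(** * Macdonald polynomials *)

Definition part_mnm n (la : seq nat) : 'X_{1..n} := [multinom nth 0%N la i | i < n].

Lemma sumn_nth n (s : seq nat) : (size s <= n)%N -> sumn s = (\sum_(i < n) nth 0%N s i)%N.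
Proof.
elim: s n => [|e s IHs] n /= sn.
  by rewrite big1 // => i _; rewrite nth_nil.
by case: n sn => // n sn; rewrite big_ord_recl /= (IHs n).
Qed.

Lemma mdeg_part_mnm n la : (size la <= n)%N -> mdeg (part_mnm n la) = sumn la.
Proof.
by move=> sn; rewrite mdegE (sumn_nth sn); apply: eq_bigr => i _; rewrite mnmE.
Qed.

Lemma part_mnm_seq n (s : seq nat) : (size s <= n)%N ->
  part_mnm n s = s ++ nseq (n - size s) 0%N :> seq nat.
Proof.
move=> sn; apply: (@eq_from_nth _ 0%N).
  by rewrite size_tuple size_cat size_nseq subnKC.
move=> i; rewrite size_tuple => i_n.
rewrite -[i]/(nat_of_ord (Ordinal i_n)) -mnm_nth mnmE nth_cat /=.
by case: ltnP => // si; rewrite nth_nseq if_same nth_default.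
Qed.

Lemma part_mnm_pos n (la : intpart) : (size la <= n)%N ->
  [seq e <- (part_mnm n la : seq nat) | (0 < e)%N] = la.
Proof.
move=> sn; rewrite part_mnm_seq // filter_cat (_ : [seq e <- nseq _ _ | _] = [::]) ?cats0.
  apply/all_filterP/allP => e ela; rewrite lt0n; apply/eqP => e0.
  by have [_] := intpartP la; rewrite -e0 ela.
by elim: (n - size la)%N.
Qed.

Lemma part_mnm_inj n (la mu : intpart) : (size la <= n)%N -> (size mu <= n)%N ->
  part_mnm n la = part_mnm n mu -> la = mu.
Proof.
by move=> ln mn h; apply: intpart_inj; rewrite -(part_mnm_pos ln) h part_mnm_pos.
Qed.

Lemma sumn_takeS (s : seq nat) i :
  sumn (take i.+1 s) = (sumn (take i s) + nth 0%N s i)%N.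
Proof.
have [si|si] := ltnP i (size s); last first.
  by rewrite nth_default // addn0 !take_oversize // ltnW.
by rewrite (take_nth 0%N) // sumn_rcons.
Qed.

(** At the first index where the partitions differ the earlier partial sums agree, so dominance
    gives the strict inequality there. The dominance order is thus refined by the total order on
    monomials. *)
Lemma dominated_lt n (nu mu : intpart) : (size nu <= n)%N -> (size mu <= n)%N ->
  dominated nu mu -> (part_mnm n nu < part_mnm n mu)%O.
Proof.
move=> nn mn /and3P[num /eqP snm /allP dom].
apply/ltmcP; first by rewrite !mdeg_part_mnm.
have [i0 hi0] : exists i : 'I_n, nth 0%N nu i != nth 0%N mu i.
  apply/existsP; apply: contraNT num; rewrite negb_exists; move/forallP=> h.
  apply/eqP/(part_mnm_inj nn mn)/mnmP => i; rewrite !mnmE.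
  by apply/eqP; have := h i; rewrite negbK.
case: (@arg_minnP _ i0 (fun i : 'I_n => nth 0%N nu i != nth 0%N mu i) (@nat_of_ord n) hi0)
  => i hi imin.
have eqlt j : (j < i)%N -> nth 0%N nu j = nth 0%N mu j.
  move=> ji; apply/eqP/negPn/negP => hj.
  have := imin (Ordinal (ltn_trans ji (ltn_ord i))) hj; rewrite leqNgt /=.
  by rewrite ji.
exists i => [j ji|]; first by rewrite !mnmE eqlt.
rewrite !mnmE ltn_neqAle hi /=.
have eqtake j : (j <= i)%N -> sumn (take j nu) = sumn (take j mu).
  elim: j => [|j IHj] ji; first by rewrite !take0.
  by rewrite !sumn_takeS IHj ?eqlt // ltnW.
have : (sumn (take i.+1 nu) <= sumn (take i.+1 mu))%N.
  have [iM|iM] := leqP i.+1 (sumn mu).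
    by apply: dom; rewrite mem_iota.
  rewrite !take_oversize ?snm //; first exact: leq_trans (size_intpart mu) (ltnW iM).
  by apply: leq_trans (size_intpart nu) _; rewrite snm ltnW.
by rewrite !sumn_takeS eqtake // leq_add2l.
Qed.

Lemma psf_homog (K : fieldType) n (la : intpart) : psf K la n \is (sumn la).-homog.
Proof.
rewrite /psf; elim: (la : seq nat) => [|r s IHs]; first by rewrite big_nil dhomog1.
rewrite big_cons /= dhomogM //.
by apply: rpred_sum => i _; rewrite mpolyXn dhomogX /= mdegMn mdeg1 mul1n.
Qed.

Lemma sumn_filter_pos (s : seq nat) : sumn [seq e <- s | (0 < e)%N] = sumn s.
Proof. by elim: s => // -[|e] s IHs //=; rewrite IHs. Qed.

Lemma mcoeff_msf (K : fieldType) n (la : intpart) (m : 'X_{1..n}) :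
  (msf K la n)@_m = (perm_eq [seq e <- m | (0 < e)%N] la)%:R.
Proof.
rewrite /msf raddf_sum /=.
under eq_bigr => a _ do rewrite mcoeffX.
case: (boolP (perm_eq _ la)) => h; last first.
  by rewrite big1 // => a ha; case: eqP => // e; rewrite -e ha in h.
have md : (mdeg m < (sumn la).+1)%N.
  by rewrite ltnS /mdeg -sumnE -sumn_filter_pos (perm_sumn h).
rewrite (bigD1 (BMultinom md)) //= eqxx big1 ?addr0 // => a /andP[_ am].
by case: eqP => // e; case/negP: am; apply/eqP/val_inj.
Qed.

Lemma msf_homog (K : fieldType) n (la : intpart) : msf K la n \is (sumn la).-homog.
Proof.
apply/dhomogP => m; rewrite mcoeff_msupp mcoeff_msf.
case: (boolP (perm_eq _ la)) => [h _|_]; last by rewrite eqxx.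
by rewrite /= /mdeg -sumnE -sumn_filter_pos (perm_sumn h).
Qed.

Lemma msf_size0 (K : fieldType) n (la : intpart) : (n < size la)%N -> msf K la n = 0.
Proof.
move=> nla; apply/mpolyP => m; rewrite mcoeff_msf mcoeff0.
case: (boolP (perm_eq _ la)) => // /perm_size e.
by move: nla; rewrite -e size_filter ltnNge (leq_trans (count_size _ _)) ?size_tuple.
Qed.

Lemma msf_part_mnm (K : fieldType) n (la mu : intpart) : (size mu <= n)%N ->
  (msf K la n)@_(part_mnm n mu) = (mu == la)%:R.
Proof.
move=> mn; rewrite mcoeff_msf part_mnm_pos //; congr (nat_of_bool _)%:R.
apply/idP/eqP => [/intpart_perm //|->].
exact: perm_refl.
Qed.

Lemma perm_part_mnm n (la : intpart) (m : 'X_{1..n}) : (size la <= n)%N ->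
  perm_eq [seq e <- m | (0 < e)%N] la -> perm_eq m (part_mnm n la).
Proof.
move=> ln h; rewrite part_mnm_seq //.
rewrite -(perm_filterC (fun e => (0 < e)%N) m) perm_cat //.
have -> : [seq e <- m | predC (fun e => (0 < e)%N) e] = nseq (n - size la) 0%N.
  have <- : size [seq e <- m | predC (fun e => (0 < e)%N) e] = (n - size la)%N.
    rewrite -(perm_size h) !size_filter -[X in (X - _)%N](size_tuple m).
    by rewrite -(count_predC (fun e => (0 < e)%N) m) addKn.
  by apply/all_pred1P/allP => e; rewrite mem_filter /= -leqNgt leqn0 => /andP[].
exact: perm_refl.
Qed.

Lemma sorted_part_mnm n (la : intpart) : (size la <= n)%N -> sorted geq (part_mnm n la : seq nat).
Proof.
move=> ln; apply/(sortedP 0%N) => i; rewrite size_tuple => i_n.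
have := mnm_nth 0%N (part_mnm n la) (Ordinal i_n); rewrite mnmE /= => <-.
have := mnm_nth 0%N (part_mnm n la) (Ordinal (ltnW i_n)); rewrite mnmE /= => <-.
have [h _] := intpartP la; have [il|il] := ltnP i.+1 (size la).
  by have /(sortedP 0%N) := h; apply.
by rewrite /geq /= nth_default.
Qed.

(** At the first position i where m differs from the decreasing rearrangement p, the entry m i
    occurs in the tail of p from i on, hence is at most p i. *)
Lemma msf_le_part_mnm (K : fieldType) n (la : intpart) (m : 'X_{1..n}) :
  (size la <= n)%N -> (msf K la n)@_m != 0 -> (m <= part_mnm n la)%O.
Proof.
move=> ln; rewrite mcoeff_msf; case: (boolP (perm_eq _ la)) => [h _|_]; last by rewrite eqxx.
have P := perm_part_mnm ln h; set p := part_mnm n la in P *.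
have md : mdeg m = mdeg p by rewrite /mdeg (perm_big _ P).
have [->//|mp] := eqVneq m p; apply/ltW/ltmcP => //.
have [i0 hi0] : exists i : 'I_n, m i != p i.
  apply/existsP; apply: contraNT mp; rewrite negb_exists; move/forallP=> e.
  by apply/eqP/mnmP => i; apply/eqP; have := e i; rewrite negbK.
case: (@arg_minnP _ i0 (fun i : 'I_n => m i != p i) (@nat_of_ord n) hi0)
  => i hi imin.
have eqlt (j : 'I_n) : (j < i)%N -> m j = p j.
  move=> ji; apply/eqP/negPn/negP => /imin; by rewrite leqNgt ji.
exists i => //; rewrite ltn_neqAle hi /=.
have sm : (i < size m)%N by rewrite size_tuple.
have sp : (i < size p)%N by rewrite size_tuple.
have tm : size (take i m) = i by rewrite size_takel // ltnW.
have tp : size (take i p) = i by rewrite size_takel // ltnW.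
have et : take i m = take i p.
  apply: (@eq_from_nth _ 0%N) => [|j]; first by rewrite tm tp.
  rewrite tm => ji; rewrite !nth_take //.
  by have := eqlt (Ordinal (ltn_trans ji (ltn_ord i))) ji; rewrite !(mnm_nth 0%N).
have Pd : perm_eq (drop i m) (drop i p).
  by rewrite -(perm_cat2l (take i m)) cat_take_drop et cat_take_drop.
have : m i \in drop i p.
  by rewrite -(perm_mem Pd) (drop_nth 0%N sm) inE (mnm_nth 0%N) eqxx.
rewrite (mnm_nth 0%N p i) (drop_nth 0%N sp) inE => /orP[/eqP -> //|].
have : sorted geq (drop i p) by apply/drop_sorted/sorted_part_mnm.
rewrite (drop_nth 0%N sp) /= => /order_path_min h' mi.
apply: (allP (h' _)) mi => a b c /= ba cb; exact: leq_trans cb ba.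
Qed.

(** The first [size nu] parts of [nu] already sum to |mu|, which forces those of [mu] to exhaust
    |mu|. Hence P_mu vanishes in fewer variables than [mu] has parts. *)
Lemma dominated_size (nu mu : intpart) : dominated nu mu -> (size mu <= size nu)%N.
Proof.
case/and3P => _ /eqP snm /allP dom; rewrite leqNgt; apply/negP => lt.
have /dom : size nu \in iota 0 (sumn mu).+1.
  by rewrite mem_iota /= add0n ltnS -snm size_intpart.
rewrite take_size snm -{1}(cat_take_drop (size nu) mu) sumn_cat -[X in (_ <= X)%N]addn0 leq_add2l.
have [_ mu0] := intpartP mu.
rewrite (drop_nth 0%N lt) /= leqn0 addn_eq0 => /andP[/eqP e _].
by case/negP: mu0; rewrite -e mem_nth.
Qed.

Lemma homog_comp (K : fieldType) n N (s : seq intpart) (a : intpart -> K) (p : {mpoly K[n]}) :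
  p = \sum_(la <- s) a la *: psf K la n ->
  forall m, mdeg m = N -> p@_m = (\sum_(la <- s | sumn la == N) a la *: psf K la n)@_m.
Proof.
move=> -> m mN; rewrite !raddf_sum [RHS]big_mkcond; apply: eq_bigr => la _ /=.
case: eqP => // laN; rewrite mcoeffZ (dhomog_nemf_coeff (psf_homog K n la)) ?mulr0 //=.
by apply/eqP => e; apply: laN; rewrite -e mN.
Qed.

Lemma big_partn_cond (V : nmodType) N (s : seq intpart) (f : intpart -> V) : uniq s ->
  \sum_(la <- s | sumn la == N) f la = \sum_(la <- partn N | la \in s) f la.
Proof.
move=> us; rewrite -big_filter -[RHS]big_filter; apply: perm_big; apply: uniq_perm.
- by rewrite filter_uniq.
- by rewrite filter_uniq // partn_uniq.
- by move=> la; rewrite !mem_filter mem_partn andbC.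
Qed.

Section MacdonaldFamily.

Variables (K : fieldType) (q T : K) (P : intpart -> symfun K).
Hypothesis HP : is_macdonald q T P.

Lemma mac_expand (la : intpart) : exists (s : seq intpart) (u : intpart -> K),
  all (fun nu => dominated nu la) s /\
  forall n, P la n = msf K la n + \sum_(nu <- s) u nu *: msf K nu n.
Proof. by case: HP => H _; apply: H. Qed.

Lemma mac_homog (la : intpart) n : P la n \is (sumn la).-homog.
Proof.
have [s [u [/allP ds ->]]] := mac_expand la.
rewrite rpredD ?msf_homog // big_seq rpred_sum // => nu /ds /and3P[_ /eqP e _].
by rewrite dhomogZ // -e msf_homog.
Qed.

Lemma mac_size0 (la : intpart) n : (n < size la)%N -> P la n = 0.
Proof.
move=> nla; have [s [u [/allP ds ->]]] := mac_expand la.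
rewrite msf_size0 // add0r big_seq big1 // => nu /ds /dominated_size h.
by rewrite msf_size0 ?scaler0 // (leq_trans nla).
Qed.

Lemma mac_lead (la : intpart) n : (size la <= n)%N -> (P la n)@_(part_mnm n la) = 1.
Proof.
move=> ln; have [s [u [/allP ds ->]]] := mac_expand la.
rewrite mcoeffD msf_part_mnm // eqxx raddf_sum big_seq big1 ?addr0 // => nu /ds /and3P[h _ _].
by rewrite /= mcoeffZ msf_part_mnm // eq_sym (negPf h) mulr0.
Qed.

Lemma mac_le (la : intpart) n (m : 'X_{1..n}) :
  (size la <= n)%N -> (P la n)@_m != 0 -> (m <= part_mnm n la)%O.
Proof.
move=> ln; have [s [u [/allP ds ->]]] := mac_expand la => h.
rewrite leNgt; apply/negP => lt; case/negP: h; apply/eqP.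
have z nu : nu \in la :: s -> (msf K nu n)@_m = 0.
  rewrite inE => hnu; have [nn|nn] := ltnP n (size nu); first by rewrite msf_size0 // mcoeff0.
  apply/eqP/negPn/negP => /(msf_le_part_mnm nn) mnu.
  case/orP: hnu => [/eqP e|/ds /(dominated_lt nn ln) h].
    by move: mnu; rewrite e leNgt lt.
  by have := le_lt_trans mnu (lt_trans h lt); rewrite ltxx.
rewrite mcoeffD z ?inE ?eqxx // raddf_sum big_seq big1 ?addr0 // => nu nus.
by rewrite /= mcoeffZ z ?mulr0 // inE nus orbT.
Qed.

Lemma mac_psf_expand (la : intpart) : exists a : intpart -> K,
  forall n, P la n = \sum_(mu <- partn (sumn la)) a mu *: psf K mu n.
Proof.
(* Orthogonality to any other member of the family supplies an expansion in power sums; a row of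
   larger size surely differs from [la]. *)
have [_ /(_ la (row_part (sumn la).+1))] := HP.
case=> [e|s [a [b [us Pa _ _]]]].
  by have := congr1 (fun s : intpart => sumn s) e => /= /eqP;
    rewrite addn0 -[X in X == _]addn0 -addn1 eqn_add2l.
exists (fun mu => if mu \in s then a mu else 0) => n.
rewrite [RHS](eq_bigr (fun mu => if mu \in s then a mu *: psf K mu n else 0)); last first.
  by move=> mu _; case: ifP; rewrite ?scale0r.
rewrite -big_mkcond -big_partn_cond //; apply/mpolyP => m.
have [mN|mN] := eqVneq (mdeg m) (sumn la); first exact: homog_comp (Pa n) _ mN.
rewrite (dhomog_nemf_coeff (mac_homog la n)) //; apply/esym.
rewrite raddf_sum big1 // => mu /eqP muN.
by rewrite /= mcoeffZ (dhomog_nemf_coeff (psf_homog K n mu)) ?mulr0 // muN.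
Qed.

Definition part_at N (i : 'I_(size (partn N))) : intpart := tnth (in_tuple (partn N)) i.

Lemma sumn_part_at N (i : 'I_(size (partn N))) : sumn (part_at i) = N.
Proof. by apply/eqP; rewrite -mem_partn mem_tnth. Qed.

Lemma size_part_at N (i : 'I_(size (partn N))) : (size (part_at i) <= N)%N.
Proof. by rewrite -[X in (_ <= X)%N](sumn_part_at i) size_intpart. Qed.

Lemma part_at_inj N : injective (@part_at N).
Proof.
move=> i j /eqP; rewrite /part_at !(tnth_nth (row_part 0)) /= nth_uniq ?partn_uniq //.
by move=> /eqP/val_inj.
Qed.

Lemma part_at_surj (la : intpart) : exists i : 'I_(size (partn (sumn la))), la = part_at i.
Proof.
have h : la \in partn (sumn la) by rewrite mem_partn.
have /tnthP[i e] : la \in in_tuple (partn (sumn la)) by [].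
by exists i.
Qed.

Lemma big_part_at (V : nmodType) N (f : intpart -> V) :
  \sum_(la <- partn N) f la = \sum_(i < size (partn N)) f (part_at i).
Proof. by rewrite (big_tnth _ _ (partn N)). Qed.

Section Degree.

Variable N : nat.
Let M := size (partn N).

Let U : 'M[K]_M := \matrix_(i, j) (P (part_at i) N)@_(part_mnm N (part_at j)).
Let Up : 'M[K]_M := \matrix_(i, j) (psf K (part_at i) N)@_(part_mnm N (part_at j)).

Let U_diag i : U i i = 1.
Proof. by rewrite mxE mac_lead // size_part_at. Qed.

Let U_trig i j : U i j != 0 -> (part_mnm N (part_at j) <= part_mnm N (part_at i))%O.
Proof. by rewrite mxE; apply: mac_le; rewrite size_part_at. Qed.

(** Unitriangularity for the monomial order: for v U = 0, the coordinate at the largest index in the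
    support of v is the entry of v itself. *)
Let U_unit : U \in unitmx.
Proof.
rewrite -row_free_unit -kermx_eq0; apply/rowV0P => v /sub_kermxP vU.
apply/eqP/negPn/negP => /rV0Pn[i0 vi0].
case: (@arg_maxP _ _ _ i0 (fun i => v 0 i != 0) (fun i => part_mnm N (part_at i)) vi0) => i vi imax.
have := congr1 (fun A : 'rV[K]_M => A 0 i) vU; rewrite !mxE (bigD1 i) //= big1 ?addr0.
  by rewrite U_diag mulr1 => /eqP; apply/negP.
move=> j ji; apply/eqP; rewrite mulf_eq0; apply/negPn/negP; rewrite negb_or => /andP[vj Uji].
have h1 := imax j vj; have h2 := U_trig Uji.
case/eqP: ji; apply: part_at_inj; apply: (@part_mnm_inj N); rewrite ?size_part_at //.
by apply: le_anti; rewrite h2 andbT; apply: h1.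
Qed.

Let psf_rows (A : 'M[K]_M) :
  (forall i, P (part_at i) N = \sum_j A i j *: psf K (part_at j) N) -> U = A *m Up.
Proof.
move=> PA; apply/matrixP => i j; rewrite !mxE PA raddf_sum; apply: eq_bigr => l _.
by rewrite !mxE /= mcoeffZ.
Qed.

(** N variables separate the partitions of N. There U = A Up with U invertible, so both factors are
    invertible. *)
Lemma mac_psf_matrix : exists A : 'M[K]_M, A \in unitmx /\
  forall i n, P (part_at i) n = \sum_j A i j *: psf K (part_at j) n.
Proof.
have [a Pa] := fin_all_exists (fun i : 'I_M => mac_psf_expand (part_at i)).
pose A : 'M[K]_M := \matrix_(i, j) a i (part_at j).
have PA i n : P (part_at i) n = \sum_j A i j *: psf K (part_at j) n.
  rewrite Pa sumn_part_at big_part_at; apply: eq_bigr => j _; by rewrite mxE.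
exists A; split => //.
have := U_unit; rewrite (psf_rows (fun i => PA i N)) !unitmxE det_mulmx.
by rewrite unitrM => /andP[].
Qed.

(** Independence of the power sums of degree N comes from the invertibility of [Up] in the same
    factorization. *)
Lemma psf_free (a : intpart -> K) :
  \sum_(mu <- partn N) a mu *: psf K mu N = 0 -> forall mu : intpart, sumn mu = N -> a mu = 0.
Proof.
move=> a0 mu muN.
have [i ->] : exists i : 'I_M, mu = part_at i by rewrite /M -muN; apply: part_at_surj.
have Up_unit : Up \in unitmx.
  have [A [_ PA]] := mac_psf_matrix.
  have := U_unit; rewrite (psf_rows (fun i => PA i N)) !unitmxE det_mulmx.
  by rewrite unitrM => /andP[].
have : \row_j a (part_at j) *m Up = 0.
  apply/rowP => j; rewrite [RHS]mxE mxE.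
  transitivity ((\sum_(mu <- partn N) a mu *: psf K mu N)@_(part_mnm N (part_at j))).
    by rewrite big_part_at raddf_sum; apply: eq_bigr => l _; rewrite !mxE /= mcoeffZ.
  by rewrite a0 mcoeff0.
move/(congr1 (mulmx^~ (invmx Up))); rewrite mulmxK // mul0mx => /rowP/(_ i).
by rewrite !mxE.
Qed.

End Degree.

(** The lists and coefficients in [qt_inner] are existentially quantified. Independence identifies
    them with the homogeneous expansion, so that inner products can be computed by matrices. *)
Lemma psf_expand_uniq (la : intpart) (s : seq intpart) (a a0 : intpart -> K) : uniq s ->
  (forall n, P la n = \sum_(nu <- s) a nu *: psf K nu n) ->
  (forall n, P la n = \sum_(nu <- partn (sumn la)) a0 nu *: psf K nu n) ->
  forall nu, (if nu \in s then a nu else 0) = (if sumn nu == sumn la then a0 nu else 0).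
Proof.
move=> us Pa Pa0 nu.
pose d mu := (if mu \in s then a mu else 0) - (if sumn mu == sumn la then a0 mu else 0).
apply/eqP; rewrite -subr_eq0; apply/eqP.
apply: (@psf_free (sumn nu) d) => //; apply/mpolyP => m; rewrite mcoeff0.
have [mN|mN] := eqVneq (mdeg m) (sumn nu); last first.
  rewrite raddf_sum big_seq big1 // => mu; rewrite mem_partn => /eqP muN.
  by rewrite /= mcoeffZ (dhomog_nemf_coeff (psf_homog K _ mu)) ?mulr0 // muN.
have -> : \sum_(mu <- partn (sumn nu)) d mu *: psf K mu (sumn nu) =
   \sum_(mu <- s | sumn mu == sumn nu) a mu *: psf K mu (sumn nu)
   - \sum_(mu <- partn (sumn nu) | sumn mu == sumn la) a0 mu *: psf K mu (sumn nu).
  rewrite big_partn_cond // big_mkcond [in RHS]big_mkcond [X in _ - X]big_mkcond -sumrB /=.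
  apply: eq_bigr => mu _; rewrite /d scalerBl.
  by congr (_ - _); case: ifP; rewrite ?scale0r.
rewrite mcoeffB -(homog_comp (Pa _) mN).
have [nl|nl] := eqVneq (sumn nu) (sumn la).
  have -> : partn (sumn nu) = partn (sumn la) by rewrite nl.
  rewrite big_seq_cond (eq_bigl (fun mu => mu \in partn (sumn la))); last first.
    by move=> mu; rewrite mem_partn andbb.
  by rewrite -big_seq -Pa0 subrr.
have -> : (P la (sumn nu))@_m = 0.
  by apply: dhomog_nemf_coeff (mac_homog la _) _; rewrite /= mN.
rewrite sub0r big_seq_cond big_pred0 ?mcoeff0 ?oppr0 // => mu.
by rewrite mem_partn; case: eqP => // ->; rewrite (negPf nl).
Qed.

End MacdonaldFamily.

(** * Expansion of the reproducing kernel in Macdonald functions *)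

Section KernelExpansion.

Variables (K : fieldType) (q T : K) (P : intpart -> symfun K).
Hypothesis HP : is_macdonald q T P.
Hypothesis charK : [pchar K] =i pred0.
Hypothesis qn : forall n : nat, q ^+ n.+1 != 1.
Hypothesis Tn : forall n : nat, T ^+ n.+1 != 1.

Lemma psf_norm_neq0 (la : intpart) : psf_norm q T la != 0.
Proof.
have /pcharf0P c0 := charK; rewrite /psf_norm mulf_neq0 //.
  rewrite c0 -lt0n big_nat; apply: prodn_cond_gt0 => r /andP[r0 _].
  by rewrite muln_gt0 expn_gt0 r0 fact_gt0.
have [_] := intpartP la; elim: (la : seq nat) => [|r s IHs]; first by rewrite big_nil oner_neq0.
rewrite inE negb_or big_cons => /andP[r0 /IHs h]; case: r r0 => // r _.
by rewrite mulf_neq0 // mulf_neq0 ?invr_eq0 // subr_eq0 eq_sym.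
Qed.

Lemma mmap_psf (L : fieldType) (i : {rmorphism K -> L}) n (v : 'I_n -> L) (la : intpart) :
  mmap i v (psf K la n) = \prod_(r <- la) psum v r.
Proof.
rewrite rmorph_prod; apply: eq_bigr => r _; rewrite rmorph_sum; apply: eq_bigr => j _.
by rewrite rmorphXn /= mmapX mmap1U.
Qed.

Lemma kernel_psf (L : fieldType) (i : {rmorphism K -> L}) N n m (v : 'I_n -> L) (w : 'I_m -> L) :
  kernel (i q) (i T) v w N =
  \sum_(la <- partn N) i (psf_norm q T la)^-1 * mmap i v (psf K la n) * mmap i w (psf K la m).
Proof.
apply: eq_bigr => la _; rewrite !mmap_psf.
rewrite big_split big_split /= !mulrA; congr (_ * _ * _).
rewrite /psf_norm fmorphV rmorphM invfM rmorph_nat; congr (_ * _).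
rewrite rmorph_prod -prodfV; apply: eq_bigr => r _.
by rewrite -fmorphV invf_div fmorph_div !rmorphB !rmorphXn rmorph1.
Qed.

(** With A the change of basis and G the Gram matrix of the power sums, orthogonality makes De = A G
    A^T diagonal, and inverting gives A^T De^-1 A = G^-1, the expansion in coefficients. The [b] are
    the inverse norms, fixed before the field L and the numbers of variables. *)
Lemma kernel_mac N : exists2 b : intpart -> K,
  forall la : intpart, sumn la = N -> b la != 0 &
  forall (L : fieldType) (i : {rmorphism K -> L}) n m (v : 'I_n -> L) (w : 'I_m -> L),
    kernel (i q) (i T) v w N =
    \sum_(la <- partn N) i (b la) * mmap i v (P la n) * mmap i w (P la m).
Proof.
set M := size (partn N).
have [A [Aunit PA]] := mac_psf_matrix HP N.
pose G : 'M[K]_M := diag_mx (\row_j psf_norm q T (part_at j)).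
pose De := A *m G *m A^T.
have DeE i j : De i j = \sum_l A i l * A j l * psf_norm q T (part_at l).
  rewrite /De mul_mx_diag mxE; apply: eq_bigr => l _; rewrite !mxE.
  by rewrite mulrAC.
have De_off i j : i != j -> De i j = 0.
  move=> ij; have [_ H] := HP.
  have [|s [a [b [us Pa Pb ab]]]] := H (part_at i) (part_at j).
    by move=> /part_at_inj e; rewrite e eqxx in ij.
  pose A0 l (nu : intpart) := \sum_(r < M | part_at r == nu) A l r.
  have A0E l r : A0 l (part_at r) = A l r.
    rewrite /A0 (big_pred1 r) // => r'; apply/eqP/eqP => [/part_at_inj //|-> //].
  have PA0 l n : P (part_at l) n = \sum_(nu <- partn (sumn (part_at l))) A0 l nu *: psf K nu n.
    rewrite PA sumn_part_at big_part_at; apply: eq_bigr => r _; by rewrite A0E.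
  have ua := psf_expand_uniq HP us Pa (PA0 i).
  have ub := psf_expand_uniq HP us Pb (PA0 j).
  rewrite DeE; apply: etrans (esym ab).
  rewrite [RHS](bigID (fun nu : intpart => sumn nu == N)) /= addrC [X in _ = X + _]big1_seq ?add0r.
    rewrite big_partn_cond // [RHS]big_mkcond big_part_at; apply: eq_bigr => l _.
    have := ua (part_at l); have := ub (part_at l).
    rewrite !sumn_part_at eqxx !A0E; case: ifP => _ <- <- //; by rewrite !mul0r.
  move=> nu /andP[nuN nus]; have := ua nu; rewrite nus sumn_part_at (negPf nuN) => ->.
  by rewrite !mul0r.
have De_diag : De = diag_mx (\row_i De i i).
  apply/matrixP => i j; rewrite [RHS]mxE [X in _ = X *+ _]mxE.
  by case: eqVneq => [->|/De_off ->]; rewrite ?mulr1n.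
have G0 : G \in unitmx.
  rewrite unitmxE det_diag unitfE; apply/prodf_neq0 => j _; rewrite mxE; exact: psf_norm_neq0.
have De_unit : De \in unitmx by rewrite !unitmx_mul Aunit G0 unitmx_tr.
have De0 i : De i i != 0.
  have h := De_unit; rewrite De_diag unitmxE det_diag unitfE in h.
  by have /prodf_neq0/(_ i isT) := h; rewrite mxE.
pose De1 : 'M[K]_M := diag_mx (\row_i (De i i)^-1).
have DeV : De *m De1 = 1%:M.
  rewrite [X in X *m _]De_diag mulmx_diag; apply/matrixP => i j.
  by rewrite 2!mxE [X in X * _]mxE [X in _ * X]mxE divff // mxE.
have key : A^T *m De1 *m A *m G = 1%:M.
  rewrite -(mulmxA (A^T *m De1)); apply: mulmx1C; rewrite mulmxA; exact: DeV.
have keyE i j : \sum_l (De l l)^-1 * A l i * A l j = (psf_norm q T (part_at j))^-1 *+ (i == j).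
  have := congr1 (fun X : 'M[K]_M => X i j) key; rewrite mul_mx_diag !mxE => h.
  have -> : \sum_l (De l l)^-1 * A l i * A l j =
      \sum_l (A^T *m De1) i l * A l j.
    apply: eq_bigr => l _; rewrite mul_mx_diag !mxE; by rewrite [A l i * _]mulrC.
  by rewrite -[LHS](mulfK (psf_norm_neq0 (part_at j))) h; case: eqP; rewrite ?mul1r ?mul0r.
exists (fun la => if [pick i | part_at i == la] is Some i then (De i i)^-1 else 0).
  move=> la laN; case: pickP => [i _|h]; first by rewrite invr_eq0.
  have [i e] : exists i : 'I_M, la = part_at i by rewrite /M -laN; apply: part_at_surj.
  by have := h i; rewrite e eqxx.
move=> L io n m v w; rewrite kernel_psf !big_part_at.
have pE i : (if [pick j | part_at j == part_at i] is Some j then (De j j)^-1 else 0) = (De i i)^-1.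
  case: pickP => [j /eqP/part_at_inj -> //|/(_ i)]; by rewrite eqxx.
under [RHS]eq_bigr => i _ do rewrite pE !PA !raddf_sum /= -mulrA mulr_suml mulr_sumr.
rewrite exchange_big /=; apply: eq_bigr => i _.
under [RHS]eq_bigr => l _ do rewrite !mulr_sumr.
rewrite exchange_big /= (bigD1 i) //= [X in _ + X]big1 ?addr0; last first.
  move=> j ji; rewrite (eq_bigr (fun l => io ((De l l)^-1 * A l i * A l j) *
     (mmap io v (psf K (part_at i) n) * mmap io w (psf K (part_at j) m)))).
    by rewrite -mulr_suml -rmorph_sum keyE eq_sym (negPf ji) /= rmorph0 mul0r.
  by move=> l _; rewrite !mmapZ !rmorphM /=; ring.
rewrite (eq_bigr (fun l => io ((De l l)^-1 * A l i * A l i) *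
     (mmap io v (psf K (part_at i) n) * mmap io w (psf K (part_at i) m)))); last first.
  by move=> l _; rewrite !mmapZ !rmorphM /=; ring.
by rewrite -mulr_suml -rmorph_sum keyE eqxx mulr1n mulrA.
Qed.

End KernelExpansion.

(** * Diagonalization of the Macdonald operators *)

Section ScaleMpoly.

Variables (K : fieldType) (k : nat).

Definition scale_mpoly (I : {set 'I_k}) (c : K) (p : {mpoly K[k]}) : {mpoly K[k]} :=
  mmap (@mpolyC k K) (scale_on I c%:MP (fun i => 'X_i)) p.

Lemma mcoeff_scale_mpoly I c p m :
  (scale_mpoly I c p)@_m = c ^+ (\sum_(i in I) m i) * p@_m.
Proof.
have H m' : mmap1 (scale_on I c%:MP (fun i => 'X_i)) m' =
    c ^+ (\sum_(i in I) m' i) *: 'X_[m'] :> {mpoly K[k]}.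
  rewrite /mmap1 (eq_bigr (fun i => (if i \in I then c ^+ m' i else 1)%:MP * 'X_i ^+ m' i)).
    rewrite big_split /= -mpolyXE_id -rmorph_prod /= mul_mpolyC; congr (_ *: _).
    by rewrite -big_mkcond prodrXr.
  move=> i _; rewrite /scale_on; case: ifP => _; last by rewrite mul1r.
  by rewrite exprMn rmorphXn.
rewrite /scale_mpoly /mmap raddf_sum /= [in RHS](mpolyE p) raddf_sum mulr_sumr /=.
apply: eq_bigr => m' _; rewrite H mul_mpolyC !mcoeffZ mcoeffX.
by case: eqP => [->|_]; rewrite ?mulr1 ?mulr0 // mulrC.
Qed.

Lemma mmap_scale_mpoly (L : fieldType) (io : {rmorphism K -> L}) (v : 'I_k -> L) I c p :
  mmap io v (scale_mpoly I c p) = mmap io (scale_on I (io c) v) p.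
Proof.
rewrite /scale_mpoly [mmap (@mpolyC k K) _ _]/mmap raddf_sum; apply: eq_bigr => m _.
rewrite /= rmorphM /= mmapC; congr (_ * _); rewrite rmorph_prod; apply: eq_bigr => i _.
rewrite rmorphXn; congr (_ ^+ _); rewrite /scale_on; case: ifP => _.
  by rewrite rmorphM /= mmapC mmapX mmap1U.
by rewrite /= mmapX mmap1U.
Qed.

Lemma mlead_scale_mpoly I c p : (mlead (scale_mpoly I c p) <= mlead p)%O.
Proof.
have [->|p0] := eqVneq (scale_mpoly I c p) 0; first by rewrite mlead0 le0m.
apply: msupp_le_mlead; have := mlead_supp p0; rewrite !mcoeff_msupp mcoeff_scale_mpoly.
by rewrite mulf_eq0 negb_or => /andP[].
Qed.

Definition vdm_mpoly : {mpoly K[k]} := vdm (fun i => 'X_i).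

Lemma mmap_vdm (L : fieldType) (io : {rmorphism K -> L}) (v : 'I_k -> L) :
  mmap io v vdm_mpoly = vdm v.
Proof.
rewrite rmorph_prod; apply: eq_bigr => i _; rewrite rmorph_prod; apply: eq_bigr => j _.
by rewrite rmorphB /= !mmapX !mmap1U.
Qed.

Definition stair : 'X_{1..k} := [multinom (k.-1 - i)%N | i < k].

(** In the monomial order the variables decrease with their index, so each factor x_j - x_i with i <
    j has leading monomial x_i. *)
Lemma mlead_vdm : mlead vdm_mpoly = stair.
Proof.
have neq0 (i j : 'I_k) : (i < j)%N -> 'X_j - 'X_i != 0 :> {mpoly K[k]}.
  move=> ij; apply/eqP => /(congr1 (mcoeff U_(j))); rewrite mcoeffB !mcoeffXU eqxx mcoeff0.
  by rewrite -val_eqE ltn_eqF // subr0 => /eqP; rewrite oner_eq0.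
have le (i j : 'I_k) : (i < j)%N -> mlead ('X_j - 'X_i : {mpoly K[k]}) = U_(i)%MM.
  move=> ij; rewrite mleadDr ?mleadN ?mleadXm //.
  apply/ltmcP; first by rewrite !mdeg1.
  exists i => [l li|]; rewrite !mnm1E; last by rewrite eqxx -val_eqE /= gtn_eqF.
  by rewrite -!val_eqE /= !gtn_eqF // (ltn_trans li).
rewrite /vdm_mpoly /vdm mlead_prod => [|i _ _]; last by apply/prodf_neq0 => j; apply: neq0.
apply/mnmP => l; rewrite mnm_sumE mnmE.
rewrite (bigD1 l) //= [X in (_ + X)%N]big1 ?addn0 => [|i il].
  rewrite mlead_prod => [|j _]; last exact: neq0.
  rewrite mnm_sumE (eq_bigr (fun=> 1%N)) => [|j lj]; last by rewrite le // mnm1E eqxx.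
  rewrite -(big_mkord (fun j => l < j)%N (fun=> 1%N)) (@big_cat_nat _ _ _ l.+1) //=.
  have -> : (\sum_(0 <= j < l.+1 | l < j) 1 = 0)%N.
    by rewrite big_nat_cond big_pred0 // => j; apply/negbTE/negP => /andP[/andP[_ h1]];
      rewrite ltnNge -ltnS h1.
  have -> : (\sum_(l.+1 <= j < k | l < j) 1 = \sum_(l.+1 <= j < k) 1)%N.
    rewrite big_nat_cond [RHS]big_nat_cond; apply: eq_bigl => j.
    by rewrite andbT andbAC andbb.
  by rewrite sum_nat_const_nat muln1; lia.
rewrite mlead_prod => [|j _]; last exact: neq0.
by rewrite mnm_sumE big1 // => j ij; rewrite le // mnm1E (negPf il).
Qed.

Lemma vdm_mpoly_neq0 : vdm_mpoly != 0.
Proof.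
have := @vdm_neq0 _ k (@rfvar K k) (@rfvar_inj K k).
rewrite -(mmap_vdm (@rfconst K k)); apply: contraNneq => ->.
by rewrite rmorph0.
Qed.

End ScaleMpoly.

(* Separation of two sets of indeterminates: a relation in K[x] (x) K[y]. *)
Lemma tensor_eq0 (K : fieldType) k (J : Type) (s : seq J) (f g : J -> {mpoly K[k]}) :
  \sum_(j <- s) mmap (rfconst k \o @rfconst K k) (fun i => rfconst k (rfvar K i)) (f j) *
    mmap (rfconst k \o @rfconst K k) (@rfvar (ratfun K k) k) (g j) = 0 ->
  forall m m', \sum_(j <- s) (f j)@_m * (g j)@_m' = 0.
Proof.
move=> h m m'.
have fE p : mmap (rfconst k \o @rfconst K k) (fun i => rfconst k (rfvar K i)) p =
    rfconst k (rfpoly p) :> ratfun (ratfun K k) k.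
  rewrite rfpolyE /mmap rmorph_sum; apply: eq_bigr => n _.
  rewrite rmorphM /=; congr (_ * _); rewrite rmorph_prod; apply: eq_bigr => i _.
  by rewrite rmorphXn.
have gE p : mmap (rfconst k \o @rfconst K k) (@rfvar (ratfun K k) k) p =
    rfpoly (map_mpoly (@rfconst K k) p) :> ratfun (ratfun K k) k.
  rewrite [in RHS](mpolyE p) (raddf_sum (map_mpoly (@rfconst K k))).
  rewrite (raddf_sum (@rfpoly (ratfun K k) k)); apply: eq_bigr => n _ /=.
  rewrite map_mpolyZ -mul_mpolyC rmorphM map_mpolyX /=; congr (_ * _).
  by rewrite mpolyXE_id rmorph_prod; apply: eq_bigr => i _; rewrite rmorphXn.
have : rfpoly (\sum_(j <- s) rfpoly (f j) *: map_mpoly (@rfconst K k) (g j)) = 0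
   :> ratfun (ratfun K k) k.
  rewrite -[RHS]h rmorph_sum; apply: eq_bigr => j _.
  by rewrite fE gE -mul_mpolyC rmorphM.
move/eqP; rewrite rfpoly_eq0 => /eqP/(congr1 (mcoeff m')).
rewrite raddf_sum mcoeff0 /=.
have E j : rfpoly (f j) * rfconst k (g j)@_m' = rfpoly ((g j)@_m' *: f j).
  by rewrite -mul_mpolyC rmorphM mulrC.
under eq_bigr => j _ do rewrite mcoeffZ mcoeff_map_mpoly /= E.
rewrite -rmorph_sum => /eqP; rewrite rfpoly_eq0 => /eqP/(congr1 (mcoeff m)).
rewrite raddf_sum mcoeff0 /= => {2}<-; apply: eq_bigr => j _.
by rewrite mcoeffZ mulrC.
Qed.

Lemma mulr_regroup5 (F : fieldType) (a b c d S : F) : a * b * (c * d * S) = c * (a * S) * (b * d).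
Proof. by ring. Qed.

Lemma mulr_regroup4 (F : fieldType) (a b c d : F) : a * (b * c * d) = b * d * (a * c).
Proof. by ring. Qed.

Section Triangular.

Variables (K : fieldType) (k : nat) (q T : K) (P : intpart -> symfun K).
Hypothesis HP : is_macdonald q T P.
Hypothesis charK : [pchar K] =i pred0.
Hypothesis qn : forall n : nat, q ^+ n.+1 != 1.
Hypothesis Tn : forall n : nat, T ^+ n.+1 != 1.

Variable z : K.

(* Vandermonde times the generating function of the Macdonald operators. *)
Let num (p : {mpoly K[k]}) : {mpoly K[k]} := \sum_(I : {set 'I_k})
  (- z) ^+ #|I| *: (scale_mpoly I T (vdm_mpoly K k) * scale_mpoly I q p).

Let V (la : intpart) := vdm_mpoly K k * P la k.

Let eps (la : intpart) : K := \prod_(i < k) (1 - z * T ^+ (k.-1 - i) * q ^+ nth 0%N la i).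

Let R la := num (P la k) - eps la *: V la.

Let mmap_num (L : fieldType) (io : {rmorphism K -> L}) (v : 'I_k -> L) p : injective v ->
  mmap io v (num p) = vdm v * \sum_(I : {set 'I_k}) (- io z) ^+ #|I| *
    (vdm (scale_on I (io T) v) / vdm v) * mmap io (scale_on I (io q) v) p.
Proof.
move=> vI; rewrite mulr_sumr raddf_sum; apply: eq_bigr => I _ /=.
rewrite mmapZ rmorphM /= !mmap_scale_mpoly mmap_vdm rmorphXn rmorphN.
by field; rewrite vdm_neq0.
Qed.

(** The exchange symmetry of the kernel, multiplied by both Vandermonde products and read in the
    iterated field K(x)(y); the coefficients of x^m y^m' are then compared. *)
Let bilinear N : exists2 b : intpart -> K, forall la : intpart, sumn la = N -> b la != 0 &
  forall m m', \sum_(la <- partn N) b la *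
    ((num (P la k))@_m * (V la)@_m' - (V la)@_m * (num (P la k))@_m') = 0.
Proof.
have [b b0 kE] := kernel_mac HP charK qn Tn N; exists b => // m m'.
pose L := ratfun (ratfun K k) k.
pose io : {rmorphism K -> L} := rfconst k \o @rfconst K k.
pose v (i : 'I_k) : L := rfconst k (rfvar K i).
pose w : 'I_k -> L := @rfvar (ratfun K k) k.
have vI : injective v by move=> i j /fmorph_inj/rfvar_inj.
have wI : injective w by apply: rfvar_inj.
have v0 i : v i != 0 by rewrite fmorph_eq0 rfvar_neq0.
have w0 i : w i != 0 by apply: rfvar_neq0.
have charL : [pchar L] =i pred0 by move=> p; rewrite (fmorph_pchar io) charK.
have qL n : io q ^+ n.+1 != 1.
  by rewrite -rmorphXn -(rmorph1 io) (inj_eq (fmorph_inj io)).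
have mkE (v' w' : 'I_k -> L) : injective v' ->
   vdm v' * vdm w' * mac_kernel (io q) (io T) (io z) v' w' N =
   \sum_(la <- partn N) io (b la) * mmap io v' (num (P la k)) * mmap io w' (V la).
  move=> v'I; rewrite /mac_kernel.
  under eq_bigr => I _ do rewrite kE mulr_sumr.
  rewrite exchange_big mulr_sumr; apply: eq_bigr => la _ /=.
  rewrite mmap_num // /V rmorphM /= mmap_vdm -mulr_regroup5; congr (_ * _).
  by rewrite mulr_sumr; apply: eq_bigr => I _; apply: mulr_regroup4.
have := mac_kernelC (q := io q) (io T) charL qL (io z) N vI wI v0 w0.
move/(congr1 ( *%R (vdm v * vdm w))); rewrite mkE // [vdm v * _]mulrC mkE // => h.
pose s := [seq (la, true) | la <- partn N] ++ [seq (la, false) | la <- partn N].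
pose f (p : intpart * bool) := if p.2 then b p.1 *: num (P p.1 k) else - (b p.1 *: V p.1).
pose g (p : intpart * bool) := if p.2 then V p.1 else num (P p.1 k).
have := @tensor_eq0 K k _ s f g; rewrite big_cat !big_map /=.
under eq_bigr => la _ do rewrite /f /g /= mmapZ.
under [X in _ + X]eq_bigr => la _ do rewrite /f /g /= mmapN mmapZ mulNr -mulrA
  [_ (V la) * _]mulrC mulrA.
rewrite sumrN h subrr => /(_ erefl m m').
rewrite big_cat !big_map /= -big_split /= => fg; rewrite -[RHS]fg; apply: eq_bigr => la _.
by rewrite /f /g /= mcoeffN !mcoeffZ; ring.
Qed.

Let mlead_P (la : intpart) : (size la <= k)%N -> (mlead (P la k) <= part_mnm k la)%O.
Proof.
move=> lk; have [->|p0] := eqVneq (P la k) 0; first by rewrite mlead0 le0m.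
by apply: (mac_le HP lk); rewrite mleadc_eq0.
Qed.

Let top (la : intpart) : 'X_{1..k} := (stair k + part_mnm k la)%MM.

Let coef_gt (c d : {mpoly K[k]}) (la : intpart) m :
  (mlead c <= stair k)%O -> (mlead d <= part_mnm k la)%O -> (top la < m)%O -> (c * d)@_m = 0.
Proof.
move=> hc hd lt; apply: mcoeff_gt_mlead; apply: le_lt_trans (mleadM_le _ _) _.
by apply: le_lt_trans lt; apply: lem_add.
Qed.

Let mlead_scaleV I : (mlead (scale_mpoly I T (vdm_mpoly K k)) <= stair k)%O.
Proof. by rewrite -(mlead_vdm K); apply: mlead_scale_mpoly. Qed.

Let mlead_scaleP I (la : intpart) : (size la <= k)%N ->
  (mlead (scale_mpoly I q (P la k)) <= part_mnm k la)%O.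
Proof. by move=> lk; apply: le_trans (mlead_scale_mpoly _ _ _) (mlead_P lk). Qed.

Let mleadV : (mlead (vdm_mpoly K k) <= stair k)%O.
Proof. by rewrite mlead_vdm. Qed.

Let V_gt (la : intpart) m : (size la <= k)%N -> (top la < m)%O -> (V la)@_m = 0.
Proof. by move=> lk; apply: coef_gt => //; apply: mlead_P. Qed.

Let V_top (la : intpart) : (size la <= k)%N -> (V la)@_(top la) != 0.
Proof.
move=> lk; rewrite (mleadcMW mleadV (mlead_P lk)) (mac_lead HP lk) mulr1.
by rewrite -(mlead_vdm K) mleadc_eq0 vdm_mpoly_neq0.
Qed.

(** Above [top la] both terms vanish by the bounds on leading monomials. At [top la] the
    contributions of the sets I are the terms in the expansion of the product [eps la]. *)
Let R_ge (la : intpart) m : (size la <= k)%N -> (top la <= m)%O -> (R la)@_m = 0.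
Proof.
move=> lk; rewrite le_eqVlt => /orP[/eqP <-|lt]; rewrite mcoeffB mcoeffZ; last first.
  rewrite (V_gt lk lt) mulr0 subr0 raddf_sum big1 // => I _.
  by rewrite /= mcoeffZ (@coef_gt _ _ la) ?mulr0 // mlead_scaleP.
apply/eqP; rewrite subr_eq0; apply/eqP.
rewrite (mleadcMW mleadV (mlead_P lk)) (mac_lead HP lk) mulr1 /eps.
rewrite (eq_bigr (fun i : 'I_k => - (z * T ^+ (k.-1 - i) * q ^+ nth 0%N la i) + 1)); last first.
  by move=> i _; rewrite addrC.
rewrite bigA_distr mulr_suml raddf_sum; apply: eq_bigr => I _ /=.
rewrite mcoeffZ (mleadcMW (mlead_scaleV I) (mlead_scaleP I lk)).
have -> : \prod_(i < k) (if i \in I then - (z * T ^+ (k.-1 - i) * q ^+ nth 0%N la i) else 1) =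
    (- z) ^+ #|I| * (T ^+ (\sum_(i in I) stair k i) * q ^+ (\sum_(i in I) part_mnm k la i)).
  rewrite -big_mkcond /= (eq_bigr (fun i : 'I_k => - z * (T ^+ stair k i * q ^+ part_mnm k la i))).
    by rewrite big_split /= prodr_const big_split /= !prodrXr.
  by move=> i _; rewrite !mnmE mulNr mulrA.
rewrite !mcoeff_scale_mpoly (mac_lead HP lk) mulr1 -!mulrA; congr (_ * (_ * _)).
by rewrite mulrC.
Qed.

(** The parts [eps la *: V la] cancel in the antisymmetric relation, which thus holds for R. Among
    the partitions with R nonzero take the one of largest leading monomial: the coefficients of its
    [top] in the second set of variables leave only its own term, a nonzero multiple of R. *)
Let R0 (la : intpart) : (size la <= k)%N -> R la = 0.
Proof.
set N := sumn la => lk; apply/eqP/negPn/negP => R1.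
have [b b0 bE] := bilinear N.
have RE m m' : \sum_(mu <- partn N) b mu * ((R mu)@_m * (V mu)@_m' - (V mu)@_m * (R mu)@_m') = 0.
  rewrite -[RHS](bE m m'); apply: eq_bigr => mu _.
  by rewrite /R !mcoeffB !mcoeffZ; ring.
pose good (i : 'I_(size (partn N))) := (size (part_at i) <= k)%N && (R (part_at i) != 0).
have [i0 gi0] : exists i, good i.
  by have [i e] := part_at_surj la; exists i; rewrite /good -e lk.
case: (@arg_maxP _ _ _ i0 good (fun i => part_mnm k (part_at i)) gi0) => i /andP[ik Ri] imax.
case/eqP: Ri; apply/mpolyP => m; rewrite mcoeff0.
have := RE m (top (part_at i)); rewrite big_part_at (bigD1 i) //= big1 ?addr0; last first.
  move=> j ji; have [jk|jk] := ltnP k (size (part_at j)).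
    rewrite /R /V (mac_size0 HP jk) mulr0 mcoeff0 scaler0 subr0.
    rewrite /num big1 => [|I _]; first by rewrite !mcoeff0 !mul0r subr0 mulr0.
    by rewrite /scale_mpoly mmap0 mulr0 scaler0.
  have [-> |Rj] := eqVneq (R (part_at j)) 0; first by rewrite !mcoeff0 mul0r mulr0 subr0 mulr0.
  have ji' : (part_mnm k (part_at j) < part_mnm k (part_at i))%O.
    rewrite lt_neqAle; apply/andP; split; last by apply: imax; rewrite /good jk.
    by apply: contra ji => /eqP/(part_mnm_inj jk ik)/part_at_inj ->.
  have tji : (top (part_at j) < top (part_at i))%O by rewrite ltmc_add2r.
  by rewrite (V_gt jk tji) (R_ge jk (ltW tji)) !mulr0 subr0 mulr0.
rewrite (R_ge ik (lexx _)) mulr0 subr0 => /eqP; rewrite mulf_eq0 mulf_eq0.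
by rewrite (negPf (b0 _ (sumn_part_at i))) (negPf (V_top ik)) orbF => /eqP.
Qed.

Lemma mac_generating (la : intpart) (L : fieldType) (io : {rmorphism K -> L}) (v : 'I_k -> L) :
  (size la <= k)%N -> injective v ->
  \sum_(I : {set 'I_k}) (- io z) ^+ #|I| *
    (vdm (scale_on I (io T) v) / vdm v) * mmap io (scale_on I (io q) v) (P la k) =
  io (\prod_(i < k) (1 - z * T ^+ (k.-1 - i) * q ^+ nth 0%N la i)) * mmap io v (P la k).
Proof.
move=> lk vI; apply: (mulfI (vdm_neq0 vI)); rewrite -mmap_num //.
have /eqP := R0 lk; rewrite subr_eq0 => /eqP ->.
by rewrite mmapZ /V rmorphM /= mmap_vdm mulrCA.
Qed.

End Triangular.

Lemma eq_mmap (R : nzRingType) (S : nzRingType) n (f : R -> S) (v w : 'I_n -> S) p :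
  v =1 w -> mmap f v p = mmap f w p.
Proof.
by move=> vw; apply: eq_bigr => m _; congr (_ * _); apply: eq_bigr => i _; rewrite vw.
Qed.

Lemma coef_prod_scale (F : fieldType) (J : finType) (c : F) (y : J -> F) r :
  (\prod_j (1 - (c * y j) *: 'X))`_r = c ^+ r * (\prod_j (1 - y j *: 'X))`_r.
Proof.
pose H (p p' : {poly F}) := forall r, p`_r = c ^+ r * p'`_r.
suff : H (\prod_j (1 - (c * y j) *: 'X)) (\prod_j (1 - y j *: 'X)) by apply.
apply: (big_ind2 H) => [r'|p1 p2 p3 p4 h1 h2 r'|j _ r'].
- by rewrite coef1; case: r' => [|r'] /=; rewrite ?expr0 ?mulr0 ?mul1r.
- rewrite !coefM mulr_sumr; apply: eq_bigr => i _; rewrite h1 h2.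
  by rewrite mulrACA -exprD subnKC // -ltnS.
- rewrite !coefB !coefZ !coef1 !coefX.
  by case: r' => [|[|r']] /=; rewrite ?expr0 ?expr1 ?(mulr0, mulr1, mul1r, subr0, sub0r, mulrN).
Qed.

Lemma mulr_rotate4 (F : fieldType) (a v m c : F) : a * v * m * c = a * c * v * m.
Proof. by ring. Qed.

Section Eigen.

Variables (K : fieldType) (k : nat) (q t : K) (P : intpart -> symfun K).
Hypothesis HP : is_macdonald q (q / t) P.
Hypothesis charK : [pchar K] =i pred0.
Hypothesis q0 : q != 0.
Hypothesis qn : forall n : nat, q ^+ n.+1 != 1.
Hypothesis Tn : forall n : nat, (q / t) ^+ n.+1 != 1.

Lemma mac_op_eigen (la : intpart) r : (size la <= k)%N ->
  mac_op t q0 r (rfpoly (P la k)) =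
  rfconst k (\prod_(i < k) (1 - ((q / t) ^+ (k.-1 - i) * q ^+ nth 0%N la i) *: 'X))`_r *
  rfpoly (P la k).
Proof.
move=> lk; set E := (\prod_(i < k) _); set f := rfpoly _.
(* [Q] is a polynomial in z whose values at the natural numbers vanish by [mac_generating]. The
   bound N exceeds every |I| and the index r to be extracted. *)
pose N := (r + k).+1.
pose Q : {poly ratfun K k} := \poly_(m < N) mac_op t q0 m f - f *: map_poly (@rfconst K k) E.
suff Q0 : Q = 0.
  have := congr1 (fun p : {poly _} => p`_r) Q0.
  rewrite coefB coefZ coef_map coef_poly ltnS leq_addr coef0 /= => /eqP.
  by rewrite subr_eq0 => /eqP ->; rewrite mulrC.
have charL : [pchar (ratfun K k)] =i pred0 by move=> p; rewrite (fmorph_pchar (@rfconst K k)) charK.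
apply: (poly_natr_eq0 charL) => n.
have -> : n%:R = rfconst k n%:R :> ratfun K k by rewrite rmorph_nat.
rewrite hornerD hornerN hornerZ horner_map horner_poly.
have xI := @rfvar_inj K k.
have := mac_generating HP charK qn Tn n%:R (@rfconst K k) lk xI.
rewrite -rfpolyE -/f => h.
have -> : E.[n%:R] = \prod_(i < k) (1 - n%:R * (q / t) ^+ (k.-1 - i) * q ^+ nth 0%N la i).
  rewrite horner_prod; apply: eq_bigr => i _; rewrite horner_1BZX.
  by rewrite mulrC mulrA.
rewrite [f * _]mulrC -h; apply/eqP; rewrite subr_eq0; apply/eqP.
rewrite [RHS](partition_big (fun I : {set 'I_k} => inord #|I| : 'I_N) xpredT) //=.
apply: eq_bigr => m _; rewrite mulr_suml; apply: eq_big => I.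
  have IN : (#|I| < N)%N.
    by rewrite ltnS -[X in (_ <= r + X)%N]card_ord; apply: leq_trans (max_card _) (leq_addl _ _).
  by apply/eqP/eqP => [e|<-]; [apply: val_inj; rewrite /= inordK | rewrite inordK].
move=> /eqP <-; rewrite shift_rfpoly /mac_coef.
rewrite (eq_mmap _ (w := scale_on I (rfconst k q) (@rfvar K k))); last first.
  move=> i; rewrite mesym1E /scale_on; case: ifP => _; rewrite ?expr1 //.
  by rewrite expr0 rmorph1 mul1r.
by rewrite [in RHS]exprNn; apply: mulr_rotate4.
Qed.

End Eigen.

(** * One-row Macdonald polynomials and the kernel with the alphabet {1} *)

Section OneRow.

Variables (K : fieldType) (q t : K).
Hypothesis charK : [pchar K] =i pred0.
Hypothesis qn : forall n : nat, q ^+ n.+1 != 1.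

Let one : 'I_1 -> K := fun=> 1.

(** For the alphabet {1}, replacing 1 by q multiplies the degree N part of the kernel by q^N, so
    [kernel_shift] becomes a recursion in the degree. *)
Lemma kernel_one_rec k (y : 'I_k -> K) m :
  \sum_(r < m.+1) (1 - t ^+ r * q ^+ (m - r)) * (\prod_j (1 - y j *: 'X))`_r *
     kernel q t one y (m - r)%N = 0.
Proof.
have := @kernel_shift K q t charK qn 1 k one y setT m.+1 m (ltnSn m).
have -> : \prod_(i in [set: 'I_1]) \prod_j (1 - (t * one i * y j) *: 'X) =
    \prod_j (1 - (t * y j) *: 'X).
  rewrite (big_pred1 ord0) => [|i]; last by rewrite inE [i]ord1.
  by apply: eq_bigr => j _; rewrite mulr1.
have -> : \prod_(i in [set: 'I_1]) \prod_j (1 - (one i * y j) *: 'X) = \prod_j (1 - y j *: 'X).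
  rewrite (big_pred1 ord0) => [|i]; last by rewrite inE [i]ord1.
  by apply: eq_bigr => j _; rewrite mul1r.
have kq N : kernel q t (scale_on setT q one) y N = q ^+ N * kernel q t one y N.
  rewrite -exp_coefZ; apply: eq_exp_coef => r; rewrite /psum !big_ord1 /scale_on inE.
  by rewrite exprMn; ring.
rewrite !(mulrC (\poly_(_ < _) _)) !coefM => /eqP; rewrite eq_sym -subr_eq0 -sumrB => /eqP h.
rewrite -[RHS]h; apply: eq_bigr => r _.
rewrite coef_prod_scale !coef_poly !ltnS leq_subr kq.
by ring.
Qed.

(** For y = {1} the recursion has two terms; its solution is the coefficient in the q-binomial
    theorem. *)
Let kernel_one_one (m : nat) : kernel q t one one m = qpoch q t m / qpoch q q m.
Proof.
elim: m => [|m IHm]; first by rewrite /kernel exp_coef0 /= !big_geq // divr1.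
have E : \prod_j (1 - one j *: 'X) = 1 - 'X :> {poly K} by rewrite big_ord1 scale1r.
have := kernel_one_rec one m.+1; rewrite E.
rewrite big_ord_recl big_ord_recl big1 => [|r _]; last first.
  by rewrite coefB coef1 coefX /= subr0 mulr0 mul0r.
rewrite !coefB !coef1 !coefX /= !subn0 subSS subn0 !expr0 expr1.
rewrite IHm /= mul1r subr0 mulr1 sub0r mulrN1 mulNr addr0 => /eqP.
rewrite subr_eq0 !big_nat_recr //= -exprS => /eqP h.
have qm : 1 - q ^+ m.+1 != 0 by rewrite subr_eq0 eq_sym.
have qp : \prod_(0 <= i < m) (1 - q * q ^+ i) != 0.
  by rewrite big_mkord; apply/prodf_neq0 => i _; rewrite subr_eq0 eq_sym -exprS.
apply: (mulfI qm); rewrite h.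
by field; rewrite qm qp.
Qed.

Variable P : intpart -> symfun K.
Hypothesis HP : is_macdonald q t P.
Hypothesis tn : forall n : nat, t ^+ n.+1 != 1.

(** In one variable only partitions with at most one part survive, and P_(m)(1) = 1, so the kernel
    is b P_(m)(y). Taking y = {1} identifies b as (t)_m/(q)_m. *)
Lemma mac_one_row k (y : 'I_k -> K) (m : nat) :
  qpoch q t m / qpoch q q m * (P (row_part m) k).@[y] = kernel q t one y m.
Proof.
have [b b0 kE] := kernel_mac HP charK qn tn m.
have sr : (size (row_part m) <= 1)%N by rewrite /= size_nseq; case: (m).
have P1 : mmap idfun one (P (row_part m) 1) = 1.
  have hm : sumn (row_part m) = m by rewrite /=; case: (m) => //= n; rewrite addn0.
  have := mac_homog HP (row_part m) 1; rewrite hm => /dhomogP H.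
  pose m0 := part_mnm 1 (row_part m).
  have E : P (row_part m) 1 = 'X_[m0].
    apply/mpolyP => n; rewrite mcoeffX; case: eqP => [<-|nm]; first exact: (mac_lead HP).
    apply/eqP; rewrite mcoeff_eq0; apply/negP => /H e; apply: nm; apply/mnmP => i.
    have : mdeg n = mdeg m0 by rewrite e mdeg_part_mnm.
    by rewrite !mdegE !big_ord1 (ord1 i).
  by rewrite E mmapX /mmap1 big_ord1 expr1n.
have kE' l (w : 'I_l -> K) : kernel q t one w m = b (row_part m) * (P (row_part m) l).@[w].
  have -> := kE K idfun 1%N l one w.
  rewrite (bigD1_seq (row_part m)) ?partn_uniq //=; last first.
    by rewrite mem_partn /=; case: (m) => //= n; rewrite addn0.
  rewrite P1 mulr1 big_seq_cond big1 ?addr0 // => la; rewrite mem_partn => /andP[/eqP lm lar].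
  rewrite (mac_size0 HP) ?mmap0 ?mulr0 ?mul0r // ltnNge; apply: contra lar => l1.
  apply/eqP; apply: intpart_inj => /=; case: la l1 lm => -[|a [|//]] /= h _ <- //.
  by case: a h => // a _; rewrite addn0.
rewrite -kernel_one_one !kE'; have -> : (P (row_part m) 1).@[one] = 1 by exact: P1.
by rewrite mulr1.
Qed.

End OneRow.

(** * The field C(q,t) *)

(** The powers of t/q and q/t combine to (t/q)^r, and (t/q)^r ((q/t)^r - q^m) = 1 - t^r q^(m-r): the
    weights of the Wronski relation become those of [kernel_one_rec]. *)
Lemma wronski_scalar (F : fieldType) (q t : F) (k r m : nat) (e g : F) :
  q != 0 -> t != 0 -> (0 < k)%N -> (r <= m)%N ->
  (t / q) ^+ (k * r) * ((q / t) ^+ r - q ^+ m) * ((q / t) ^+ k.-1 ^+ r * e) * g =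
  (1 - t ^+ r * q ^+ (m - r)) * e * g.
Proof.
move=> q0 t0 k0 rm.
have s0 : t / q != 0 by rewrite mulf_neq0 ?invr_eq0.
have -> : q / t = (t / q)^-1 by rewrite invf_div.
have -> : t ^+ r * q ^+ (m - r) = (t / q) ^+ r * q ^+ m.
  by rewrite -{2}(subnKC rm) exprD expr_div_n; field; rewrite expf_neq0.
have -> : (t / q) ^+ (k * r) = (t / q) ^+ r * (t / q) ^+ (k.-1 * r).
  by rewrite -exprD -mulSn prednK.
rewrite !exprVn -exprM.
have := expf_neq0 r s0; have := expf_neq0 (k.-1 * r) s0.
by move: ((t / q) ^+ r) ((t / q) ^+ (k.-1 * r)) (q ^+ m) => a b c b0 a0; field; rewrite a0 b0.
Qed.

Section Eigenvalue.

Variables (K : fieldType) (k : nat) (q t : K) (P P' : intpart -> symfun K).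
Hypotheses (HP : is_macdonald q t P) (HP' : is_macdonald q (q / t) P').
Hypothesis charK : [pchar K] =i pred0.
Hypotheses (q0 : q != 0) (t0 : t != 0).
Hypothesis qn : forall n : nat, q ^+ n.+1 != 1.
Hypothesis tn : forall n : nat, t ^+ n.+1 != 1.
Hypothesis Tn : forall n : nat, (q / t) ^+ n.+1 != 1.
Hypothesis tq : forall n : int, t * q ^ n != 1.

(** With T = q/t, T^(k-1-i) q^(mu_i) is T^(k-1) times the evaluation point y_i, so the eigenvalue of
    M_r is T^((k-1) r) times the coefficient of X^r in the product of the 1 - y_i X. *)
Lemma Dop_macdonald d (mu : intpart) : (0 < k)%N -> (size mu <= k)%N ->
  Dop q t d (rfpoly (P' mu k)) =
  rfconst k (qpoch q t d / qpoch q q d *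
     (P (row_part d) k).@[fun i : 'I_k => q ^+ nth 0%N mu i * (t / q) ^+ i]) *
  rfpoly (P' mu k).
Proof.
move=> k0 muk; set y := fun i : 'I_k => _.
pose n r := (\prod_(i < k) (1 - ((q / t) ^+ (k.-1 - i) * q ^+ nth 0%N mu i) *: 'X))`_r.
pose g (m : nat) := qpoch q t m / qpoch q q m * (P (row_part m) k).@[y].
have nE r : n r = ((q / t) ^+ k.-1) ^+ r * (\prod_j (1 - y j *: 'X))`_r.
  rewrite -coef_prod_scale; congr (polyseq _)`_r; apply: eq_bigr => i _.
  congr (1 - _ *: _); rewrite mulrCA [RHS]mulrC; congr (_ * _).
  have ik : (i <= k.-1)%N by rewrite -ltnS prednK.
  have -> : (q / t) ^+ k.-1 = (q / t) ^+ (k.-1 - i) * (q / t) ^+ i by rewrite -exprD subnK.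
  have qt : q / t * (t / q) = 1 by field; rewrite q0 t0.
  by rewrite -mulrA -exprMn qt expr1n mulr1.
have gE m : g m = kernel q t (fun _ : 'I_1 => 1) y m by apply: mac_one_row.
apply: (@Dop_eigen K k q t charK q0 t0 qn tq (rfpoly (P' mu k)) n g) => //.
- by move=> r; apply: mac_op_eigen.
- by rewrite gE /kernel exp_coef0.
- rewrite nE expr0 mul1r -horner_coef0 horner_prod big1 // => i _.
  by rewrite horner_1BZX mulr0 subr0.
move=> m m0; rewrite -[RHS](kernel_one_rec t charK qn y m); apply: eq_bigr => r _.
by rewrite nE gE wronski_scalar // -ltnS.
Qed.

End Eigenvalue.

(* Imported late: it turns [i] into a keyword and breaks reflection views. *)
From mathcomp Require Import complex reals.

Section BaseField.

Variable R : realType.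
Let q := Cqt_q R.
Let t := Cqt_t R.

(** The genericity conditions on q and t below all follow from the distinctness of monomials. *)
Lemma Cqt_monomial a b c d : q ^+ a * t ^+ b = q ^+ c * t ^+ d -> a = c /\ b = d.
Proof.
pose m (a b : nat) : 'X_{1..2} := (U_(ord0) *+ a + U_(ord_max) *+ b)%MM.
have E a' b' : q ^+ a' * t ^+ b' = FracField.tofrac 'X_[m a' b'].
  by rewrite /m mpolyXD rmorphM -!mpolyXn !rmorphXn.
rewrite !E => /eqP; rewrite tofrac_eq => /eqP/(congr1 (mcoeff (m a b))).
rewrite !mcoeffX eqxx; case: eqP => [e _|_ /eqP]; last by rewrite oner_eq0.
have h i : m c d i = m a b i by rewrite e.
move: (h ord0) (h ord_max); rewrite !mnmDE !mulmnE !mnm1E !eqxx /=; lia.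
Qed.

Lemma Cqt_q_neq0 : q != 0.
Proof.
rewrite tofrac_eq0; apply/eqP => /(congr1 (mcoeff U_(ord0)))/eqP.
by rewrite mcoeffXU eqxx mcoeff0 oner_eq0.
Qed.

Lemma Cqt_t_neq0 : t != 0.
Proof.
rewrite tofrac_eq0; apply/eqP => /(congr1 (mcoeff U_(ord_max)))/eqP.
by rewrite mcoeffXU eqxx mcoeff0 oner_eq0.
Qed.

Lemma Cqt_pchar : [pchar Cqt R] =i pred0.
Proof.
move=> p; rewrite (fmorph_pchar (@FracField.tofrac {mpoly R[i][2]} \o @mpolyC 2 R[i])).
exact: Num.Theory.pchar_num.
Qed.

Lemma Cqt_qn n : q ^+ n.+1 != 1.
Proof.
apply/eqP => h; have /Cqt_monomial[] : q ^+ n.+1 * t ^+ 0 = q ^+ 0 * t ^+ 0; last by [].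
by rewrite !expr0 !mulr1.
Qed.

Lemma Cqt_tn n : t ^+ n.+1 != 1.
Proof.
apply/eqP => h; have /Cqt_monomial[] : q ^+ 0 * t ^+ n.+1 = q ^+ 0 * t ^+ 0; last by [].
by rewrite !expr0 !mul1r.
Qed.

Lemma Cqt_Tn n : (q / t) ^+ n.+1 != 1.
Proof.
apply/eqP => h; have /Cqt_monomial[] : q ^+ n.+1 * t ^+ 0 = q ^+ 0 * t ^+ n.+1; last by [].
rewrite !expr0 mul1r mulr1 -[LHS](@divfK _ (t ^+ n.+1)) ?expf_neq0 ?Cqt_t_neq0 //.
by rewrite -expr_div_n h mul1r.
Qed.

Lemma Cqt_tq (n : int) : t * q ^ n != 1.
Proof.
apply/eqP; case: n => n h.
  have /Cqt_monomial[] : q ^+ n * t ^+ 1 = q ^+ 0 * t ^+ 0; last by [].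
  by rewrite !expr0 mulr1 expr1 mulrC.
have /Cqt_monomial[] : q ^+ 0 * t ^+ 1 = q ^+ n.+1 * t ^+ 0; last by [].
rewrite !expr0 mul1r mulr1 expr1.
have e : t / q ^+ n.+1 = 1 by exact: h.
by rewrite -[LHS](@divfK _ (q ^+ n.+1)) ?expf_neq0 ?Cqt_q_neq0 // e mul1r.
Qed.

End BaseField.

Theorem theorem3 (R : realType) (k : nat) (k_ge1 : (1 <= k)%N) :
  let q := Cqt_q R in
  let t := Cqt_t R in
  (forall (d e : nat) (f : ratfun (Cqt R) k),
      Dop q t d (Dop q t e f) = Dop q t e (Dop q t d f))
  /\ (forall P P' : intpart -> symfun (Cqt R),
      is_macdonald q t P -> is_macdonald q (q / t) P' ->
      forall (d : nat) (mu : intpart), (size mu <= k)%N ->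
        Dop q t d (rfpoly (P' mu k))
        = rfconst k (qpoch q t d / qpoch q q d
                     * (P (row_part d) k).@[fun i : 'I_k =>
                          q ^+ nth 0%N mu i * (t / q) ^+ i])
          * rfpoly (P' mu k)).
Proof.
move=> q t; split=> [d e f|P P' HP HP' d mu muk].
  exact: (Dop_comm (@Cqt_pchar R) (@Cqt_q_neq0 R) (@Cqt_t_neq0 R) (@Cqt_qn R) (@Cqt_tq R)).
exact: (Dop_macdonald HP HP' (@Cqt_pchar R) (@Cqt_q_neq0 R) (@Cqt_t_neq0 R)
  (@Cqt_qn R) (@Cqt_tn R) (@Cqt_Tn R) (@Cqt_tq R) d k_ge1 muk).
Qed.
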